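(* Let $M$ be a closed smooth manifold and let $\mathcal{M}$ be the space of all $C^{2}$ Riemannian metrics on $M$. For any constant $\kappa \in \mathbb{R}$, the subspace $$\left\{ g \in \mathcal{M} \ \middle|\ \int_{M} R(g)\, d\mathrm{vol}_{g} \ge \kappa \right\} \subset \mathcal{M}$$ is closed in $\mathcal{M}$ with respect to the $C^{0} \cap W^{1,2}$-topology.
   Context: $R(g)$ denotes the scalar curvature and $d\mathrm{vol}_g$ the Riemannian volume measure of $g$. Closed manifold means compact without boundary. The $C^0\cap W^{1,2}$-topology on $\mathcal{M}$ is the one in which $g_i\to g$ means that $\sup_M|g_i-g|_g\to0$ and that $g_i$ and all its first weak derivatives converge respectively to those of $g$ in the $L^2$-norm of $g$ (equivalently, of any fixed reference metric). *)

(* Defs.v *)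
From HB Require Import structures.
From mathcomp Require Import all_boot all_order all_algebra finmap.
From mathcomp Require Import all_classical all_reals all_analysis.

Set Implicit Arguments.
Unset Strict Implicit.
Unset Printing Implicit Defensive.

Import Order.TTheory GRing.Theory Num.Theory.
Import numFieldNormedType.Exports.

Local Open Scope classical_set_scope.
Local Open Scope ring_scope.

(** ** Calculus and Lebesgue measure on R^n *)

Definition pderive (R : realType) n (a : 'I_n) (f : 'rV[R]_n -> R) :
    'rV[R]_n -> R :=
  fun x => 'D_(delta_mx 0 a) f x.

(* Meant for open U, where continuity and derivatives at the points of U do not
   depend on the values of f outside U. *)
Fixpoint Ck (R : realType) n (k : nat) (U : set 'rV[R]_n) (f : 'rV[R]_n -> R) :
    Prop :=
  (forall x, U x -> {for x, continuous f}) /\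
  match k with
  | 0 => True
  | k'.+1 => forall a : 'I_n,
      (forall x, U x -> derivable f x (delta_mx 0 a)) /\ Ck k' U (pderive a f)
  end.

Definition smooth (R : realType) n (U : set 'rV[R]_n) (f : 'rV[R]_n -> R) :=
  forall k, Ck k U f.

Definition borel (T : ptopologicalType) := g_sigma_algebraType (@open T).

(* n-dimensional Lebesgue measure on Borel sets, by slicing along the first
   coordinate (the formula of [product_measure1]). *)
Fixpoint lebesgue_rV (R : realType) n : set (borel 'rV[R]_n) -> \bar R :=
  match n with
  | 0 => fun A => (\1_A (0 : 'rV[R]_0))%:E
  | m.+1 => fun A =>
      (\int[lebesgue_measure]_(t in [set: R])
         lebesgue_rV [set v : 'rV[R]_m | A (row_mx t%:M v : 'rV[R]_(1 + m))])%E
  end.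

(** ** Smooth manifolds *)

(* A homeomorphism between an open subset of M and an open subset of R^n; only
   the values of [cmap] on [cdom] and of [cinv] on its image are relevant. *)
Record chart (R : realType) n (M : topologicalType) := Chart {
  cdom : set M ;
  cmap : M -> 'rV[R]_n ;
  cinv : 'rV[R]_n -> M ;
  cdom_open : open cdom ;
  cimg_open : open (cmap @` cdom) ;
  cmapK : forall p, cdom p -> cinv (cmap p) = p ;
  cmap_continuous : {within cdom, continuous cmap} ;
  cinv_continuous : {within cmap @` cdom, continuous cinv} }.

Definition cimg (R : realType) n (M : topologicalType) (c : chart R n M) :
    set 'rV[R]_n :=
  cmap c @` cdom c.

(* b-th component of the coordinate change c' o c^-1 *)
Definition transition (R : realType) n (M : topologicalType)
    (c c' : chart R n M) (b : 'I_n) : 'rV[R]_n -> R :=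
  fun x => cmap c' (cinv c x) 0 b.

(* The carrier is pointed, hence nonempty, as all measurable types of the
   library are. *)
Record smooth_manifold (R : realType) (n : nat) := SmoothManifold {
  carrier :> ptopologicalType ;
  mf_hausdorff : hausdorff_space carrier ;
  mf_second_countable : @second_countable carrier ;
  cindex : choiceType ;
  charts : cindex -> chart R n carrier ;
  charts_cover : forall p, exists i, cdom (charts i) p ;
  charts_smooth : forall i j b,
    smooth (cmap (charts i) @` (cdom (charts i) `&` cdom (charts j)))
           (transition (charts i) (charts j) b) }.

Record closed_manifold (R : realType) (n : nat) := ClosedManifold {
  manifold :> smooth_manifold R n ;
  manifold_compact : compact [set: manifold] }.

Definition chart_at R n (M : smooth_manifold R n) (p : M) : cindex M :=
  projT1 (cid (charts_cover p)).

Definition coord R n (M : smooth_manifold R n) (p : M) : 'rV[R]_n :=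
  cmap (charts (chart_at p)) p.

(** ** C^2 Riemannian metrics *)

(* A metric is given by its component matrices (g_ab) in the charts of the
   atlas, subject to the transformation law of covariant 2-tensors; they are
   set to 0 outside the image of the chart so that each tensor field has a
   unique representation. *)
Record riem_metric R n (M : smooth_manifold R n) := RiemMetric {
  comp :> cindex M -> 'rV[R]_n -> 'M[R]_n ;
  comp_sym : forall i x, cimg (charts i) x -> (comp i x)^T = comp i x ;
  comp_pos : forall i x (v : 'rV[R]_n), cimg (charts i) x -> v != 0 ->
    0 < (v *m comp i x *m v^T) 0 0 ;
  comp_C2 : forall i a b, Ck 2 (cimg (charts i)) (fun x => comp i x a b) ;
  comp_change : forall i j p, cdom (charts i) p -> cdom (charts j) p ->
    let x := cmap (charts i) p in
    let J := \matrix_(a < n, b < n)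
               pderive a (transition (charts i) (charts j) b) x in
    comp i x = J *m comp j (cmap (charts j) p) *m J^T ;
  comp_out : forall i x, ~ cimg (charts i) x -> comp i x = 0 }.

(** ** Local formulas, for a metric G in a chart *)

(* Gamma^c_ab *)
Definition christoffel (R : realType) n (G : 'rV[R]_n -> 'M[R]_n)
    (c a b : 'I_n) : 'rV[R]_n -> R :=
  fun x => 2^-1 * \sum_(d < n) invmx (G x) c d *
    (pderive a (fun y => G y d b) x + pderive b (fun y => G y d a) x
     - pderive d (fun y => G y a b) x).

(* Ric_bc = d_a Gamma^a_bc - d_b Gamma^a_ac + Gamma^a_ae Gamma^e_bc
            - Gamma^a_be Gamma^e_ac, positive on round spheres *)
Definition ricci (R : realType) n (G : 'rV[R]_n -> 'M[R]_n) (b c : 'I_n) :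
    'rV[R]_n -> R :=
  fun x => \sum_(a < n)
    (pderive a (christoffel G a b c) x - pderive b (christoffel G a a c) x
     + \sum_(e < n) (christoffel G a a e x * christoffel G e b c x
                     - christoffel G a b e x * christoffel G e a c x)).

Definition scalar_local (R : realType) n (G : 'rV[R]_n -> 'M[R]_n)
    (x : 'rV[R]_n) : R :=
  \sum_(b < n) \sum_(c < n) invmx (G x) b c * ricci G b c x.

(* (nabla_c T)_ab for the Levi-Civita connection of G *)
Definition nabla (R : realType) n (G T : 'rV[R]_n -> 'M[R]_n) (c : 'I_n)
    (x : 'rV[R]_n) : 'M[R]_n :=
  \matrix_(a < n, b < n)
    (pderive c (fun y => T y a b) x
     - \sum_(d < n) (christoffel G d c a x * T x d b
                     + christoffel G d c b x * T x a d)).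

(* G^{ac} G^{bd} S_ab T_cd *)
Definition inner2 (R : realType) n (G S T : 'M[R]_n) : R :=
  \tr (invmx G *m S *m invmx G *m T^T).

(* The same for 3-tensors, the first slot being the argument in 'I_n. *)
Definition inner3 (R : realType) n (G : 'M[R]_n) (S T : 'I_n -> 'M[R]_n) : R :=
  \sum_(c < n) \sum_(c' < n) invmx G c c' * inner2 G (S c) (T c').

(** ** Geometric quantities on M *)

Definition scalar_curvature R n (M : smooth_manifold R n) (g : riem_metric M)
    (p : M) : R :=
  scalar_local (g (chart_at p)) (coord p).

Lemma finite_atlas_subproof R n (M : closed_manifold R n) :
  exists s : seq (cindex M),
    forall p : M, exists2 i, i \in s & cdom (charts i) p.
Proof.
have := @manifold_compact R n M; rewrite compact_cover => cM.
have [|p _|D _ covD] := cM (cindex M) setT (fun i => cdom (charts i)).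
- by move=> i _; exact: cdom_open.
- by have [i pi] := charts_cover p; exists i.
- by exists (enum_fset D) => p; have [i /= iD pi] := covD p I; exists i.
Qed.

Definition finite_atlas R n (M : closed_manifold R n) : seq (cindex M) :=
  projT1 (cid (finite_atlas_subproof M)).

(* The Borel set A is cut into pieces lying in a single chart each, on which
   the volume is the integral of sqrt (det g_ab). By the change of variables
   formula the result does not depend on the list of charts, as long as their
   domains cover A. *)
Fixpoint volume_along R n (M : closed_manifold R n) (g : riem_metric M)
    (s : seq (cindex M)) (A : set M) : \bar R :=
  match s with
  | [::] => 0%E
  | i :: s' =>
      (\int[@lebesgue_rV R n]_(x in
          (cmap (charts i) @` (A `&` cdom (charts i)) : set (borel 'rV[R]_n)))
         (Num.sqrt (\det (g i x)))%:E
       + volume_along g s' (A `\` cdom (charts i)))%E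
  end.

Definition volume R n (M : closed_manifold R n) (g : riem_metric M) :
    set (borel M) -> \bar R :=
  volume_along g (finite_atlas M).

Definition total_scalar_curvature R n (M : closed_manifold R n)
    (g : riem_metric M) : \bar R :=
  (\int[volume g]_p (scalar_curvature g p)%:E)%E.

(** ** The topology of C^0 and W^{1,2} convergence on the space of metrics *)

Definition diff_comp R n (M : smooth_manifold R n) (g h : riem_metric M)
    (i : cindex M) (x : 'rV[R]_n) : 'M[R]_n :=
  h i x - g i x.

(* |h - g|_g at p *)
Definition diff_norm R n (M : smooth_manifold R n) (g h : riem_metric M)
    (p : M) : R :=
  let i := chart_at p in let x := coord p in
  Num.sqrt (inner2 (g i x) (diff_comp g h i x) (diff_comp g h i x)).

(* |nabla^g (h - g)|_g at p. Metrics being C^2, their weak first derivatives are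
   the classical ones; the reference connection used is that of g. *)
Definition nabla_diff_norm R n (M : smooth_manifold R n) (g h : riem_metric M)
    (p : M) : R :=
  let i := chart_at p in let x := coord p in
  let D c := nabla (g i) (diff_comp g h i) c x in
  Num.sqrt (inner3 (g i x) D D).

Definition C0_dist R n (M : smooth_manifold R n) (g h : riem_metric M) :
    \bar R :=
  ereal_sup [set (diff_norm g h p)%:E | p in [set: M]].

Definition L2_norm R n (M : closed_manifold R n) (g : riem_metric M)
    (f : M -> R) : \bar R :=
  ((\int[volume g]_p (f p ^+ 2)%:E) `^ 2^-1)%E.

Definition C0W12_ball R n (M : closed_manifold R n) (g : riem_metric M)
    (e : R) : set (riem_metric M) :=
  [set h | [/\ (C0_dist g h < e%:E)%E,
               (L2_norm g (diff_norm g h) < e%:E)%E &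
               (L2_norm g (nabla_diff_norm g h) < e%:E)%E]].

(* This is the finest topology in which C0_dist g (h_k) -> 0 and the two L^2
   distances -> 0 imply h_k -> g, see closed_metricsP. *)
Definition C0W12_open R n (M : closed_manifold R n)
    (O : set (riem_metric M)) : Prop :=
  forall g, O g -> exists2 e : R, 0 < e & C0W12_ball g e `<=` O.

Definition metrics R n (M : closed_manifold R n) := riem_metric M.

Section topology.
Context (R : realType) (n : nat) (M : closed_manifold R n).

HB.instance Definition _ := gen_eqMixin (metrics M).
HB.instance Definition _ := gen_choiceMixin (metrics M).

Let openT : @C0W12_open R n M setT.
Proof. by move=> g _; exists 1. Qed.

Let openI : setI_closed (@C0W12_open R n M).
Proof.
move=> A B oA oB g [/oA[e e0 eA] /oB[f f0 fB]].
exists (Num.min e f); first by rewrite lt_min e0.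
move=> h [h1 h2 h3]; split; [apply: eA|apply: fB]; split;
  by [apply: lt_le_trans h1 _; rewrite lee_fin ge_min lexx ?orbT
     |apply: lt_le_trans h2 _; rewrite lee_fin ge_min lexx ?orbT
     |apply: lt_le_trans h3 _; rewrite lee_fin ge_min lexx ?orbT].
Qed.

Let open_bigU (I : Type) (f : I -> set (riem_metric M)) :
  (forall i, C0W12_open (f i)) -> C0W12_open (\bigcup_i f i).
Proof.
move=> fo g [i _ /fo[e e0 ef]]; exists e => // h /ef fh.
by exists i.
Qed.

HB.instance Definition _ :=
  @isOpenTopological.Build (metrics M) (@C0W12_open R n M)
    openT openI open_bigU.

End topology.

(* [closed] means sequentially closed for C^0 and W^{1,2} convergence. *)
Lemma closed_metricsP (R : realType) n (M : closed_manifold R n)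
    (A : set (metrics M)) :
  closed A <-> forall (u : nat -> metrics M) (g : metrics M),
    (forall k, A (u k)) ->
    (C0_dist g (u k) @[k --> \oo] --> 0%E) ->
    (L2_norm g (diff_norm g (u k)) @[k --> \oo] --> 0%E) ->
    (L2_norm g (nabla_diff_norm g (u k)) @[k --> \oo] --> 0%E) -> A g.
Proof.
have ltN (x : (\bar R)^nat) (e : R) : 0 < e -> x @ \oo --> 0%E ->
    \forall k \near \oo, (x k < e%:E)%E.
  move=> e0 x0; apply: (x0 [set y | (y < e%:E)%E]).
  apply: open_nbhs_nbhs; split; first exact: open_ereal_lt_ereal.
  by rewrite /= lte_fin.
have to0 (x : (\bar R)^nat) : (forall k, 0 <= x k)%E ->
    (forall k, x k < (k.+1%:R^-1)%:E)%E -> x @ \oo --> 0%E.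
  move=> x0 xlt; apply: (@squeeze_cvge _ _ _ _ (cst 0%E) _
      (fun k => (k.+1%:R^-1)%:E)).
  - by near=> k; rewrite x0 ltW.
  - exact: cvg_cst.
  - by apply: cvg_EFin; [near=> k|exact: cvg_harmonic].
have C00 (g h : metrics M) : (0 <= C0_dist g h)%E.
  apply: (@le_trans _ _ (diff_norm g h point)%:E).
    by rewrite lee_fin sqrtr_ge0.
  by apply: ereal_sup_ubound; exists point.
rewrite -openC.
have -> : open (~` A) <-> C0W12_open (~` A : set (riem_metric M)) by [].
split=> [oA u g Au c0 c1 c2|sA g nAg].
  apply: contrapT => /oA[e e0 eA].
  have : \forall k \near \oo, C0W12_ball g e (u k).
    near=> k; split; near: k; exact: ltN.
  by move=> [k _ /(_ k (leqnn k)) /eA]; apply; exact: Au.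
apply: contrapT => noball.
have H (k : nat) : exists h, A h /\ C0W12_ball g k.+1%:R^-1 h.
  apply: contrapT => nh; apply: noball.
  exists k.+1%:R^-1 => [|h gh Ah]; first by rewrite invr_gt0.
  by apply: nh; exists h.
have [u uP] := choice H.
apply: nAg; apply: (sA u) => [k|||]; first by have [] := uP k.
- by apply: to0 => k; [exact: C00|have [_ []] := uP k].
- by apply: to0 => k; [exact: poweR_ge0|have [_ []] := uP k].
- by apply: to0 => k; [exact: poweR_ge0|have [_ []] := uP k].
Unshelve. all: by end_near. Qed.

(* Main.v *)
(** The divergence structure of the scalar curvature turns [phi R sqrt(det g)],
    for a C^1 weight [phi] with compact support in a chart, into a term
    [weak_scalar] that only involves [g], [g^-1] and first derivatives of [g],
    and is quadratic in the latter, plus a divergence. With a C^1 partition of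
    unity the total scalar curvature is therefore a finite sum of integrals of
    such terms. On a compact subset of a chart, where the C^0 distance controls
    [h - g] and the covariant derivative of [h - g] controls the difference of
    first derivatives up to the C^0 distance, the terms of [g] and [h] differ by
    at most [delta + C |nabla (h - g)|^2]. So the total scalar curvature is
    continuous for the C^0 and W^{1,2} topology, and its superlevel sets are
    closed.

    The volume of [g] does not depend on the charts: on a small dyadic cube a
    coordinate change is linear up to a factor [1 + eta], and comparing two
    measures on small dyadic cubes compares them on open sets. *)

Require Import Defs.
From HB Require Import structures.
From mathcomp Require Import all_boot all_order all_algebra.
From mathcomp Require Import fingroup perm.
From mathcomp Require Import all_classical all_reals all_analysis.
From mathcomp Require Import measurable_realfun.
From mathcomp Require Import ring lra.

Set Implicit Arguments.
Unset Strict Implicit.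
Unset Printing Implicit Defensive.

Import Order.TTheory GRing.Theory Num.Theory.
Import numFieldNormedType.Exports.

Local Open Scope classical_set_scope.
Local Open Scope ring_scope.

(** * Calculus on R^n *)

(** The curvature contains second derivatives of the metric, which W^{1,2} does not see; once they
    are removed, first derivatives occur to the second power, the highest that L^2 convergence
    absorbs. Hence a calculus of degrees, [approx_deg]: with [metric_var] measuring the difference
    of first derivatives at a point, inverses and determinants have degree 0 and connection
    coefficients degree 1. Terms linear in [metric_var] are split by completing a square, so that
    only the finite measure of a compact set is used. The weak form is classical: metrics are C^2,
    so connection coefficients are C^1 and the flux can be differentiated. The volume cuts the
    manifold along a list of charts, whereas integration by parts needs the whole support of a
    weight in one chart; curvature and norms are evaluated at each point in a chart chosen for that
    point. Both call for independence of the chart: of the curvature by the transformation law of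
    the connection, which follows from its uniqueness, and of the volume first on open sets, where
    cubes can be compared, then on Borel sets by uniqueness of measures. *)

Section Ck_basic.
Context {R : realType} {n : nat}.
Implicit Types (U V : set 'rV[R]_n) (f g : 'rV[R]_n -> R) (k : nat).

Lemma Ck_continuous k U f x : Ck k U f -> U x -> {for x, continuous f}.
Proof. by case: k => [|k] [cf _]; exact: cf. Qed.

Lemma Ck_derivable k U f a x :
  Ck k.+1 U f -> U x -> derivable f x (delta_mx 0 a).
Proof. by move=> [_ /(_ a)[df _]]; exact: df. Qed.

Lemma Ck_pderive k U f a : Ck k.+1 U f -> Ck k U (pderive a f).
Proof. by move=> [_ /(_ a)[]]. Qed.

Lemma Ck_pred k U f : Ck k.+1 U f -> Ck k U f.
Proof.
elim: k f => [|k IH] f [cf df]; first by split.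
split=> // a; split; first by have [] := df a.
by apply: IH; have [] := df a.
Qed.

Lemma Ck_sub k U V f : V `<=` U -> Ck k U f -> Ck k V f.
Proof.
move=> VU; elim: k f => [|k IH] f [cf df]; split=> //.
- by move=> x /VU; exact: cf.
- by move=> x /VU; exact: cf.
- move=> a; have [d1 d2] := df a; split; last exact: IH.
  by move=> x /VU; exact: d1.
Qed.

Lemma near_continuous (T S : topologicalType) (f g : T -> S) (x : T) :
  (\forall y \near x, f y = g y) -> {for x, continuous f} ->
  {for x, continuous g}.
Proof.
move=> fg cf; rewrite /prop_for /continuous_at -(nbhs_singleton fg).
by apply: cvg_trans cf; apply: near_eq_cvg.
Qed.

Lemma near_forall_fin (I : finType) (T : topologicalType) (x : T)
    (P : I -> T -> Prop) :
  (forall i, \forall y \near x, P i y) -> \forall y \near x, forall i, P i y.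
Proof. exact: filter_forall. Qed.

Lemma near_open (T : topologicalType) (U : set T) (x : T) (P : T -> Prop) :
  open U -> U x -> (forall y, U y -> P y) -> \forall y \near x, P y.
Proof.
by move=> oU Ux UP; apply: filterS UP _; exact: open_nbhs_nbhs.
Qed.

(** Being C^k is local: [g] agrees with [f] on the open set [V], and so do its derivatives.
    Functions that are zero off a compact set are glued in this way. *)
Lemma Ck_near k U f :
  (forall x, U x -> exists V, [/\ open V, V x &
     exists2 g, Ck k V g & forall y, V y -> g y = f y]) ->
  Ck k U f.
Proof.
elim: k f => [|k IH] f H; (split=> [x Ux|]).
- have [V [oV Vx [g Cg gf]]] := H _ Ux.
  by apply: near_continuous (Ck_continuous Cg Vx); exact: near_open gf.
- by [].
- have [V [oV Vx [g Cg gf]]] := H _ Ux.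
  by apply: near_continuous (Ck_continuous Cg Vx); exact: near_open gf.
- move=> a; split=> [x Ux|].
    have [V [oV Vx [g Cg gf]]] := H _ Ux.
    by apply: (@near_eq_derivable _ _ _ g); [exact: near_open gf|exact: Ck_derivable Cg Vx].
  apply: IH => x Ux; have [V [oV Vx [g Cg gf]]] := H _ Ux.
  exists V; split=> //; exists (pderive a g); first exact: Ck_pderive.
  by move=> y Vy; apply: near_eq_derive; exact: near_open gf.
Qed.

Lemma Ck_ext k U f g : open U -> (forall y, U y -> g y = f y) ->
  Ck k U g -> Ck k U f.
Proof. by move=> oU gf Cg; apply: Ck_near => x Ux; exists U; split=> //; exists g. Qed.

Lemma pderive_ext U f g a x : open U -> U x -> (forall y, U y -> f y = g y) ->
  pderive a f x = pderive a g x.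
Proof. by move=> oU Ux fg; apply: near_eq_derive; exact: near_open fg. Qed.

Lemma pderive_cst (c : R) a x : pderive a (fun _ : 'rV[R]_n => c) x = 0.
Proof. exact: derive_cst. Qed.

Lemma Ck_cst k U (c : R) : Ck k U (fun=> c).
Proof.
elim: k c => [|k IH] c; (split=> [x _|]; first exact: cst_continuous) => // a.
split=> [x _|]; first exact: derivable_cst.
have -> : pderive a (fun=> c) = (fun=> 0) by apply/funext => x; exact: pderive_cst.
exact: IH.
Qed.

Lemma Ck_add k U f g : open U -> Ck k U f -> Ck k U g ->
  Ck k U (fun x => f x + g x).
Proof.
move=> oU; elim: k f g => [|k IH] f g Cf Cg; (split=> [x Ux|];
  first by apply: continuousD;
    [exact: Ck_continuous Cf Ux|exact: Ck_continuous Cg Ux]) => // a.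
split=> [x Ux|].
  by apply: derivableD; [exact: Ck_derivable Cf Ux|exact: Ck_derivable Cg Ux].
apply: (Ck_ext oU _ (IH _ _ (Ck_pderive a Cf) (Ck_pderive a Cg))) => x Ux.
rewrite -[RHS]/('D_(delta_mx 0 a) (f + g) x) deriveD//.
- exact: Ck_derivable Cf Ux.
- exact: Ck_derivable Cg Ux.
Qed.

Lemma pderiveD f g a x : derivable f x (delta_mx 0 a) ->
  derivable g x (delta_mx 0 a) ->
  pderive a (fun y => f y + g y) x = pderive a f x + pderive a g x.
Proof. by move=> df dg; rewrite -deriveD. Qed.

Lemma pderiveM f g a x : derivable f x (delta_mx 0 a) ->
  derivable g x (delta_mx 0 a) ->
  pderive a (fun y => f y * g y) x = pderive a f x * g x + f x * pderive a g x.
Proof.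
move=> df dg; apply: etrans (deriveM df dg) _; rewrite addrC.
by congr (_ + _); rewrite [LHS]mulrC.
Qed.

Lemma Ck_mul k U f g : open U -> Ck k U f -> Ck k U g ->
  Ck k U (fun x => f x * g x).
Proof.
move=> oU; elim: k f g => [|k IH] f g Cf Cg; (split=> [x Ux|];
  first by apply: continuousM;
    [exact: Ck_continuous Cf Ux|exact: Ck_continuous Cg Ux]) => // a.
split=> [x Ux|].
  by apply: derivableM; [exact: Ck_derivable Cf Ux|exact: Ck_derivable Cg Ux].
have H1 := IH _ _ (Ck_pderive a Cf) (Ck_pred Cg).
have H2 := IH _ _ (Ck_pred Cf) (Ck_pderive a Cg).
apply: (Ck_ext oU _ (Ck_add oU H1 H2)) => x Ux.
by rewrite pderiveM//; [exact: Ck_derivable Cf Ux|exact: Ck_derivable Cg Ux].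
Qed.

Lemma Ck_opp k U f : open U -> Ck k U f -> Ck k U (fun x => - f x).
Proof.
move=> oU Cf; apply: (Ck_ext oU _ (Ck_mul oU (Ck_cst k U (-1)) Cf)) => x _.
by rewrite mulN1r.
Qed.

Lemma pderiveN f a x : derivable f x (delta_mx 0 a) ->
  pderive a (fun y => - f y) x = - pderive a f x.
Proof. by move=> df; rewrite -[LHS]/('D_(delta_mx 0 a) (- f) x) deriveN. Qed.

Lemma Ck_sum k U (I : Type) (s : seq I) (P : pred I) (F : I -> 'rV[R]_n -> R) :
  open U -> (forall i, Ck k U (F i)) ->
  Ck k U (fun x => \sum_(i <- s | P i) F i x).
Proof.
move=> oU CF; elim: s => [|i s IH].
  by apply: (Ck_ext oU _ (Ck_cst k U 0)) => x _; rewrite big_nil.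
case Pi : (P i); last by apply: (Ck_ext oU _ IH) => x _; rewrite big_cons Pi.
by apply: (Ck_ext oU _ (Ck_add oU (CF i) IH)) => x _; rewrite big_cons Pi.
Qed.

Lemma derivable_sumf (I : Type) (s : seq I) (P : pred I)
    (F : I -> 'rV[R]_n -> R) x v :
  (forall i, derivable (F i) x v) ->
  derivable (fun y => \sum_(i <- s | P i) F i y) x v.
Proof.
move=> dF; elim: s => [|i s IH].
  rewrite (_ : (fun y => _) = fun=> 0); first exact: derivable_cst.
  by apply/funext => y; rewrite big_nil.
case Pi : (P i).
  rewrite (_ : (fun y => _) = F i + fun y => \sum_(i <- s | P i) F i y).
    exact: derivableD.
  by apply/funext => y; rewrite big_cons Pi.
rewrite (_ : (fun y => _) = fun y => \sum_(i <- s | P i) F i y)//.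
by apply/funext => y; rewrite big_cons Pi.
Qed.

Lemma pderive_sum (I : Type) (s : seq I) (P : pred I)
    (F : I -> 'rV[R]_n -> R) a x :
  (forall i, derivable (F i) x (delta_mx 0 a)) ->
  pderive a (fun y => \sum_(i <- s | P i) F i y) x
  = \sum_(i <- s | P i) pderive a (F i) x.
Proof.
move=> dF; elim: s => [|i s IH].
  under [X in pderive a X]eq_fun do rewrite big_nil.
  by rewrite big_nil pderive_cst.
under [X in pderive a X]eq_fun do rewrite big_cons.
rewrite big_cons; case: (P i) => //; rewrite pderiveD ?IH//.
exact: derivable_sumf.
Qed.

Lemma Ck_prod k U (I : Type) (s : seq I) (P : pred I) (F : I -> 'rV[R]_n -> R) :
  open U -> (forall i, Ck k U (F i)) ->
  Ck k U (fun x => \prod_(i <- s | P i) F i x).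
Proof.
move=> oU CF; elim: s => [|i s IH].
  by apply: (Ck_ext oU _ (Ck_cst k U 1)) => x _; rewrite big_nil.
case Pi : (P i); last by apply: (Ck_ext oU _ IH) => x _; rewrite big_cons Pi.
by apply: (Ck_ext oU _ (Ck_mul oU (CF i) IH)) => x _; rewrite big_cons Pi.
Qed.

Lemma coord_continuousr (b : 'I_n) : continuous (fun x : 'rV[R]_n => x 0 b).
Proof. by move=> x; apply/differentiable_continuous; exact: differentiable_coord. Qed.

Lemma coord_pderive (a b : 'I_n) x :
  derivable (fun y : 'rV[R]_n => y 0 b) x (delta_mx 0 a) /\
  pderive a (fun y : 'rV[R]_n => y 0 b) x = (a == b)%:R.
Proof.
have C : (fun h => h^-1 *: (((h *: delta_mx 0 a + x : 'rV[R]_n)) 0 b - x 0 b))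
    @ 0^' --> ((a == b)%:R : R).
  have : (fun=> (a == b)%:R : R) @ (0 : R)^' --> ((a == b)%:R : R) by exact: cvg_cst.
  apply: cvg_trans; apply: near_eq_cvg; near=> h.
  have h0 : h != 0 by near: h; exact: nbhs_dnbhs_neq.
  by rewrite !mxE addrK eqxx/= [RHS]mulrA mulVf// mul1r eq_sym.
by split; [apply/cvg_ex; eexists; exact: C|exact: cvg_lim C].
Unshelve. all: by end_near. Qed.

Lemma Ck_coord k U (b : 'I_n) : open U -> Ck k U (fun x => x 0 b).
Proof.
move=> oU; case: k => [|k]; (split=> [x _|]; first exact: coord_continuousr) => // a.
split=> [x _|]; first by have [] := coord_pderive a b x.
apply: (Ck_ext oU _ (Ck_cst k U (a == b)%:R)) => x _.
by have [_ ->] := coord_pderive a b x.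
Qed.

Lemma is_derive_line f (x v : 'rV[R]_n) (s : R) : derivable f (s *: v + x) v ->
  is_derive s 1 (fun h => f (h *: v + x)) ('D_v f (s *: v + x)).
Proof.
have E : (fun h : R => h^-1 *: (f ((h *: 1 + s) *: v + x) - f (s *: v + x))) =
   (fun h => h^-1 *: ((f \o shift (s *: v + x)) (h *: v) - f (s *: v + x))).
  by apply/funext => h /=; rewrite [h *: 1]mulr1 scalerDl addrA.
by move=> dv; split; rewrite /derivable /derive/= E.
Qed.

(** Both signs of [t] are allowed because in [strict_diff] it is the difference of two
    coordinates. *)
Lemma MVT_line f (x v : 'rV[R]_n) (t : R) :
  (forall s, Num.min 0 t <= s <= Num.max 0 t -> derivable f (s *: v + x) v) ->
  exists2 s, Num.min 0 t <= s <= Num.max 0 t &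
    f (t *: v + x) - f x = 'D_v f (s *: v + x) * t.
Proof.
move=> df; pose g h := f (h *: v + x); pose dg h := 'D_v f (h *: v + x).
have main a b : a <= b -> Num.min 0 t <= a -> b <= Num.max 0 t ->
    exists2 c, c \in `[a, b] & g b - g a = dg c * (b - a).
  move=> ab ta bt; apply: MVT_segment => // [s /[!in_itv]/= /andP[as_ sb]|].
    apply: is_derive_line; apply: df.
    by rewrite (le_trans ta (ltW as_)) (le_trans (ltW sb) bt).
  apply: derivable_within_continuous => s /[!in_itv]/= /andP[as_ sb].
  have H : derivable f (s *: v + x) v.
    by apply: df; rewrite (le_trans ta as_) (le_trans sb bt).
  by have [] := is_derive_line H.
have g0 : g 0 = f x by rewrite /g scale0r add0r.
case: (leP 0 t) => [t0|/ltW t0].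
  have [||s] := main 0 t t0; rewrite ?(min_l t0) ?(max_r t0)//.
  rewrite in_itv/= => st; rewrite g0 subr0 => E; exists s => //.
have [||s] := main t 0 t0; rewrite ?(min_r t0) ?(max_l t0)//.
rewrite in_itv/= => st; rewrite g0 sub0r mulrN => E; exists s => //.
by rewrite -opprB E opprK.
Qed.

End Ck_basic.

(** * Strict differentiability of C^1 functions *)

Section strict_diff.
Context {R : realType} {n : nat}.
Implicit Types (U V : set 'rV[R]_n) (f g : 'rV[R]_n -> R) (k : nat).

Lemma coord_le_norm (x : 'rV[R]_n) i : `|x 0 i| <= `|x|.
Proof.
rewrite [leRHS]/Num.Def.normr/= mx_normrE.
by rewrite (le_trans _ (le_bigmax _ _ (0, i))).
Qed.

Lemma norm_rV_le (x : 'rV[R]_n) (r : R) : 0 <= r ->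
  (forall i, `|x 0 i| <= r) -> `|x| <= r.
Proof.
move=> r0 H; rewrite [leLHS]/Num.Def.normr/= mx_normrE bigmax_le// => -[i j] _ /=.
by rewrite (ord1 i).
Qed.

Lemma ball_rVP (x y : 'rV[R]_n) (r : R) : 0 < r ->
  ball x r y <-> forall i, `|x 0 i - y 0 i| < r.
Proof.
move=> r0; split=> [[_ H] i|H]; first exact: H.
by split=> // i j; rewrite (ord1 i); exact: H.
Qed.

(** Corners of a staircase from [y] to [z]. Balls of the sup norm are cubes, so the staircase stays
    in every ball that contains its two ends. *)
Definition mix (y z : 'rV[R]_n) (k : nat) : 'rV[R]_n :=
  \row_j (if (j < k)%N then z 0 j else y 0 j).

(** Each step of the staircase moves a single coordinate and obeys the mean value theorem with error
    at most [e] times the norm of [z - y]; the [n] steps account for the factor [n]. *)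
Lemma strict_diff f (x : 'rV[R]_n) (r e : R) (l : 'I_n -> R) : 0 < r ->
  (forall a y, ball x r y -> derivable f y (delta_mx 0 a)) ->
  (forall a y, ball x r y -> `|pderive a f y - l a| <= e) ->
  forall y z, ball x r y -> ball x r z ->
  `|f z - f y - \sum_a l a * (z 0 a - y 0 a)| <= e *+ n * `|z - y|.
Proof.
move=> r0 df dl y z xy xz.
have m0 : mix y z 0 = y by apply/rowP => j; rewrite mxE.
have mn : mix y z n = z by apply/rowP => j; rewrite mxE ltn_ord.
have mB k : ball x r (mix y z k).
  move: xy xz => /(ball_rVP _ _ r0) xy /(ball_rVP _ _ r0) xz.
  by apply/ball_rVP => // i; rewrite mxE; case: ifP.
have mS (a : 'I_n) : mix y z a.+1 = (z 0 a - y 0 a) *: delta_mx 0 a + mix y z a.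
  apply/rowP => j; rewrite !mxE eqxx/= ltnS leq_eqVlt eq_sym.
  rewrite -val_eqE /=; case: (eqVneq (a : nat) j) => [/val_inj <-|aj] /=.
    by rewrite ltnn mulr1 subrK.
  by rewrite mulr0 add0r.
have step (a : 'I_n) :
    `|f (mix y z a.+1) - f (mix y z a) - l a * (z 0 a - y 0 a)| <= e * `|z - y|.
  set t := z 0 a - y 0 a.
  have inB s : Num.min 0 t <= s <= Num.max 0 t ->
      ball x r (s *: delta_mx 0 a + mix y z a).
    move=> st; apply/ball_rVP => // i.
    move: (mB a) => /(ball_rVP _ _ r0)/(_ i).
    rewrite !mxE eqxx/=; case: (eqVneq i a) => [->|_] /=; last first.
      by rewrite mulr0 add0r.
    rewrite ltnn mulr1 => H1.
    move: xz => /(ball_rVP _ _ r0)/(_ a); move: H1 st; rewrite /t !ltr_norml.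
    case: (leP 0 (z 0 a - y 0 a)) => ? /andP[? ?] /andP[? ?] /andP[? ?].
      by apply/andP; split; lra.
    by apply/andP; split; lra.
  have [s st E] := @MVT_line R n f (mix y z a) (delta_mx 0 a) t
    (fun s st => df a _ (inB s st)).
  rewrite mS E -mulrBl normrM.
  apply: ler_pM => //; first exact: dl (inB _ st).
  by rewrite (le_trans _ (coord_le_norm _ a))// !mxE.
have tele : f z - f y = \sum_(a < n) (f (mix y z a.+1) - f (mix y z a)).
  rewrite -(big_mkord xpredT (fun a => f (mix y z a.+1) - f (mix y z a))).
  by rewrite telescope_sumr// m0 mn.
rewrite tele -sumrB; apply: le_trans (ler_norm_sum _ _ _) _.
apply: le_trans (ler_sum _ (fun a _ => step a)) _.
by rewrite sumr_const card_ord mulrnAl.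
Qed.

(* Continuity of the partial derivatives makes the linear approximation uniform
   on small balls. *)
Lemma C1_strict_diff U f x (e : R) : open U -> Ck 1 U f -> U x -> 0 < e ->
  exists2 r, 0 < r & ball x r `<=` U /\
  (forall y z, ball x r y -> ball x r z ->
  `|f z - f y - \sum_a pderive a f x * (z 0 a - y 0 a)| <= e * `|z - y|).
Proof.
move=> oU Cf Ux e0; pose e' := e / (n.+1)%:R.
have e'0 : 0 < e' by rewrite divr_gt0.
have H : \forall y \near x, U y /\
    forall a, `|pderive a f y - pderive a f x| <= e'.
  apply: filterI; first by exact: open_nbhs_nbhs.
  apply: (@near_forall_fin 'I_n 'rV[R]_n x
    (fun a y => `|pderive a f y - pderive a f x| <= e')) => a.
  have /cvgrPdist_le/(_ _ e'0) := Ck_continuous (Ck_pderive a Cf) Ux.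
  by apply: filterS => y; rewrite distrC.
have /nbhs_ballP[r /= r0 rH] := H.
exists r => //; split; first by move=> y /rH[].
move=> y z xy xz.
apply: le_trans (strict_diff (e := e') r0 _ _ xy xz) _.
- by move=> a w /rH[Uw _]; exact: Ck_derivable Cf Uw.
- by move=> a w /rH[_].
- rewrite ler_wpM2r// -mulr_natr /e' -mulrA ler_piMr ?(ltW e0)//.
  by rewrite mulrC ler_pdivrMr// mul1r ler_nat.
Qed.

End strict_diff.

(** * Chain rule and symmetry of second derivatives *)

Section chain.
Context {R : realType} {n : nat}.
Implicit Types (U V : set 'rV[R]_n) (f g : 'rV[R]_n -> R) (k : nat).

Lemma continuous_row m (T : topologicalType) (F : 'I_m -> T -> R) (x : T) :
  (forall b, {for x, continuous (F b)}) ->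
  {for x, continuous (fun y => \row_b F b y : 'rV[R]_m)}.
Proof.
move=> cF; apply/cvgrPdist_le => e e0.
have H : \forall y \near x, forall b, `|F b x - F b y| <= e.
  apply: (filter_forall (f := fun b y => `|F b x - F b y| <= e)) => b.
  by have /cvgrPdist_le/(_ _ e0) := cF b.
apply: filterS H => y H; apply: norm_rV_le; first exact: ltW.
by move=> i; rewrite !mxE.
Qed.

(** Continuity of the partial derivatives of [f] provides a total linear approximation, which is
    applied between [y] and the moving point [z]. The difference quotients [q] of the inner
    functions stay bounded, so its error is small compared with [h]. *)
Lemma is_derive_chain m (V : set 'rV[R]_m) (f : 'rV[R]_m -> R)
    (T : 'I_m -> 'rV[R]_n -> R) x v :
  open V -> Ck 1 V f -> V (\row_b T b x) ->
  (forall b, derivable (T b) x v) ->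
  is_derive x v (fun y => f (\row_b T b y))
    (\sum_b pderive b f (\row_b T b x) * 'D_v (T b) x).
Proof.
move=> oV Cf VTx dT; set L := \sum_b _.
pose q b (h : R) := h^-1 *: (T b (h *: v + x) - T b x).
have qc b : q b @ (0 : R)^' --> 'D_v (T b) x.
  exact: (dT b).
suff C : (fun h : R => h^-1 *: (f (\row_b T b (h *: v + x)) - f (\row_b T b x)))
    @ (0 : R)^' --> L.
  by split; [apply/cvg_ex; exists L; exact: C|exact: cvg_lim C].
have sc : (fun h => \sum_b pderive b f (\row_b T b x) * q b h) @ (0 : R)^' --> L.
  apply: cvg_big => [|b _]; last by apply: cvgMr.
  exact: add_continuous.
pose C := 1 + \sum_b `|'D_v (T b) x|.
have C0 : 0 < C by rewrite ltr_wpDr// sumr_ge0.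
have qC : \forall h \near (0 : R)^', forall b, `|q b h| <= C.
  apply: (filter_forall (f := fun b h => `|q b h| <= C)) => b.
  have /cvgrPdist_le/(_ _ ltr01) := qc b.
  apply: filterS => h H; rewrite -(subrK ('D_v (T b) x) (q b h)).
  rewrite (le_trans (ler_normD _ _))// lerD//; first by rewrite distrC.
  by rewrite (bigD1 b)//= ler_wpDr// sumr_ge0.
apply/cvgrPdist_le => e e0.
(* Since [z - y] has norm at most [C] times that of [h], this precision of the linear approximation
   costs [e / 2]; the convergence of the quotients costs the rest. *)
pose e1 := e / 2 / C; have e10 : 0 < e1 by rewrite !divr_gt0.
have [r r0 [rV rH]] := C1_strict_diff oV Cf VTx e10.
have e20 : 0 < e / 2 by rewrite divr_gt0.
have rC : 0 < r / C by rewrite divr_gt0.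
move: sc => /cvgrPdist_le/(_ _ e20) sc.
near=> h.
have h0 : h != 0 by near: h; exact: nbhs_dnbhs_neq.
have hrC : `|h| < r / C by near: h; exact: dnbhs0_lt.
have qCh : forall b, `|q b h| <= C by near: h.
have sch : `|L - \sum_b pderive b f (\row_b T b x) * q b h| <= e / 2 by near: h.
set y := \row_b T b x; set z := \row_b T b (h *: v + x).
have zy : z - y = h *: \row_b q b h.
  apply/rowP => b; rewrite !mxE /q.
  by rewrite [RHS]mulrA divff// mul1r.
have nzy : `|z - y| <= `|h| * C.
  rewrite zy normrZ ler_wpM2l// norm_rV_le// ?(ltW C0)// => b.
  by rewrite mxE.
have yz : ball y r z.
  rewrite -ball_normE /ball_/= distrC (le_lt_trans nzy)//.
  by rewrite -ltr_pdivlMr.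
have := rH y z (ballxx _ r0) yz => {}rH.
rewrite -(subrK (\sum_b pderive b f y * q b h) L) -addrA.
rewrite (le_trans (ler_normD _ _))// (splitr e) lerD//.
have -> : \sum_b pderive b f y * q b h =
    h^-1 * (\sum_b pderive b f y * (z 0 b - y 0 b)).
  rewrite mulr_sumr; apply: eq_bigr => b _.
  have -> : z 0 b - y 0 b = (z - y) 0 b by rewrite !mxE.
  by rewrite zy !mxE; field.
rewrite distrC -mulrBr normrM normfV ler_pdivrMl ?normr_gt0//.
apply: le_trans rH _; apply: le_trans (ler_wpM2l (ltW e10) nzy) _.
rewrite /e1 le_eqVlt; apply/orP; left; apply/eqP; field.
by rewrite gt_eqF.
Unshelve. all: by end_near. Qed.

Lemma pderive_chain m (V : set 'rV[R]_m) (f : 'rV[R]_m -> R)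
    (T : 'I_m -> 'rV[R]_n -> R) x a :
  open V -> Ck 1 V f -> V (\row_b T b x) ->
  (forall b, derivable (T b) x (delta_mx 0 a)) ->
  pderive a (fun y => f (\row_b T b y)) x =
    \sum_b pderive b f (\row_b T b x) * pderive a (T b) x.
Proof. by move=> oV Cf VT dT; have [] := is_derive_chain oV Cf VT dT. Qed.

Lemma C1_comp m (U : set 'rV[R]_n) (V : set 'rV[R]_m) (f : 'rV[R]_m -> R)
    (T : 'I_m -> 'rV[R]_n -> R) :
  open U -> open V -> Ck 1 V f -> (forall b, Ck 1 U (T b)) ->
  (forall x, U x -> V (\row_b T b x)) ->
  Ck 1 U (fun y => f (\row_b T b y)).
Proof.
move=> oU oV Cf CT UV.
have cT x : U x -> {for x, continuous (fun y => \row_b T b y : 'rV[R]_m)}.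
  by move=> Ux; apply: continuous_row => b; exact: Ck_continuous (CT b) Ux.
have cf k (g : 'rV[R]_m -> R) x : Ck k V g -> U x -> {for x, continuous (fun y => g (\row_b T b y))}.
  move=> Cg Ux; apply: continuous_comp (cT _ Ux) _.
  by apply: Ck_continuous Cg _; exact: UV.
split=> [x Ux|a]; first exact: cf Cf Ux.
split=> [x Ux|].
  have dT b : derivable (T b) x (delta_mx 0 a) by exact: Ck_derivable (CT b) Ux.
  by have [] := is_derive_chain oV Cf (UV _ Ux) dT.
apply: (@Ck_ext _ _ 0 U _
  (fun x => \sum_b pderive b f (\row_b T b x) * pderive a (T b) x) oU).
  move=> x Ux; rewrite (pderive_chain oV Cf (UV _ Ux))// => b.
  exact: Ck_derivable (CT b) Ux.
apply: Ck_sum => // b; apply: Ck_mul => //; last exact: Ck_pderive.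
by split=> // x Ux; apply: (cf 0) => //; exact: Ck_pderive.
Qed.

Lemma is_derive_comp1 (phi : R -> R) f (x v : 'rV[R]_n) (d : R) :
  is_derive (f x) 1 phi d -> derivable f x v ->
  is_derive x v (phi \o f) (d * 'D_v f x).
Proof.
move=> [dphi <-] df; set g := fun h : R => f (h *: v + x).
have g0 : g 0 = f x by rewrite /g scale0r add0r.
have dg : derivable g 0 1 by apply/(derivable1P f x v).
have E (F : 'rV[R]_n -> R) : 'D_v F x = derive1 (fun h : R => F (h *: v + x)) 0.
  rewrite /derive1 /derive; set u := (fun h => _); set w := (fun h : R => _).
  suff -> : u = w by [].
  by apply/funext => h; rewrite /u /w /= addr0 scale0r add0r.
rewrite -g0 in dphi *.
have dpg : derivable (phi \o g) 0 1.
  apply/derivable1_diffP; apply: differentiable_comp; first exact/derivable1_diffP.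
  exact/derivable1_diffP.
split; first exact/(derivable1P (phi \o f) x v).
have E2 := derive1_comp dg dphi.
rewrite (E (phi \o f)) (E f); apply: etrans E2 _.
by rewrite derive1E.
Qed.

Lemma C1_comp1 (phi dphi : R -> R) U f : open U -> Ck 1 U f ->
  (forall x, U x -> is_derive (f x) 1 phi (dphi (f x))) ->
  (forall x, U x -> {for f x, continuous dphi}) ->
  Ck 1 U (fun x => phi (f x)) /\
  forall a x, U x -> pderive a (fun y => phi (f y)) x = dphi (f x) * pderive a f x.
Proof.
move=> oU Cf dphiP cdphi.
have D a x : U x -> is_derive x (delta_mx 0 a) (phi \o f) (dphi (f x) * pderive a f x).
  move=> Ux; apply: is_derive_comp1; first exact: dphiP.
  exact: Ck_derivable Cf Ux.
split=> [|a x Ux]; last by have [] := D a x Ux.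
split=> [x Ux|a].
  apply: continuous_comp; first exact: Ck_continuous Cf Ux.
  by apply/differentiable_continuous/derivable1_diffP; have [] := dphiP x Ux.
split=> [x Ux|]; first by have [] := D a x Ux.
apply: (@Ck_ext _ _ 0 U _ (fun x => dphi (f x) * pderive a f x) oU).
  by move=> x Ux; have [_] := D a x Ux; rewrite /pderive => <-.
apply: Ck_mul => //; last exact: Ck_pderive.
split=> // x Ux; apply: continuous_comp; first exact: Ck_continuous Cf Ux.
exact: cdphi.
Qed.

Lemma C1_inv U f : open U -> Ck 1 U f -> (forall x, U x -> f x != 0) ->
  Ck 1 U (fun x => (f x)^-1).
Proof.
move=> oU Cf f0.
have cV (x : 'rV[R]_n) : U x -> {for x, continuous (fun y => (f y)^-1)}.
  by move=> Ux; apply: continuousV; [exact: f0|exact: Ck_continuous Cf Ux].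
split=> // a; split=> [x Ux|].
  exact: derivableV (f0 x Ux) (Ck_derivable Cf Ux).
apply: (@Ck_ext _ _ 0 U _ (fun x => - ((f x)^-1 * (f x)^-1) * pderive a f x) oU).
  move=> x Ux; apply/esym.
  apply: etrans (deriveV (f0 x Ux) (Ck_derivable Cf Ux)) _.
  by rewrite expr2 invfM.
have C0 : Ck 0 U (fun y => (f y)^-1) by [].
by apply: Ck_mul => //; [apply: Ck_opp => //; exact: Ck_mul|exact: Ck_pderive].
Qed.

Lemma C1_sqrt U f : open U -> Ck 1 U f -> (forall x, U x -> 0 < f x) ->
  Ck 1 U (fun x => Num.sqrt (f x)) /\
  forall a x, U x -> pderive a (fun y => Num.sqrt (f y)) x
    = (2 * Num.sqrt (f x))^-1 * pderive a f x.
Proof.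
move=> oU Cf f0; apply: (@C1_comp1 Num.sqrt (fun y => (2 * Num.sqrt y)^-1)) => // x Ux.
  exact: is_derive1_sqrt (f0 x Ux).
apply: continuous_comp.
  by apply: continuousM; [exact: cst_continuous|exact: sqrt_continuous].
by apply: inv_continuous; rewrite mulf_neq0// sqrtr_eq0 -ltNge f0.
Qed.

(** The squared positive part is the profile of the bump functions. It is C^1, and the weak form
    differentiates its weight only once. *)
Lemma is_derive_sqpos (t : R) :
  is_derive t 1 (fun y => Num.max 0 y ^+ 2) (2 * Num.max 0 t).
Proof.
case: (ltgtP 0 t) => [t0|t0|<-].
- have : is_derive t 1 (fun y : R => y ^+ 2) (2 * t).
    by apply: is_derive_eq; rewrite [t *: 1]mulr1 mulr_natl.
  apply: near_eq_is_derive; near=> y.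
  by rewrite max_r// ltW//; near: y; exact: lt_nbhsr.
- rewrite mulr0; have : is_derive t 1 (fun y : R => 0 : R) 0 by exact: is_derive_cst.
  apply: near_eq_is_derive; near=> y.
  rewrite max_l ?expr0n//; apply/ltW; near: y; exact: lt_nbhsl.
- rewrite mulr0.
  suff C : (fun h : R => h^-1 *: (((fun y : R => Num.max 0 y ^+ 2) \o shift (0 : R)) (h *: (1 : R))
       - Num.max 0 0 ^+ 2)) @ (0 : R)^' --> (0 : R).
    by split; [apply/cvg_ex; exists 0; exact: C|exact: cvg_lim C].
  apply/cvgrPdist_le => e e0; near=> h.
  have h0 : h != 0 by near: h; exact: nbhs_dnbhs_neq.
  have he : `|h| <= e by apply/ltW; near: h; exact: dnbhs0_lt.
  rewrite /= addr0 maxxx expr0n/= subr0 sub0r normrN [h *: 1]mulr1.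
  rewrite [_ *: _]mulrC normrM normfV ler_pdivrMr ?normr_gt0//.
  rewrite normrX expr2 ler_pM//; last first.
    by case: (leP 0 h) => // _; rewrite normr0.
  by apply: le_trans he; case: (leP 0 h) => // _; rewrite normr0.
Unshelve. all: by end_near. Qed.

Lemma C1_sqpos U f : open U -> Ck 1 U f ->
  Ck 1 U (fun x => Num.max 0 (f x) ^+ 2).
Proof.
move=> oU Cf.
have [] // := @C1_comp1 (fun y => Num.max 0 y ^+ 2) (fun y => 2 * Num.max 0 y) U f oU Cf.
  by move=> x _; exact: is_derive_sqpos.
move=> x _; apply: continuousM; first exact: cst_continuous.
by apply: continuous_max; [exact: cst_continuous|].
Qed.

Lemma derive_shiftv f (c x v : 'rV[R]_n) :
  ('D_v (fun y => f (y + c)) x = 'D_v f (x + c)) /\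
  (derivable f (x + c) v -> derivable (fun y => f (y + c)) x v).
Proof.
have E : (fun h : R => h^-1 *: (((fun y => f (y + c)) \o shift x) (h *: v) - f (x + c)))
   = (fun h : R => h^-1 *: ((f \o shift (x + c)) (h *: v) - f (x + c))).
  by apply/funext => h /=; rewrite addrA.
by rewrite /derivable /derive E.
Qed.

(** The second difference over the square of side [h] is the increment in direction [b] of the
    difference [F] in direction [a]. The mean value theorem turns it into an increment of
    [pderive b f], to which strict differentiability applies. *)
Lemma double_diff U f x (a b : 'I_n) (e : R) : open U -> Ck 2 U f -> U x -> 0 < e ->
  exists2 r : R, 0 < r & forall h, 0 < h < r ->
  `|(f (x + h *: delta_mx 0 a + h *: delta_mx 0 b) - f (x + h *: delta_mx 0 a)
     - f (x + h *: delta_mx 0 b) + f x) - pderive a (pderive b f) x * h ^+ 2|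
    <= e * h ^+ 2.
Proof.
move=> oU Cf Ux e0.
have [r r0 [rU rH]] := C1_strict_diff oU (Ck_pderive b Cf) Ux e0.
exists (r / 2); first by rewrite divr_gt0.
move=> h /andP[h0 hr].
pose ea : 'rV[R]_n := delta_mx 0 a; pose eb : 'rV[R]_n := delta_mx 0 b.
have ne (i : 'I_n) : `|delta_mx 0 i : 'rV[R]_n| <= 1.
  by apply: norm_rV_le => // j; rewrite mxE eqxx/= normr_nat lern1 leq_b1.
have inB s t : 0 <= s <= h -> 0 <= t <= h -> ball x r (s *: eb + x + t *: ea).
  move=> /andP[s0 sh] /andP[t0 th].
  rewrite -ball_normE /ball_/= (_ : x - _ = - (s *: eb + t *: ea)); last first.
    by rewrite addrAC [_ + x]addrC opprD addrA subrr add0r.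
  rewrite normrN.
  rewrite (le_lt_trans (ler_normD _ _))// !normrZ (ger0_norm s0) (ger0_norm t0).
  have H1 : s * `|eb| <= h by rewrite (le_trans (ler_piMr s0 (ne b))).
  have H2 : t * `|ea| <= h by rewrite (le_trans (ler_piMr t0 (ne a))).
  by lra.
pose F y := f (y + h *: ea) - f y.
have hh : 0 <= h <= h by rewrite (ltW h0) lexx.
have h00 : 0 <= (0 : R) <= h by rewrite (ltW h0) lexx.
have d1 s : 0 <= s <= h -> derivable f (s *: eb + x + h *: ea) eb.
  by move=> sh; apply: Ck_derivable Cf _; apply/rU/inB.
have d0 s : 0 <= s <= h -> derivable f (s *: eb + x) eb.
  move=> sh; apply: Ck_derivable Cf _; apply/rU.
  by rewrite -[_ + x]addr0 -(scale0r ea); exact: inB.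
have dF s : 0 <= s <= h -> derivable F (s *: eb + x) eb.
  move=> sh; apply: derivableB; last exact: d0.
  by apply: (derive_shiftv f _ _ _).2; exact: d1.
have [|s] := @MVT_line R n F x eb h.
  by move=> s; rewrite (min_l (ltW h0)) (max_r (ltW h0)); exact: dF.
rewrite (min_l (ltW h0)) (max_r (ltW h0)) => sh.
have -> : 'D_eb F (s *: eb + x) =
    pderive b f (s *: eb + x + h *: ea) - pderive b f (s *: eb + x).
  rewrite deriveB; [|by apply: (derive_shiftv f _ _ _).2; exact: d1|exact: d0].
  by rewrite (derive_shiftv f _ _ _).1.
rewrite {1}/F {1}/F => E.
have y1 : ball x r (s *: eb + x).
  by rewrite -[_ + x]addr0 -(scale0r ea); exact: inB.
have := rH _ _ y1 (inB s h sh hh).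
set D := pderive b f _ - _ in E *.
have -> : \sum_a0 pderive a0 (pderive b f) x *
    ((s *: eb + x + h *: ea) 0 a0 - (s *: eb + x) 0 a0)
    = pderive a (pderive b f) x * h.
  rewrite (bigD1 a)//= big1 ?addr0 => [|i ia].
    by rewrite !mxE !eqxx/= mulr1; congr (_ * _); ring.
  by rewrite !mxE eqxx/= (negbTE ia) mulr0 addr0 [X in _ * X]subrr mulr0.
rewrite [_ - (s *: eb + x)]addrC addrA addNr add0r normrZ (ger0_norm (ltW h0)).
move=> H3.
have -> : f (x + h *: ea + h *: eb) - f (x + h *: ea) - f (x + h *: eb) + f x
   = D * h.
  rewrite -E [h *: eb + x]addrC addrAC.
  by rewrite [x + h *: eb + h *: ea]addrAC; ring.
rewrite expr2 !mulrA -mulrBl normrM (ger0_norm (ltW h0)) ler_wpM2r ?(ltW h0)//.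
apply: le_trans H3 _; rewrite mulrA ler_piMr ?mulr_ge0 ?(ltW e0) ?(ltW h0)//.
exact: ne.
Qed.

Lemma schwarz U f x (a b : 'I_n) : open U -> Ck 2 U f -> U x ->
  pderive a (pderive b f) x = pderive b (pderive a f) x.
Proof.
move=> oU Cf Ux; apply/eqP; rewrite -subr_eq0 -normr_le0.
apply/ler_addgt0Pl => e e0; rewrite addr0.
have e20 : 0 < e / 2 by rewrite divr_gt0.
have [r1 r10 H1] := double_diff a b oU Cf Ux e20.
have [r2 r20 H2] := double_diff b a oU Cf Ux e20.
pose h := Num.min r1 r2 / 2.
have h0 : 0 < h by rewrite divr_gt0// lt_min r10.
have m0 : 0 < Num.min r1 r2 by rewrite lt_min r10.
have [hr1 hr2] : h < r1 /\ h < r2.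
  have H : h < Num.min r1 r2 by rewrite /h; lra.
  by move: H; rewrite lt_min => /andP[].
have {H1} := H1 h; rewrite h0 hr1 => /(_ isT) H1.
have {H2} := H2 h; rewrite h0 hr2 => /(_ isT) H2.
rewrite -(@ler_pM2r _ (h ^+ 2)) ?exprn_gt0//.
rewrite -[X in _ * X](@ger0_norm _ (h ^+ 2)) ?exprn_ge0 ?(ltW h0)//.
rewrite -normrM.
(* Exchanging [a] and [b] permutes the corners of the square, so both estimates bear on the same
   second difference. *)
move: H1 H2; rewrite (addrAC x (h *: delta_mx 0 b)).
set A := f (_ + _ + _); set B := f (_ + _); set C := f (_ + _).
set X := pderive a _ x; set Y := pderive b _ x; set h2 := h ^+ 2.
move: (f x) X Y h2 A B C => fx X Y h2 A B C.
rewrite !ler_norml => /andP[H1 H2] /andP[H3 H4]; apply/andP.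
rewrite mulrBl; move: (X * h2) (Y * h2) H1 H2 H3 H4 => X' Y'.
rewrite (_ : e / 2 * h2 = (e * h2) / 2); last by rewrite mulrAC.
by move: (e * h2) => E H1 H2 H3 H4; split; lra.
Qed.

End chain.

(** * Positive definite matrices *)

Section posdef.
Context {R : realType}.

Definition posdef n (G : 'M[R]_n) :=
  G^T = G /\ forall v : 'rV[R]_n, v != 0 -> 0 < (v *m G *m v^T) 0 0.

Lemma mx11E (A : 'M[R]_1) : A = (A 0 0)%:M.
Proof. exact: mx11_scalar. Qed.

(** Induction through the Schur complement [D'] of the upper left entry. The factor [B] plays the
    role of an orthonormal frame: through it every inner product of tensors becomes a Frobenius
    product. *)
Lemma cholesky n (G : 'M[R]_n) : posdef G ->
  exists2 B : 'M[R]_n, B \in unitmx & G = B *m B^T.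
Proof.
elim: n G => [|n IH] G [sG pG].
  by exists 1%:M; [exact: unitmx1|apply/matrixP => -[]].
change 'M[R]_(1 + n) in G.
have {}pG (v : 'rV[R]_(1 + n)) : v != 0 -> 0 < (v *m G *m v^T) 0 0 by exact: pG.
pose d0 := (ulsubmx G : 'M[R]_1) 0 0.
have G1 : ulsubmx G = d0%:M by exact: mx11E.
pose b := ursubmx G; pose D := drsubmx G.
have Gb : G = block_mx (d0%:M) b b^T D.
  rewrite -[LHS]submxK -G1 /b trmx_ursub; congr block_mx.
  by rewrite sG.
have d0_gt0 : 0 < d0.
  have := pG (row_mx (1%:M : 'M[R]_1) (0 : 'rV[R]_n)).
  rewrite Gb mul_row_block !mul1mx !mul0mx !addr0 tr_row_mx mul_row_col.
  rewrite trmx1 mulmx1 trmx0 mulmx0 addr0 mxE eqxx mulr1n; apply.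
  apply/eqP => /matrixP/(_ 0 (lshift n 0)); rewrite row_mxEl !mxE eqxx.
  by move/eqP; rewrite oner_eq0.
pose D' := D - d0^-1 *: (b^T *m b).
have D'pd : posdef D'.
  split.
    rewrite /D' linearB /= linearZ /= trmx_mul trmxK; congr (_ - _).
    by rewrite /D trmx_drsub sG.
  move=> v v0.
  (* For fixed [v] this first coordinate minimises the quadratic form of [G], and the minimum is the
     form of [D'] at [v]. *)
  pose t := - d0^-1 *: (v *m b^T).
  have := pG (row_mx t v).
  have -> : (row_mx t v *m G *m (row_mx t v)^T) = v *m D' *m v^T.
    rewrite Gb mul_row_block tr_row_mx mul_row_col.
    have -> : t *m d0%:M + v *m b^T = 0.
      by rewrite mul_mx_scalar /t scalerA mulrN divff ?gt_eqF// scaleN1r addNr.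
    rewrite mul0mx add0r; congr (_ *m _).
    rewrite /D' mulmxBr /t -scalemxAr -scalemxAl scaleNr addrC mulmxA.
    by [].
  apply; apply: contraNN v0 => /eqP/matrixP H; apply/eqP/matrixP => i j.
  by have := H i (rshift 1 j); rewrite row_mxEr !mxE.
have [B' B'u D'B] := IH _ D'pd.
pose s := Num.sqrt d0.
have s2 : s * s = d0 by rewrite -expr2 sqr_sqrtr// ltW.
have s0 : s != 0 by rewrite sqrtr_eq0 -ltNge.
change (exists2 B : 'M[R]_(1 + n), B \in unitmx & G = B *m B^T).
exists (block_mx s%:M 0 (s^-1 *: b^T) B').
  rewrite unitmxE det_lblock unitrM -[X in _ && X]unitmxE B'u andbT det_scalar1.
  by rewrite unitfE.
rewrite tr_block_mx trmx0 mulmx_block !mulmx0 !mul0mx !addr0 tr_scalar_mx.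
rewrite -scalar_mxM s2 linearZ/= trmxK mul_scalar_mx scalerA divff// scale1r.
rewrite mul_mx_scalar scalerA divff// scale1r -scalemxAl -scalemxAr scalerA.
rewrite -invfM s2 -D'B /D' [RHS](_ : _ = block_mx d0%:M b b^T D)//.
by congr block_mx; rewrite addrC subrK.
Qed.

Lemma posdef_unit n (G : 'M[R]_n) : posdef G -> G \in unitmx.
Proof. by move=> /cholesky[B uB ->]; rewrite unitmx_mul uB unitmx_tr. Qed.

Lemma posdef_det n (G : 'M[R]_n) : posdef G -> 0 < \det G.
Proof.
move=> /cholesky[B uB ->]; rewrite det_mulmx det_tr -expr2.
by rewrite lt_neqAle sqr_ge0 andbT eq_sym sqrf_eq0 -unitfE -unitmxE.
Qed.

Definition frob2 m n (S : 'M[R]_(m, n)) : R := \tr (S *m S^T).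

Lemma frob2E m n (S : 'M[R]_(m, n)) : frob2 S = \sum_i \sum_j S i j ^+ 2.
Proof.
rewrite /frob2 /mxtrace; apply: eq_bigr => i _; rewrite !mxE.
by apply: eq_bigr => j _; rewrite !mxE expr2.
Qed.

Lemma frob2_ge0 m n (S : 'M[R]_(m, n)) : 0 <= frob2 S.
Proof.
by rewrite frob2E; apply: sumr_ge0 => i _; apply: sumr_ge0 => j _; exact: sqr_ge0.
Qed.

Lemma entry_frob2 m n (S : 'M[R]_(m, n)) i j : S i j ^+ 2 <= frob2 S.
Proof.
rewrite frob2E (bigD1 i)//= (bigD1 j)//= -addrA lerDl addr_ge0//.
  by apply: sumr_ge0 => ? _; exact: sqr_ge0.
by apply: sumr_ge0 => ? _; apply: sumr_ge0 => ? _; exact: sqr_ge0.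
Qed.

Lemma frob2_tr m n (S : 'M[R]_(m, n)) : frob2 S^T = frob2 S.
Proof. by rewrite /frob2 trmxK mxtrace_mulC. Qed.

(* Cauchy-Schwarz, from the sum of squares [sum_ij (u_i v_j - u_j v_i)^2]. *)
Lemma cauchy_schwarz_sum n (u v : 'I_n -> R) :
  (\sum_i u i * v i) ^+ 2 <= (\sum_i u i ^+ 2) * (\sum_i v i ^+ 2).
Proof.
have : 0 <= \sum_i \sum_j (u i * v j - u j * v i) ^+ 2.
  by apply: sumr_ge0 => i _; apply: sumr_ge0 => j _; exact: sqr_ge0.
have -> : \sum_i \sum_j (u i * v j - u j * v i) ^+ 2 =
    (\sum_i u i ^+ 2) * (\sum_i v i ^+ 2) *+ 2 - (\sum_i u i * v i) ^+ 2 *+ 2.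
  have -> : \sum_i \sum_j (u i * v j - u j * v i) ^+ 2 =
     \sum_i \sum_j (u i ^+ 2 * v j ^+ 2) + \sum_i \sum_j (u j ^+ 2 * v i ^+ 2)
     - (\sum_i \sum_j ((u i * v i) * (u j * v j))) *+ 2.
    rewrite -sumrMnl -big_split -sumrB /=; apply: eq_bigr => i _.
    rewrite -sumrMnl -big_split -sumrB /=; apply: eq_bigr => j _.
    by ring.
  rewrite [X in _ + X - _]exchange_big /= -mulr2n.
  rewrite mulr_suml expr2 mulr_suml; congr (_ *+ 2 - _ *+ 2).
    by apply: eq_bigr => i _; rewrite mulr_sumr.
  by apply: eq_bigr => i _; rewrite mulr_sumr.
by rewrite -mulrnBl pmulrn_lge0// subr_ge0.
Qed.

Lemma frob2_mul m n p (S : 'M[R]_(m, n)) (T : 'M[R]_(n, p)) :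
  frob2 (S *m T) <= frob2 S * frob2 T.
Proof.
rewrite -(frob2_tr T) !frob2E mulr_suml; apply: ler_sum => i _.
rewrite mulr_sumr; apply: ler_sum => j _; rewrite mxE.
apply: le_trans (cauchy_schwarz_sum _ _) _.
by rewrite le_eqVlt; apply/orP; left; apply/eqP; congr (_ * _);
  apply: eq_bigr => k _; rewrite ?mxE.
Qed.

(** The inverse of [B *m B^T] splits into two factors, which cyclicity of the trace distributes over
    the two sides of [S] and of [T]. *)
Lemma inner2_frob n (B S T : 'M[R]_n) : B \in unitmx ->
  inner2 (B *m B^T) S T =
  \tr ((invmx B *m S *m (invmx B)^T) *m (invmx B *m T *m (invmx B)^T)^T).
Proof.
move=> uB; have iG : invmx (B *m B^T) = (invmx B)^T *m invmx B.
  apply: (can_inj (mulKmx (_ : B *m B^T \in unitmx))).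
    by rewrite unitmx_mul uB unitmx_tr.
  rewrite mulmxV ?unitmx_mul ?uB ?unitmx_tr// mulmxA -[B *m _ *m _]mulmxA.
  by rewrite -trmx_mul mulVmx// trmx1 mulmx1 mulmxV.
rewrite /inner2 iG !trmx_mul !trmxK -!mulmxA mxtrace_mulC -!mulmxA.
by [].
Qed.

(** Entries in a chart are controlled by the invariant norm: [S] is recovered from its components in
    the frame [B] by two multiplications, each of which costs a factor [frob2 B = \tr G]. *)
Lemma frob2_inner2 n (G S : 'M[R]_n) : posdef G ->
  0 <= inner2 G S S /\ frob2 S <= (\tr G) ^+ 2 * inner2 G S S.
Proof.
move=> /cholesky[B uB ->]; rewrite inner2_frob//.
set S' := (invmx B *m S *m (invmx B)^T); rewrite -/(frob2 S'); split; first exact: frob2_ge0.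
have -> : S = B *m S' *m B^T.
  rewrite /S' !mulmxA mulmxV// mul1mx -mulmxA -trmx_mul mulmxV// trmx1.
  by rewrite mulmx1.
rewrite -/(frob2 B); apply: le_trans (frob2_mul _ _) _.
rewrite frob2_tr expr2 mulrAC ler_wpM2r ?frob2_ge0//.
exact: frob2_mul.
Qed.

Lemma inner2_suml n (G T : 'M[R]_n) (I : finType) (c : I -> R) (S : I -> 'M[R]_n) :
  inner2 G (\sum_i c i *: S i) T = \sum_i c i * inner2 G (S i) T.
Proof.
rewrite /inner2 mulmx_sumr !mulmx_suml raddf_sum; apply: eq_bigr => i _.
by rewrite -scalemxAr -!scalemxAl /= mxtraceZ.
Qed.

Lemma inner2_sumr n (G T : 'M[R]_n) (I : finType) (c : I -> R) (S : I -> 'M[R]_n) :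
  inner2 G T (\sum_i c i *: S i) = \sum_i c i * inner2 G T (S i).
Proof.
rewrite /inner2 raddf_sum /= mulmx_sumr raddf_sum; apply: eq_bigr => i _.
by rewrite /= linearZ /= -scalemxAr mxtraceZ.
Qed.

(** [S'] expresses the first slot in the frame [B]; undoing this by Cauchy-Schwarz adds a third
    factor [\tr G] to the two of [frob2_inner2]. *)
Lemma frob2_inner3 n (G : 'M[R]_n) (S : 'I_n -> 'M[R]_n) : posdef G ->
  0 <= inner3 G S S /\
  \sum_c frob2 (S c) <= (\tr G) ^+ 3 * inner3 G S S.
Proof.
move=> pG; have [B uB GB] := cholesky pG.
pose S' e := \sum_c invmx B e c *: S c.
have iG : invmx G = (invmx B)^T *m invmx B.
  rewrite GB; apply: (can_inj (mulKmx (_ : B *m B^T \in unitmx))).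
    by rewrite unitmx_mul uB unitmx_tr.
  rewrite mulmxV ?unitmx_mul ?uB ?unitmx_tr// mulmxA -[B *m _ *m _]mulmxA.
  by rewrite -trmx_mul mulVmx// trmx1 mulmx1 mulmxV.
have E : inner3 G S S = \sum_e inner2 G (S' e) (S' e).
  rewrite /inner3.
  under eq_bigr => c _ do under eq_bigr => c' _ do rewrite iG mxE mulr_suml.
  under eq_bigr => c _ do rewrite exchange_big /=.
  rewrite exchange_big /=; apply: eq_bigr => e _.
  rewrite inner2_suml; apply: eq_bigr => c _.
  rewrite inner2_sumr mulr_sumr; apply: eq_bigr => c' _.
  by rewrite !mxE mulrA.
rewrite E; split.
  by apply: sumr_ge0 => e _; have [] := frob2_inner2 (S' e) pG.
have SB c : S c = \sum_e B c e *: S' e.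
  rewrite /S'; under eq_bigr => e _ do rewrite scaler_sumr.
  rewrite exchange_big /= (bigD1 c)//= [X in _ = _ + X]big1 ?addr0 => [|i ic].
    under eq_bigr => e _ do rewrite scalerA.
    rewrite -scaler_suml; have -> : \sum_e B c e * invmx B e c = 1.
      by have := mulmxV uB => /matrixP/(_ c c); rewrite !mxE eqxx.
    by rewrite scale1r.
  under eq_bigr => e _ do rewrite scalerA.
  rewrite -scaler_suml; have -> : \sum_e B c e * invmx B e i = 0.
    have := mulmxV uB => /matrixP/(_ c i); rewrite !mxE eq_sym (negbTE ic).
    by [].
  by rewrite scale0r.
have H c : frob2 (S c) <= (\sum_e B c e ^+ 2) * \sum_e frob2 (S' e).
  rewrite {1}SB frob2E.
  under [X in _ <= _ * X]eq_bigr => e _ do rewrite frob2E.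
  rewrite [X in _ <= _ * X]exchange_big /= mulr_sumr; apply: ler_sum => i _.
  rewrite [X in _ <= _ * X]exchange_big /= mulr_sumr; apply: ler_sum => j _.
  rewrite summxE; apply: le_trans (cauchy_schwarz_sum _ _).
  by rewrite le_eqVlt; apply/orP; left; apply/eqP; congr (_ ^+ 2);
    apply: eq_bigr => e _; rewrite mxE.
apply: le_trans (ler_sum _ (fun c _ => H c)) _.
rewrite -mulr_suml -frob2E.
have -> : frob2 B = \tr G by rewrite GB.
have trG0 : 0 <= \tr G by rewrite GB; exact: frob2_ge0.
rewrite exprS -mulrA ler_wpM2l// mulr_sumr; apply: ler_sum => e _.
by have [] := frob2_inner2 (S' e) pG.
Qed.

End posdef.

(** * Lebesgue measure on R^n *)

Section affine1.
Context {R : realType}.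

Lemma measurable_affine (a c : R) :
  measurable_fun setT (fun t : measurableTypeR R => a * t + c : measurableTypeR R).
Proof. by apply: measurable_funD => //; exact: measurable_funM. Qed.

(** Stated as an existence so that the pushforward enters later proofs as an abstract measure, known
    by its values. *)
Lemma pushforward_measureP d1 d2 (T1 : measurableType d1) (T2 : measurableType d2)
    (m : {measure set T1 -> \bar R}) (f : T1 -> T2) : measurable_fun setT f ->
  exists p : {measure set T2 -> \bar R},
    p = (fun A => m (f @^-1` A)) :> (set T2 -> \bar R).
Proof.
move=> mf; exists (measure_function_pushforward__canonical__measure_function_Measure m mf).
by [].
Qed.

(** The right hand side is a measure in [A], so by uniqueness it is enough to compare half-open
    intervals; a negative [a] reverses them and moves the open end to the other side. *)
Lemma lebesgue_measure_affine (a c : R) (A : set (measurableTypeR R)) : a != 0 ->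
  measurable A ->
  lebesgue_measure A =
    (`|a|%:E * lebesgue_measure ((fun t : R => (a * t + c)%R) @^-1` A))%E.
Proof.
move=> a0 mA.
pose mu (B : set (measurableTypeR R)) :=
  (`|a|%:E * lebesgue_measure ((fun t : R => (a * t + c)%R) @^-1` B))%E.
have [m mE] : exists m : {measure set (measurableTypeR R) -> \bar R}, m = mu :> (set R -> \bar R).
  have [p pE] := pushforward_measureP (@lebesgue_measure R) (measurable_affine a c).
  by exists (mscale (`|a|%:nng) p); apply/funext => B; rewrite /mu /mscale /=; congr (_ * _)%E; rewrite pE.
suff -> : lebesgue_measure A = m A by rewrite mE.
apply: lebesgue_measure_unique => // _ [[x y]] _ <-; rewrite mE.
rewrite /mu.
have [xy|yx] := ltP x y; last first.
  by rewrite set_itv_ge ?bnd_simp -?leNgt// preimage_set0 !measure0 mule0.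
rewrite lebesgue_measure_itv /= lte_fin xy.
case: (ltgtP 0 a) => [a_gt0|a_lt0|a00]; last by rewrite -a00 eqxx in a0.
- have -> : (fun t : R => a * t + c) @^-1` `]x, y] = `](x - c) / a, (y - c) / a]%classic.
    apply/seteqP; split=> t /=; rewrite !in_itv /= ltr_pdivrMr// ler_pdivlMr//;
      by rewrite ltrBlDr lerBrDr mulrC.
  rewrite lebesgue_measure_itv /= lte_fin ltr_pM2r ?invr_gt0// ltrD2r xy.
  rewrite -!EFinB -EFinM (gtr0_norm a_gt0); congr (_%:E); field.
  exact: a0.
- have -> : (fun t : R => a * t + c) @^-1` `]x, y] = `[(y - c) / a, (x - c) / a[%classic.
    apply/seteqP; split=> t /=; rewrite !in_itv /= ltr_ndivlMr// ler_ndivrMr//;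
      by rewrite ltrBlDr lerBrDr mulrC andbC.
  rewrite lebesgue_measure_itv /= lte_fin ltr_nM2r ?invr_lt0// ltrD2r xy.
  rewrite -!EFinB -EFinM (ltr0_norm a_lt0); congr (_%:E); field.
  exact: a0.
Qed.

Lemma integral_affine (a c : R) (f : R -> \bar R) : a != 0 ->
  measurable_fun setT f -> (forall x, 0 <= f x)%E ->
  (\int[lebesgue_measure]_(t in setT) f t =
    `|a|%:E * \int[lebesgue_measure]_(t in setT) f (a * t + c)%R)%E.
Proof.
move=> a0 mf f0.
pose phi : measurableTypeR R -> measurableTypeR R := fun t => a * t + c.
have mphi : measurable_fun setT phi := measurable_affine a c.
have := ge0_integral_pushforward mphi (@lebesgue_measure R) measurableT mf (fun y _ => f0 y).
rewrite preimage_setT => <-.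
have [p pE] := pushforward_measureP (@lebesgue_measure R) mphi.
rewrite (_ : pushforward _ _ = p); last by rewrite pE.
have := @ge0_integral_mscale _ _ R p setT measurableT (`|a|%:nng) f mf.
move=> <-; last by move=> x _; exact: f0.
apply: eq_measure_integral => A mA _.
apply: etrans (lebesgue_measure_affine c a0 mA) _.
by rewrite /mscale /=; congr (_ * _)%E; rewrite pE.
Qed.

End affine1.

(** * Dyadic cubes and Borel sets *)

Section dyadic.
Context {R : realType}.

Definition box n (a b : 'rV[R]_n) : set 'rV[R]_n :=
  [set x | forall i, a 0 i <= x 0 i < b 0 i].

Definition dyadic_index n (k : nat) (x : 'rV[R]_n) : 'rV[int]_n :=
  \row_i Num.floor (2 ^+ k * x 0 i).

(** Half-open cubes of side 1 / 2^k. As fibres of [dyadic_index], those of one level partition the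
    space, and each lies in exactly one cube of every coarser level. *)
Definition dyadic n (k : nat) (z : 'rV[int]_n) : set 'rV[R]_n :=
  [set x | dyadic_index k x = z].

Lemma dyadicP n k z (x : 'rV[R]_n) :
  dyadic k z x <-> forall i, (z 0 i)%:~R <= 2 ^+ k * x 0 i < (z 0 i + 1)%:~R.
Proof.
split=> [<- i|H]; first by rewrite mxE Num.Theory.floor_itv.
by apply/rowP => i; rewrite mxE; apply: Num.Theory.floor_def; exact: H.
Qed.

Lemma dyadic_box n k (z : 'rV[int]_n) :
  dyadic k z = box (\row_i ((z 0 i)%:~R / 2 ^+ k)) (\row_i ((z 0 i + 1)%:~R / 2 ^+ k)).
Proof.
have k0 : 0 < 2 ^+ k :> R by rewrite exprn_gt0.
apply/seteqP; split=> [x /dyadicP H i|x H].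
  by rewrite !mxE ler_pdivrMr// ltr_pdivlMr// mulrC.
apply/dyadicP => i; have := H i; rewrite !mxE ler_pdivrMr// ltr_pdivlMr//.
by rewrite [_ * 2 ^+ k]mulrC.
Qed.

Lemma dyadic_index_half n k (x y : 'rV[R]_n) :
  dyadic_index k.+1 x = dyadic_index k.+1 y -> dyadic_index k x = dyadic_index k y.
Proof.
have H (t s : R) : Num.floor (2 * t) = Num.floor (2 * s) -> Num.floor t = Num.floor s.
  move=> E; apply/esym; apply: Num.Theory.floor_def.
  have /andP[t1 t2] := Num.Theory.floor_itv t.
  have : 2 * Num.floor t <= Num.floor (2 * t).
    by rewrite Num.Theory.floor_ge_int intrM ler_pM2l.
  rewrite E Num.Theory.floor_ge_int intrM ler_pM2l// => ->.
  have : Num.floor (2 * t) < 2 * (Num.floor t + 1).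
    by rewrite Num.Theory.floor_lt_int intrM ltr_pM2l.
  by rewrite E Num.Theory.floor_lt_int intrM ltr_pM2l.
move=> /rowP E; apply/rowP => i; have := E i; rewrite !mxE !exprS -!mulrA.
exact: H.
Qed.

Lemma dyadic_index_le n k k' (x y : 'rV[R]_n) : (k <= k')%N ->
  dyadic_index k' x = dyadic_index k' y -> dyadic_index k x = dyadic_index k y.
Proof.
move=> /subnKC <-; elim: (k' - k)%N => [|m IH]; first by rewrite addn0.
by rewrite addnS => /dyadic_index_half.
Qed.

Lemma dyadic_small n k (x y : 'rV[R]_n) :
  dyadic_index k x = dyadic_index k y -> forall i, `|x 0 i - y 0 i| < (2 ^+ k)^-1.
Proof.
move=> E i; have /dyadicP/(_ i) H1 : dyadic k (dyadic_index k y) x by [].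
have /dyadicP/(_ i) H2 : dyadic k (dyadic_index k y) y by [].
have k0 : 0 < 2 ^+ k :> R by rewrite exprn_gt0.
rewrite -(ltr_pM2l k0) mulfV ?gt_eqF// -{1}(gtr0_norm k0) -normrM mulrBr.
move: H1 H2; rewrite intrD; set u := _%:~R.
move: (2 ^+ k * _) (2 ^+ k * _) => p q /andP[? ?] /andP[? ?].
by rewrite ltr_norml; apply/andP; split; lra.
Qed.

Lemma dyadic_nbhs n (x : 'rV[R]_n) (U : set 'rV[R]_n) : nbhs x U ->
  \forall k \near \oo, forall y, dyadic_index k y = dyadic_index k x -> U y.
Proof.
move=> /nbhs_ballP[r /= r0 rU].
have : (fun k : nat => (2 ^+ k)^-1 : R) @ \oo --> (0 : R).
  have -> : (fun k : nat => (2 ^+ k)^-1 : R) = (fun k => 2^-1 ^+ k).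
    by apply/funext => k; rewrite exprVn.
  by apply: cvg_expr; rewrite gtr0_norm// invf_lt1// ltr1n.
move=> /cvgrPdist_lt/(_ _ r0); apply: filterS => k; rewrite sub0r normrN => kr y E.
apply/rU/ball_rVP => // i; apply: lt_le_trans (dyadic_small (esym E) i) _.
by apply: le_trans (ltW kr); rewrite ler_norm.
Qed.

Lemma open_dyadic n (U : set 'rV[R]_n) : open U ->
  U = \bigcup_(p in [set p : nat * 'rV[int]_n | dyadic p.1 p.2 `<=` U]) dyadic p.1 p.2.
Proof.
move=> oU; apply/seteqP; split=> [x Ux|x [p pU]]; last exact: pU.
have /dyadic_nbhs[k _ /(_ k (leqnn k)) kU] : nbhs x U by exact: open_nbhs_nbhs.
by exists (k, dyadic_index k x).
Qed.

(** There are countably many dyadic cubes and an open set is the union of those it contains, so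
    measurability can be tested on cubes. *)
Lemma open_sigma_dyadic n d (T : measurableType d) (f : T -> 'rV[R]_n) :
  (forall k z, measurable (f @^-1` dyadic k z)) ->
  forall U, open U -> measurable (f @^-1` U).
Proof.
move=> mf U /open_dyadic ->; rewrite preimage_bigcup bigcup_mkcond.
apply: countable_bigcupT_measurable => [|i]; first exact: countableP.
by case: ifP => // _; exact: mf.
Qed.

Lemma measurable_borel_fun n d (T : measurableType d) (f : T -> borel 'rV[R]_n) :
  (forall k z, measurable (f @^-1` dyadic k z)) -> measurable_fun setT f.
Proof.
move=> mf; apply: (@measurability _ _ _ (borel 'rV[R]_n) setT f (@open 'rV[R]_n) erefl) => // _ [U oU <-].
by rewrite setTI; exact: open_sigma_dyadic.
Qed.

Lemma open_borel_measurable (T : ptopologicalType) (U : set T) :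
  open U -> measurable (U : set (borel T)).
Proof. by move=> oU; exact: sub_sigma_algebra. Qed.

Lemma continuous_borel_measurable (T S : ptopologicalType) (f : T -> S) :
  continuous f -> measurable_fun setT (f : borel T -> borel S).
Proof.
move=> /continuousP cf; apply: (@measurability _ _ (borel T) (borel S) setT f (@open S) erefl) => // _ [U oU <-].
by rewrite setTI; apply: open_borel_measurable; exact: cf.
Qed.

Lemma continuous_borel_measurable_real (T : ptopologicalType) (f : T -> R) :
  continuous f -> measurable_fun setT (f : borel T -> measurableTypeR R).
Proof.
move=> /continuousP cf; apply: (measurability _ (RGenOpens.measurableE R)).
move=> _ [_ [a [b ->] <-]]; rewrite setTI.
by apply: open_borel_measurable; apply: cf; exact: interval_open.
Qed.

Lemma measurable_box n (a b : 'rV[R]_n) : measurable (box a b : set (borel 'rV[R]_n)).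
Proof.
have -> : box a b = \bigcap_(i : 'I_n) ((fun x : 'rV[R]_n => x 0 i) @^-1` `[a 0 i, b 0 i[).
  apply/seteqP; split=> [x H i _|x H i]; first by rewrite /= in_itv; exact: H.
  by have := H i I; rewrite /= in_itv.
apply: fin_bigcap_measurable => // i _.
have := continuous_borel_measurable_real (@coord_continuousr R n i).
move=> /(_ measurableT (`[a 0 i, b 0 i[%classic : set R)); rewrite setTI; apply.
exact: measurable_itv.
Qed.

Lemma measurable_dyadic n k (z : 'rV[int]_n) :
  measurable (dyadic k z : set (borel 'rV[R]_n)).
Proof. by rewrite dyadic_box; exact: measurable_box. Qed.

End dyadic.

(** * Measures by slicing along the first coordinate *)

Section slice.
Context {R : realType}.
Local Notation L1 := (@lebesgue_measure R).

(** The type ['rV_m.+1] is convertible to ['rV_(1 + m)], so that this is the map in the definition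
    of [lebesgue_rV] and [lebesgue_rVS] holds by computation. *)
Definition cons_rV m (p : R * 'rV[R]_m) : 'rV[R]_m.+1 :=
  row_mx (p.1%:M : 'M[R]_1) p.2 : 'rV[R]_(1 + m).

Lemma cons_rV0 m (p : R * 'rV[R]_m) : cons_rV p 0 ord0 = p.1.
Proof.
rewrite (_ : ord0 = lshift m (ord0 : 'I_1)); last exact: val_inj.
apply: etrans (row_mxEl (p.1%:M : 'M[R]_1) p.2 0 ord0) _.
by rewrite mxE eqxx.
Qed.

Lemma cons_rVS m (p : R * 'rV[R]_m) i : cons_rV p 0 (lift ord0 i) = p.2 0 i.
Proof.
rewrite (_ : lift ord0 i = rshift 1 i); last exact: val_inj.
exact: (row_mxEr (p.1%:M : 'M[R]_1) p.2 0 i).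
Qed.

Lemma cons_rV_box m (a b : 'rV[R]_m.+1) (p : R * 'rV[R]_m) :
  box a b (cons_rV p) <-> `[a 0 ord0, b 0 ord0[%classic p.1 /\
    box (\row_i a 0 (lift ord0 i)) (\row_i b 0 (lift ord0 i)) p.2.
Proof.
split=> [H|[H1 H2] i].
  split; first by have := H ord0; rewrite cons_rV0 /= in_itv.
  by move=> i; rewrite !mxE -cons_rVS; exact: H.
have [j ->|->] := unliftP ord0 i; first by rewrite cons_rVS; have := H2 j; rewrite !mxE.
by rewrite cons_rV0; move: H1; rewrite /= in_itv.
Qed.

(** Links the product sigma-algebra, for which sections are measurable, to the Borel sets of
    R^(m+1): the preimage of a half-open box is a rectangle. *)
Lemma measurable_cons_rV m :
  measurable_fun setT (@cons_rV m : measurableTypeR R * borel 'rV[R]_m -> borel 'rV[R]_m.+1).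
Proof.
apply: measurable_borel_fun => k z; rewrite dyadic_box.
set a := \row_i _; set b := \row_i _.
have -> : (@cons_rV m : measurableTypeR R * borel 'rV[R]_m -> borel 'rV[R]_m.+1) @^-1` box a b =
    `[a 0 ord0, b 0 ord0[%classic `*`
    box (\row_i a 0 (lift ord0 i)) (\row_i b 0 (lift ord0 i)).
  by apply/seteqP; split=> p /cons_rV_box.
by apply: measurableX; [exact: measurable_itv|exact: measurable_box].
Qed.

Context (m : nat) (mu : {sigma_finite_measure set (borel 'rV[R]_m) -> \bar R}).

Definition slice_measure (A : set (borel 'rV[R]_m.+1)) : \bar R :=
  (\int[L1]_(t in [set: R]) mu [set v : 'rV[R]_m | A (cons_rV (t, v))])%E.

Lemma measurable_slice (A : set (borel 'rV[R]_m.+1)) t : measurable A ->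
  measurable ([set v : 'rV[R]_m | A (cons_rV (t, v))] : set (borel 'rV[R]_m)).
Proof.
move=> mA; have := measurable_cons_rV measurableT mA; rewrite setTI.
by move=> /(measurable_xsection t); rewrite xsectionE.
Qed.

Lemma measurable_fun_slice (A : set (borel 'rV[R]_m.+1)) : measurable A ->
  measurable_fun [set: measurableTypeR R]
    (fun t => mu [set v : 'rV[R]_m | A (cons_rV (t, v))]).
Proof.
move=> mA; have := measurable_cons_rV measurableT mA; rewrite setTI => mB.
have := measurable_fun_xsection mu mB; congr measurable_fun.
by apply/funext => t /=; rewrite xsectionE.
Qed.

Lemma slice_measure0 : slice_measure set0 = 0%E.
Proof. by rewrite /slice_measure integral0_eq// => t _; rewrite measure0. Qed.

Lemma slice_measure_ge0 A : (0 <= slice_measure A)%E.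
Proof. by apply: integral_ge0. Qed.

Lemma slice_measure_sigma_additive : semi_sigma_additive slice_measure.
Proof.
move=> F mF tF mUF.
have E : slice_measure (\bigcup_n F n) = (\sum_(n <oo) slice_measure (F n))%E.
  rewrite /slice_measure -integral_nneseries//; last first.
    by move=> n; exact: measurable_fun_slice.
  apply: eq_integral => t _.
  have -> : [set v | (\bigcup_n F n) (cons_rV (t, v))] =
      \bigcup_n [set v : 'rV[R]_m | F n (cons_rV (t, v))] by [].
  rewrite measure_semi_bigcup//.
  - by move=> i; exact: measurable_slice.
  - apply/trivIsetP => i j _ _ ij; apply/seteqP; split=> // v [/= Fi Fj].
    by move/trivIsetP : tF => /(_ i j I I ij)/seteqP[/(_ _ (conj Fi Fj))].
  - rewrite (_ : \bigcup_n _ = [set v : 'rV[R]_m | (\bigcup_n F n) (cons_rV (t, v))])//.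
    exact: measurable_slice.
rewrite E; apply: is_cvg_nneseries => n _ _; exact: slice_measure_ge0.
Qed.

Lemma slice_measure_box (a b : 'rV[R]_m.+1) : a 0 ord0 <= b 0 ord0 ->
  slice_measure (box a b) =
  ((b 0 ord0 - a 0 ord0)%:E *
   mu (box (\row_i a 0%R (lift ord0 i)) (\row_i b 0%R (lift ord0 i))))%E.
Proof.
move=> ab; rewrite /slice_measure; set B := box (\row_i _) _.
have E t : mu [set v : 'rV[R]_m | box a b (cons_rV (t, v))] =
    (mu B * (\1_(`[a 0 ord0, b 0 ord0[%classic : set R) t)%:E)%E.
  rewrite indicE; case: (boolP (t \in _)) => [/set_mem H|/negP H]; rewrite ?mule1 ?mule0.
    by congr (mu _); apply/seteqP; split=> v; [move=> /cons_rV_box[]|move=> Bv; apply/cons_rV_box].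
  rewrite (_ : [set v | _] = set0) ?measure0//.
  by apply/seteqP; split=> // v /cons_rV_box[/= Ht _]; apply: H; exact/mem_set.
under eq_integral do rewrite E.
rewrite ge0_integralZl//; last by apply/measurable_EFinP; exact: measurable_indic.
rewrite integral_indic// setIT muleC; congr (_ * _)%E.
rewrite /= lebesgue_measure_itv /= lte_fin; case: ltP => // ba.
by have -> : a 0 ord0 = b 0 ord0 by [apply/le_anti; rewrite ab ba]; rewrite subrr.
Qed.

End slice.

Section lebesgue_rV_is_measure.
Context {R : realType}.
Local Notation L1 := (@lebesgue_measure R).

HB.instance Definition _ m (mu : {sigma_finite_measure set (borel 'rV[R]_m) -> \bar R}) :=
  isMeasure.Build _ _ _ (slice_measure mu) (slice_measure0 mu)
    (slice_measure_ge0 mu) (@slice_measure_sigma_additive _ _ mu).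

Definition big_box n (k : nat) : set 'rV[R]_n := box (const_mx (- k%:R)) (const_mx k%:R).

Lemma big_box_cover n : \bigcup_k @big_box n k = setT.
Proof.
apply/seteqP; split=> // x _; exists (Num.truncn `|x|).+1 => // i; rewrite !mxE.
have H : `|x| < (Num.truncn `|x|).+1%:R by rewrite truncnS_gt.
have := le_lt_trans (coord_le_norm x i) H; rewrite ltr_norml => /andP[/ltW -> ->].
by [].
Qed.

Lemma sigma_finite_box n (mu : {measure set (borel 'rV[R]_n) -> \bar R}) :
  (forall a b : 'rV[R]_n, (mu (box a b) < +oo)%E) -> sigma_finite setT mu.
Proof.
move=> H; exists (@big_box n); first by rewrite big_box_cover.
by move=> k; split; [exact: measurable_box|exact: H].
Qed.

Lemma box_eq0 n (a b : 'rV[R]_n) i : b 0 i <= a 0 i -> box a b = set0.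
Proof.
move=> ba; apply/seteqP; split=> // x /(_ i) /andP[h1 h2].
by have := le_lt_trans h1 h2; rewrite ltNge ba.
Qed.

(** Sigma-finiteness accompanies the value on boxes through the induction: measurability of the
    slices uses it in dimension [n], and finite values on boxes restore it in dimension [n.+1]. *)
Lemma lebesgue_rV_spec n :
  exists mu : {sigma_finite_measure set (borel 'rV[R]_n) -> \bar R},
    mu = @lebesgue_rV R n :> (set _ -> \bar R) /\
    forall a b : 'rV[R]_n, (forall i, a 0 i <= b 0 i) ->
      mu (box a b) = (\prod_i (b 0 i - a 0 i))%:E.
Proof.
elim: n => [|n [mu [muE muB]]].
  (* In dimension 0 every box is the whole one-point space, and the empty product is 1. *)
  exists (dirac (0 : borel 'rV[R]_0)); split=> // a b ab.
  by rewrite /= diracE big_ord0 mem_set//; case.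
have B (a b : 'rV[R]_n.+1) : (forall i, a 0 i <= b 0 i) ->
    slice_measure mu (box a b) = (\prod_i (b 0 i - a 0 i))%:E.
  move=> ab; rewrite slice_measure_box// muB; last by move=> i; rewrite !mxE.
  rewrite big_ord_recl EFinM; congr (_ * (_)%:E)%E.
  by apply: eq_bigr => i _; rewrite !mxE.
have sf : sigma_finite setT (slice_measure mu).
  apply: (@sigma_finite_box _ (slice_measure mu)) => a b.
  have [ab|/existsNP[i /negP]] := pselect (forall i, a 0 i <= b 0 i).
    by rewrite /= B// ltry.
  by rewrite -ltNge => /ltW /box_eq0 ->; rewrite measure0.
pose nu : {sigma_finite_measure set (borel 'rV[R]_n.+1) -> \bar R} :=
  HB.pack (slice_measure mu) (Measure.on (slice_measure mu))
    (@Measure_isSigmaFinite.Build _ _ _ (slice_measure mu) sf).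
exists nu; split; last exact: B.
by rewrite /= /slice_measure muE.
Qed.

Lemma lebesgue_rV0 n : @lebesgue_rV R n set0 = 0%E.
Proof. by have [mu [<- _]] := lebesgue_rV_spec n; rewrite measure0. Qed.

Lemma lebesgue_rV_ge0 n A : (0 <= @lebesgue_rV R n A)%E.
Proof. by have [mu [<- _]] := lebesgue_rV_spec n; rewrite measure_ge0. Qed.

Lemma lebesgue_rV_sigma_additive n : semi_sigma_additive (@lebesgue_rV R n).
Proof.
by have [mu [<- _]] := lebesgue_rV_spec n; exact: measure_semi_sigma_additive.
Qed.

HB.instance Definition _ n :=
  isMeasure.Build _ _ _ (@lebesgue_rV R n) (lebesgue_rV0 n)
    (@lebesgue_rV_ge0 n) (@lebesgue_rV_sigma_additive n).

Lemma lebesgue_rV_box n (a b : 'rV[R]_n) : (forall i, a 0 i <= b 0 i) ->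
  lebesgue_rV (box a b) = (\prod_i (b 0 i - a 0 i))%:E.
Proof. by have [mu [<- H]] := lebesgue_rV_spec n; exact: H. Qed.

Lemma lebesgue_rV_box_lty n (a b : 'rV[R]_n) : (lebesgue_rV (box a b) < +oo)%E.
Proof.
have [ab|/existsNP[i /negP]] := pselect (forall i, a 0 i <= b 0 i).
  by rewrite /= lebesgue_rV_box// ltry.
by rewrite -ltNge => /ltW /box_eq0 ->; rewrite measure0.
Qed.

Lemma lebesgue_rV_sigma_finite n : sigma_finite setT (@lebesgue_rV R n).
Proof. by apply: sigma_finite_box => a b; exact: lebesgue_rV_box_lty. Qed.

HB.instance Definition _ n :=
  @Measure_isSigmaFinite.Build _ _ _ (@lebesgue_rV R n) (@lebesgue_rV_sigma_finite n).

Lemma lebesgue_rVS n (A : set (borel 'rV[R]_n.+1)) :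
  lebesgue_rV A = (\int[L1]_(t in [set: R])
    @lebesgue_rV R n [set v : 'rV[R]_n | A (cons_rV (t, v))])%E.
Proof. by []. Qed.

Lemma box_setI n : setI_closed [set box a b | a in [set: 'rV[R]_n] & b in [set: 'rV[R]_n]].
Proof.
move=> _ _ [a _ [b _ <-]] [c _ [d _ <-]].
exists (\row_i Num.max (a 0 i) (c 0 i)) => //.
exists (\row_i Num.min (b 0 i) (d 0 i)) => //.
apply/seteqP; split=> [x H|x [H1 H2] i].
  by split=> i; have := H i; rewrite !mxE ge_max lt_min =>
    /andP[/andP[h1 h2] /andP[h3 h4]]; apply/andP.
rewrite !mxE ge_max lt_min; have := H1 i; have := H2 i.
by move=> /andP[-> ->] /andP[-> ->].
Qed.

Lemma borel_boxE n : @measurable _ (borel 'rV[R]_n) =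
  <<s [set box a b | a in [set: 'rV[R]_n] & b in [set: 'rV[R]_n]] >>.
Proof.
set G := [set _ | _ in _ & _ in _].
apply/seteqP; split; last first.
  apply: smallest_sub; first exact: sigma_algebra_measurable.
  by move=> _ [a _ [b _ <-]]; exact: measurable_box.
apply: smallest_sub; first exact: smallest_sigma_algebra.
move=> U oU.
have := @open_sigma_dyadic R n _ (g_sigma_algebraType G) id _ U oU.
apply => k z; apply: sub_sigma_algebra; rewrite preimage_id dyadic_box.
by eexists => //; eexists.
Qed.

(** Boxes are stable under intersection and generate the Borel sets, and the [big_box] exhaust the
    space with finite measure. *)
Lemma lebesgue_rV_unique n (nu : {measure set (borel 'rV[R]_n) -> \bar R}) :
  (forall a b : 'rV[R]_n, (forall i, a 0 i <= b 0 i) ->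
     nu (box a b) = (\prod_i (b 0 i - a 0 i))%:E) ->
  forall A, measurable A -> lebesgue_rV A = nu A.
Proof.
move=> H A mA.
have := @measure_unique _ R (borel 'rV[R]_n) _ (@big_box n) (borel_boxE n)
  (@box_setI n) _ _ (@lebesgue_rV R n) nu.
apply => //.
- by move=> k; eexists => //; eexists.
- exact: big_box_cover.
- move=> _ [a _ [b _ <-]].
  have [ab|/existsNP[i /negP]] := pselect (forall i, a 0 i <= b 0 i).
    by rewrite /= lebesgue_rV_box// H.
  by rewrite -ltNge => /ltW /box_eq0 ->; rewrite !measure0.
- by move=> k; exact: lebesgue_rV_box_lty.
Qed.

End lebesgue_rV_is_measure.

(** * Affine changes of variables *)

Section linear_change.
Context {R : realType}.
Local Notation L1 := (@lebesgue_measure R).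

(** The translation [c] is part of the property because a triangular map acts on each slice with a
    translation that depends on the first coordinate. *)
Definition scales n (L : 'M[R]_n) := forall (c : 'rV[R]_n) (A : set (borel 'rV[R]_n)),
  measurable A ->
  lebesgue_rV A = (`|\det L|%:E * lebesgue_rV [set x | A (x *m L + c)%R])%E.

Lemma continuous_affine_mx m n (L : 'M[R]_(m, n)) (c : 'rV[R]_n) :
  continuous (fun x : 'rV[R]_m => x *m L + c).
Proof.
move=> x; have -> : (fun x : 'rV[R]_m => x *m L + c) =
    fun x => \row_j (\sum_i x 0 i * L i j + c 0 j).
  by apply/funext => y; apply/rowP => j; rewrite !mxE.
apply: continuous_row => j.
apply: continuousD; last exact: cst_continuous.
have -> : (fun x : 'rV[R]_m => \sum_i x 0 i * L i j) =
    fun x => \sum_i L i j * x 0 i.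
  by apply/funext => y; apply: eq_bigr => i _; rewrite mulrC.
have C : Ck 0 setT (fun x : 'rV[R]_m => \sum_i L i j * x 0 i).
  apply: (@Ck_sum _ _ 0 setT _ _ _ (fun i (x : 'rV[R]_m) => L i j * x 0 i)).
    exact: openT.
  move=> i; apply: Ck_mul; [exact: openT|exact: Ck_cst|apply: Ck_coord; exact: openT].
exact: Ck_continuous C _.
Qed.

Lemma measurable_affine_mx m n (L : 'M[R]_(m, n)) (c : 'rV[R]_n) (A : set (borel 'rV[R]_n)) :
  measurable A -> measurable ([set x | A (x *m L + c)] : set (borel 'rV[R]_m)).
Proof.
move=> mA; have := continuous_borel_measurable (@continuous_affine_mx m n L c).
by move=> /(_ measurableT A mA); rewrite setTI.
Qed.

Lemma scalesM n (L1' L2 : 'M[R]_n) : scales L1' -> scales L2 -> scales (L1' *m L2).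
Proof.
move=> H1 H2 c A mA.
rewrite (H2 c A mA) (H1 0 _ (measurable_affine_mx L2 c mA)).
rewrite muleA -EFinM -normrM -det_mulmx det_mulmx mulrC -det_mulmx.
congr (_ * lebesgue_rV _)%E; apply/seteqP; split=> x /=; by rewrite addr0 mulmxA.
Qed.

(** The first coordinate is mapped to [u * t + c0] whatever the others are. This rescales the outer
    integral by the absolute value of [u], and on each slice the induction hypothesis for [U']
    applies. *)
Lemma scales_upper n (U : 'M[R]_n) : (forall i j : 'I_n, (j < i)%N -> U i j = 0) ->
  U \in unitmx -> scales U.
Proof.
elim: n U => [|n IH] U upU uU c A mA.
  rewrite (_ : U = 1%:M) ?det1 ?normr1 ?mul1e; last by apply/matrixP => -[].
  congr lebesgue_rV; apply/seteqP; split=> x /=;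
    by rewrite (_ : x *m _ + c = x)//; apply/rowP => -[].
change 'M[R]_(1 + n) in U; change 'rV[R]_(1 + n) in c.
pose u := (ulsubmx U : 'M[R]_1) 0 0; pose w := ursubmx U; pose U' := drsubmx U.
have UE : U = block_mx (u%:M : 'M[R]_1) w 0 U'.
  rewrite -[LHS]submxK; congr block_mx; first exact: mx11_scalar.
  by apply/matrixP => i j; rewrite !mxE upU//= ord1.
have dU : \det U = u * \det U' by rewrite UE det_ublock det_scalar1.
move: uU; rewrite unitmxE dU unitrM unitfE => /andP[u0 uU'].
have upU' (i j : 'I_n) : (j < i)%N -> U' i j = 0.
  by move=> ji; rewrite /U' !mxE upU.
pose c0 := (lsubmx c : 'M[R]_1) 0 0; pose c' := rsubmx c.
have cE : c = row_mx (c0%:M : 'M[R]_1) c'.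
  by rewrite -[LHS]hsubmxK; congr row_mx; exact: mx11_scalar.
have consE t (v : 'rV[R]_n) : cons_rV (t, v) *m U + c =
    cons_rV (u * t + c0, v *m U' + (t *: w + c')).
  apply: etrans (_ : row_mx (t%:M : 'M[R]_1) v *m U + c = _) _; first by [].
  rewrite UE cE mul_row_block add_row_mx /cons_rV /=; congr row_mx.
    by rewrite mulmx0 addr0 -scalar_mxM -raddfD/= mulrC.
  by rewrite mul_scalar_mx [RHS]addrCA addrA.
rewrite !lebesgue_rVS.
set g := fun t => lebesgue_rV [set v : 'rV[R]_n | A (cons_rV (t, v))].
have mg : measurable_fun [set: measurableTypeR R] g.
  exact: (@measurable_fun_slice R n (@lebesgue_rV R n) A mA).
rewrite (integral_affine c0 u0 mg); last by move=> t; exact: measure_ge0.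
rewrite normrM EFinM -muleA; congr (_ * _)%E.
rewrite -ge0_integralZl//; last first.
- have := @measurable_fun_slice R n (@lebesgue_rV R n) _ (measurable_affine_mx U c mA).
  by [].
apply: eq_integral => t _.
rewrite /g; have := IH U' upU' uU' (t *: w + c') _ (@measurable_slice R n A (u * t + c0) mA).
move=> ->; congr (_ * lebesgue_rV _)%E.
by apply/seteqP; split=> v /=; rewrite consE.
Qed.

(** Preimages of boxes are boxes with permuted sides, so uniqueness of the measure applies. *)
Lemma scales_perm n (s : 'S_n) : scales (perm_mx s : 'M[R]_n).
Proof.
move=> c A mA.
have mphi : measurable_fun setT ((fun x => x *m perm_mx s + c) : borel 'rV[R]_n -> borel 'rV[R]_n).
  by apply: continuous_borel_measurable; exact: (@continuous_affine_mx n n).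
have [p pE] := pushforward_measureP (@lebesgue_rV R n) mphi.
have E x i : (x *m perm_mx s + c : 'rV[R]_n) 0 i = x 0 (s^-1%g i) + c 0 i.
  by rewrite -(invgK s) -col_permE invgK !mxE.
rewrite det_perm normrX normrN1 expr1n mul1e.
transitivity (p A); last by rewrite pE.
apply: lebesgue_rV_unique => // a b ab; rewrite pE.
rewrite (_ : _ @^-1` _ = box (\row_i (a 0 (s i) - c 0 (s i))) (\row_i (b 0 (s i) - c 0 (s i)))).
  apply: etrans (lebesgue_rV_box _) _; first by move=> i; rewrite !mxE lerD2r.
  congr (_%:E); rewrite [RHS](reindex_inj (@perm_inj _ s)) /=.
  by apply: eq_bigr => i _; rewrite !mxE; ring.
apply/seteqP; split=> x H i.
  by have := H (s i); rewrite /= E permK !mxE lerBlDr ltrBrDr.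
by have := H (s^-1%g i); rewrite E !mxE permKV lerBlDr ltrBrDr.
Qed.

(** LUP decomposition: the lower triangular factor becomes upper triangular when conjugated by the
    permutation that reverses the coordinates. *)
Lemma scales_unit n (L : 'M[R]_n) : L \in unitmx -> scales L.
Proof.
case: n L => [|n] L uL.
  by apply: scales_upper => // -[].
have := cormen_lup_correct L; have := cormen_lup_perm L.
have := cormen_lup_lower L; have := cormen_lup_upper L; have := cormen_lup_detL L.
case: cormen_lup => -[P Lo] Up /= detLo upUp loLo /is_perm_mxP[s ->] E.
have LE : L = perm_mx s^-1 *m (Lo *m Up).
  rewrite (_ : Lo *m Up = perm_mx s *m L)//.
  by rewrite mulmxA -perm_mxM mulVg perm_mx1 mul1mx.
have uLo : Lo \in unitmx by rewrite unitmxE detLo unitr1.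
have uUp : Up \in unitmx.
  have := uL; rewrite LE unitmx_mul unitmx_perm /= unitmx_mul => /andP[_]; exact.
pose r : 'S_n.+1 := perm (@rev_ord_inj n.+1).
have rr : (r * r)%g = 1%g by apply/permP => i; rewrite permM !permE rev_ordK.
pose Up' := perm_mx r *m Lo *m perm_mx r.
have LoE : Lo = perm_mx r *m (Up' *m perm_mx r).
  rewrite /Up' -!mulmxA -perm_mxM rr perm_mx1 mulmx1 mulmxA -perm_mxM rr.
  by rewrite perm_mx1 mul1mx.
rewrite LE; apply: scalesM; first exact: scales_perm.
apply: scalesM; last exact: scales_upper.
rewrite LoE; apply: scalesM; first exact: scales_perm.
apply: scalesM; last exact: scales_perm.
apply: scales_upper; last by rewrite /Up' !unitmx_mul !unitmx_perm uLo.
have rV : (r^-1 = r)%g by apply/eqP; rewrite eq_invg_mul rr.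
have -> : Up' = col_perm r (row_perm r Lo) by rewrite col_permE row_permE rV.
move=> i j ji; rewrite !mxE !permE loLo.
  by rewrite (inj_eq rev_ord_inj) -val_eqE gtn_eqF.
by rewrite /= leq_sub2l// ltnW.
Qed.

Lemma lebesgue_rV_linear n (L : 'M[R]_n) (c : 'rV[R]_n) (A : set (borel 'rV[R]_n)) :
  L \in unitmx -> measurable A ->
  lebesgue_rV A = (`|\det L|%:E * lebesgue_rV [set x | A (x *m L + c)%R])%E.
Proof. by move=> uL mA; exact: scales_unit. Qed.

Lemma lebesgue_rV_translate n (c : 'rV[R]_n) (A : set (borel 'rV[R]_n)) : measurable A ->
  lebesgue_rV A = lebesgue_rV [set x | A (x + c)].
Proof.
move=> mA; rewrite (lebesgue_rV_linear c (unitmx1 _ _) mA) det1 normr1 mul1e.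
by congr lebesgue_rV; apply/seteqP; split=> x /=; rewrite mulmx1.
Qed.

End linear_change.

(** * Comparison of measures on dyadic cubes *)

Section dyadic_comparison.
Context {R : realType} {n : nat}.
Local Open Scope ereal_scope.

Lemma dyadic_sub k k' (z z' : 'rV[int]_n) (x : 'rV[R]_n) : (k <= k')%N ->
  dyadic k z x -> dyadic k' z' x -> dyadic k' z' `<=` (dyadic k z : set 'rV[R]_n).
Proof. by move=> kk' <- <- y /(dyadic_index_le kk'). Qed.

(** Goodness requires the inequality on all subcubes, hence is inherited by them. So the unions
    [O_ k] of the good cubes of level [k] increase to [O]; each is a countable disjoint union, over
    which the inequality can be summed. *)
Lemma dyadic_comparison (mu nu : {measure set (borel 'rV[R]_n) -> \bar R})
    (O : set 'rV[R]_n) (c : R) : (0 <= c)%R -> open O ->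
  (forall x, O x -> exists2 V : set 'rV[R]_n, nbhs x V &
    forall k z, dyadic k z `<=` V -> nu (dyadic k z) <= c%:E * mu (dyadic k z)) ->
  nu O <= c%:E * mu O.
Proof.
move=> c0 oO H.
pose good k (z : 'rV[int]_n) := (dyadic k z `<=` O) /\ forall k' (z' : 'rV[int]_n),
  (k <= k')%N -> dyadic k' z' `<=` (dyadic k z : set 'rV[R]_n) ->
  nu (dyadic k' z') <= c%:E * mu (dyadic k' z').
pose F k j : set (borel 'rV[R]_n) :=
  if pickle_inv j is Some z then (if `[< good k z >] then dyadic k z else set0) else set0.
have FP k j x : F k j x -> exists z, [/\ good k z, pickle z = j & dyadic k z x].
  rewrite /F; have := pickle_invK (T := 'rV[int]_n) j.
  by case: (pickle_inv j) => [z|]//= zj; case: asboolP => // gz xz; exists z.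
have mF k j : measurable (F k j).
  rewrite /F; case: (pickle_inv j) => [z|]; last exact: measurable0.
  by case: ifP => // _; exact: measurable_dyadic.
have tF k : trivIset setT (F k).
  apply/trivIsetP => i j _ _ ij; apply/seteqP; split=> // x [/FP[z [_ zi zx]] /FP[z' [_ zj zx']]].
  by move: ij; rewrite -zi -zj -zx -zx' eqxx.
pose O_ k := \bigcup_j F k j.
have mO k : measurable (O_ k) by exact: bigcupT_measurable.
have O_O : \bigcup_k O_ k = O.
  apply/seteqP; split=> [x [k _ [j _ /FP[z [[zO _] _ xz]]]]|x Ox]; first exact: zO.
  have [V Vx HV] := H x Ox.
  have /dyadic_nbhs[k _ /(_ k (leqnn k)) kVO] : nbhs x (V `&` O).
    by apply: filterI => //; exact: open_nbhs_nbhs.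
  have gk : good k (dyadic_index k x).
    split=> [y /kVO[]//|k' z' kk' sub]; apply: HV => y /sub /kVO[].
    by [].
  exists k => //; exists (pickle (dyadic_index k x)) => //.
  by rewrite /F pickleK_inv asboolT.
have O_nd : {homo O_ : k m / (k <= m)%N >-> (k <= m)%O}.
  move=> k m km; apply/subsetPset => x [j _ /FP[z [[zO Hz] _ xz]]].
  have sub : dyadic m (dyadic_index m x) `<=` (dyadic k z : set 'rV[R]_n).
    by apply: (dyadic_sub km xz).
  exists (pickle (dyadic_index m x)) => //.
  rewrite /F pickleK_inv asboolT//; split=> [y /sub /zO//|k' z' mk' sub'].
  by apply: Hz; [exact: leq_trans mk'|move=> y /sub' /sub].
have mUO : measurable (\bigcup_k O_ k) by exact: bigcupT_measurable.
have Hk k : nu (O_ k) <= c%:E * mu O.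
  apply: (@le_trans _ _ (c%:E * mu (O_ k))).
    rewrite /O_ !measure_semi_bigcup//; try exact: mO.
    rewrite -nneseriesZl//; apply: lee_nneseries => // j _.
    rewrite /F; case: (pickle_inv j) => [z|]; last by rewrite !measure0 mule0.
    by case: asboolP => [[_ Hz]|_]; [exact: Hz|rewrite !measure0 mule0].
  apply: lee_wpmul2l; first by rewrite lee_fin.
  apply: le_measure; rewrite ?inE//; last by rewrite -O_O; exact: bigcup_sup.
  exact: open_borel_measurable.
have := @nondecreasing_cvg_mu _ _ _ nu O_ mO mUO O_nd.
rewrite O_O => C; apply: (cvge_le _ C).
by near=> k; exact: Hk.
Unshelve. all: by end_near. Qed.

End dyadic_comparison.

(** * Integrals of compactly supported functions *)

Section parts.
Context {R : realType}.

Lemma bounded_support_integrable d (T : measurableType d)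
    (mu : {measure set T -> \bar R}) (A : set T) (M : R) (f : T -> R) :
  measurable A -> (mu A < +oo)%E -> measurable_fun setT f ->
  (forall x, `|f x| <= M) -> (forall x, ~ A x -> f x = 0) ->
  mu.-integrable setT (EFin \o f).
Proof.
move=> mA Afin mf fM f0.
have M0 x : A x -> 0 <= M by move=> _; exact: le_trans (fM x).
apply/integrableP; split; first exact/measurable_EFinP.
apply: (@le_lt_trans _ _ (\int[mu]_(x in setT) ((`|M|)%:E * (\1_A x)%:E))%E).
  apply: ge0_le_integral => //.
  - apply/measurable_EFinP; apply: measurableT_comp => //.
  - by apply: measurable_funeM; apply/measurable_EFinP; exact: measurable_indic.
  - move=> x _; rewrite /= -EFinM lee_fin indicE; case: (boolP (x \in A)) => xA.
      by rewrite mulr1 (le_trans (fM x))// ler_norm.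
    by rewrite f0 ?normr0 ?mulr0//; move/negP: xA => xA Ax; apply: xA; exact/mem_set.
rewrite ge0_integralZl//; last by apply/measurable_EFinP; exact: measurable_indic.
rewrite integral_indic// setIT; move: Afin; rewrite -ge0_fin_numE// => /fineK <-.
by rewrite -EFinM ltry.
Qed.

Lemma compact_bound (T : topologicalType) (K : set T) (f : T -> R) :
  compact K -> {within K, continuous f} -> exists2 M : R, 0 <= M & forall x, K x -> `|f x| <= M.
Proof.
move=> cK cf; have /compact_bounded[M [_ MP]] := continuous_compact cf cK.
exists (`|M| + 1); first by rewrite addr_ge0.
move=> x Kx; apply: MP; last by exists x.
by rewrite (le_lt_trans (ler_norm _))// ltrDl.
Qed.

Lemma compact_big_box n (K : set 'rV[R]_n) : compact K ->
  exists k : nat, forall x, K x -> `|x| <= k%:R.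
Proof.
move=> /compact_bounded[M [_ MP]]; exists (Num.truncn (`|M| + 1)).+1 => x Kx.
apply: (@le_trans _ _ (`|M| + 1)); last by rewrite ltW// truncnS_gt.
by apply: MP => //; rewrite (le_lt_trans (ler_norm _))// ltrDl.
Qed.

Lemma lebesgue_rV_compact_lty n (K : set 'rV[R]_n) : compact K ->
  (lebesgue_rV K < +oo)%E.
Proof.
move=> cK; have [k kP] := compact_big_box cK.
have mK : measurable (K : set (borel 'rV[R]_n)).
  rewrite -[K]setCK; apply: measurableC; apply: open_borel_measurable.
  by apply: closed_openC; apply: compact_closed => //; exact: norm_hausdorff.
apply: le_lt_trans (lebesgue_rV_box_lty (const_mx (- k.+1%:R)) (const_mx k.+1%:R)).
apply: le_measure; rewrite ?inE//; first exact: measurable_box.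
move=> x /kP xk i; rewrite !mxE; have := le_trans (coord_le_norm x i) xk.
rewrite ler_norml => /andP[h1 h2]; rewrite (le_trans _ h1)/=; last by rewrite lerN2 ler_nat.
by rewrite (le_lt_trans h2)// ltr_nat.
Qed.

Lemma integral_translate n (f : 'rV[R]_n -> R) v :
  measurable_fun setT (f : borel 'rV[R]_n -> R) ->
  (@lebesgue_rV R n).-integrable setT (EFin \o (fun x => f (x + v))) ->
  (\int[@lebesgue_rV R n]_(x in setT) (f (x + v))%:E =
   \int[@lebesgue_rV R n]_(x in setT) (f x)%:E)%E.
Proof.
move=> mf intf.
pose phi : borel 'rV[R]_n -> borel 'rV[R]_n := fun x => x + v.
have mphi : measurable_fun setT phi.
  have -> : phi = (fun x => x *m 1%:M + v) by apply/funext => x; rewrite mulmx1.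
  by apply: continuous_borel_measurable; exact: (@continuous_affine_mx R n n).
have mEf : measurable_fun setT (EFin \o f : borel 'rV[R]_n -> \bar R) by exact/measurable_EFinP.
have := @integral_pushforward _ _ _ _ R phi mphi (@lebesgue_rV R n) setT _ mEf intf measurableT.
rewrite preimage_setT => <-.
have [p pE] := pushforward_measureP (@lebesgue_rV R n) mphi.
rewrite (_ : pushforward _ _ = p); last by rewrite pE.
apply: eq_measure_integral => A mA _.
by rewrite pE; apply/esym; apply: etrans (lebesgue_rV_translate v mA) _.
Qed.

(** Translation invariance makes the integrals of the difference quotients [q k] vanish. The mean
    value theorem bounds them by a bound [M] of the derivative, so dominated convergence gives the
    limit. *)
Lemma integral_pderive0 n (f : 'rV[R]_n -> R) (K : set 'rV[R]_n) (a : 'I_n) :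
  Ck 1 setT f -> compact K -> (forall x, ~ K x -> f x = 0) ->
  (\int[@lebesgue_rV R n]_(x in setT) (pderive a f x)%:E = 0)%E.
Proof.
move=> Cf cK f0.
pose h (k : nat) : R := k.+1%:R^-1.
have h0 k : 0 < h k by rewrite invr_gt0.
have h1 k : h k <= 1 by rewrite invf_le1// ler1n.
pose ea : 'rV[R]_n := delta_mx 0 a.
pose q k (x : 'rV[R]_n) := (h k)^-1 * (f (x + h k *: ea) - f x).
have qc x : q ^~ x @ \oo --> pderive a f x.
  have D : derivable f x ea by exact: Ck_derivable Cf _.
  have H : h @ \oo --> (0 : R)^'.
    move=> A /= [e e0 eA].
    have /cvgrPdist_lt/(_ _ e0) := @cvg_harmonic R.
    apply: filterS => k; rewrite sub0r normrN => ke; apply: eA => /=.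
      by rewrite sub0r normrN.
    by rewrite gt_eqF.
  have := cvg_comp _ _ H D; apply: cvg_trans.
  rewrite (_ : _ \o h = q ^~ x)//; apply/funext => k /=.
  by rewrite /q [x + _]addrC.
have [m mP] := compact_big_box cK.
(* Of the two units of margin, one absorbs the shift by [h k <= 1] and one the open upper faces of
   the box. *)
pose B : set (borel 'rV[R]_n) := box (const_mx (- m.+2%:R)) (const_mx m.+2%:R).
have mB : measurable B by exact: measurable_box.
have fB k x : ~ B x -> f (x + h k *: ea) = 0 /\ f x = 0.
  move=> nB; have xm : m.+1%:R < `|x|.
    rewrite ltNge; apply/negP => xm; apply: nB => i; rewrite !mxE.
    have := le_trans (coord_le_norm x i) xm; rewrite ler_norml => /andP[g1 g2].
    rewrite (le_trans _ g1)/=; last by rewrite lerN2 ler_nat.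
    by rewrite (le_lt_trans g2)// ltr_nat.
  split; apply: f0 => /mP; apply/negP; rewrite -ltNge.
    have ne : `|h k *: ea| <= 1.
      rewrite normrZ (gtr0_norm (h0 k)) (le_trans _ (h1 k))// ler_piMr//; first exact: ltW.
      by apply: norm_rV_le => // j; rewrite mxE eqxx/= normr_nat lern1 leq_b1.
    have := ler_normD (x + h k *: ea) (- (h k *: ea)); rewrite addrK normrN.
    move=> H1; have := lt_le_trans xm (le_trans H1 (lerD (lexx _) ne)).
    by rewrite -addn1 natrD ltrD2r.
  by apply: lt_trans xm; rewrite ltr_nat.
have q0 k x : ~ B x -> q k x = 0.
  by move=> /(fB k)[e1 e2]; rewrite /q e1 e2 subrr mulr0.
have d0 x : ~ B x -> pderive a f x = 0.
  move=> nB; have := qc x; rewrite (_ : q ^~ x = cst 0).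
    by move=> /(cvg_lim (@Rhausdorff R)) <-; rewrite lim_cst//; exact: Rhausdorff.
  by apply/funext => k; exact: q0.
have cd : continuous (pderive a f).
  have Cd : Ck 0 setT (pderive a f) by exact: Ck_pderive.
  by move=> x; exact: Ck_continuous Cd I.
have [M M0 MP] : exists2 M : R, 0 <= M & forall x, `|pderive a f x| <= M.
  pose Q : set 'rV[R]_n := [set x | `|x| <= m.+2%:R].
  have cQ : compact Q.
    apply: bounded_closed_compact.
      by exists m.+2%:R; split=> // r rm x /= /le_trans; apply; exact: ltW.
    rewrite (_ : Q = (fun x : 'rV[R]_n => `|x|) @^-1` [set r | r <= m.+2%:R])//.
    by apply: closed_comp; [move=> x _; exact: norm_continuous|exact: closed_le].
  have [|M M0 MP] := @compact_bound _ Q (pderive a f) cQ.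
    exact: continuous_subspaceT.
  exists M => // x; have [/MP//|nQ] := pselect (Q x).
  rewrite d0 ?normr0// => Bx; apply: nQ; rewrite /Q /=; apply: norm_rV_le => // i.
  by have := Bx i; rewrite !mxE ler_norml => /andP[-> /ltW ->].
have qM k x : `|q k x| <= M.
  have [|s _ E] := @MVT_line R n f x ea (h k).
    by move=> s _; exact: Ck_derivable Cf _.
  rewrite /q (addrC x) E mulrC mulfK ?gt_eqF//.
  exact: MP.
have cf : continuous f by move=> x; exact: Ck_continuous Cf I.
have ch k : continuous (fun x : 'rV[R]_n => f (x + h k *: ea)).
  move=> x; apply: continuous_comp; last exact: cf.
  by apply: continuousD; [exact: cvg_id|exact: cst_continuous].
have cq k : continuous (q k).
  have Cfh : Ck 0 setT (fun x : 'rV[R]_n => f (x + h k *: ea)) by split=> // x _; exact: ch.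
  have Cf0 : Ck 0 setT f by split=> // x _; exact: cf.
  have Cq := Ck_mul openT (Ck_cst 0 setT (h k)^-1) (Ck_add openT Cfh (Ck_opp openT Cf0)).
  by move=> x; exact: Ck_continuous Cq I.
have mc (g : 'rV[R]_n -> R) : continuous g -> measurable_fun setT (g : borel 'rV[R]_n -> R).
  exact: continuous_borel_measurable_real.
have Blty : (@lebesgue_rV R n B < +oo)%E by exact: lebesgue_rV_box_lty.
have Iq k : (@lebesgue_rV R n).-integrable setT (EFin \o q k).
  exact: (bounded_support_integrable mB Blty (mc _ (cq k)) (qM k) (q0 k)).
have [Mf Mf0 MfP] := compact_bound cK (continuous_subspaceT cf).
have MfT x : `|f x| <= Mf.
  have [/MfP//|nK] := pselect (K x); by rewrite f0// normr0.
have If : (@lebesgue_rV R n).-integrable setT (EFin \o f).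
  apply: (bounded_support_integrable mB Blty (mc _ cf) MfT).
  by move=> x /(fB 0%N)[].
have Ifh k : (@lebesgue_rV R n).-integrable setT (EFin \o (fun x => f (x + h k *: ea))).
  apply: (bounded_support_integrable mB Blty (mc _ (ch k)) (fun x => MfT _)).
  by move=> x /(fB k)[].
have int0 k : (\int[@lebesgue_rV R n]_(x in setT) (q k x)%:E = 0)%E.
  under eq_integral do rewrite /q EFinM.
  rewrite integralZl//; last first.
    by have := integrableB measurableT (Ifh k) If.
  under eq_integral do rewrite EFinB.
  rewrite integralB_EFin// integral_translate//; last exact: mc.
  rewrite subee ?mule0//; exact: integrable_fin_num.
have IM : (@lebesgue_rV R n).-integrable setT (EFin \o (fun x => M * \1_B x)).
  apply: (@bounded_support_integrable _ _ _ B M) => //.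
  - by apply: measurable_funM => //; exact: measurable_indic.
  - move=> x; rewrite indicE; case: (x \in B); rewrite ?mulr1 ?mulr0 ?normr0//.
    by rewrite ger0_norm.
  - by move=> x nB; rewrite indicE memNset// mulr0.
have mq k : measurable_fun setT (fun x : borel 'rV[R]_n => (q k x)%:E).
  by apply/measurable_EFinP; apply: mc; exact: cq.
have md : measurable_fun setT (fun x : borel 'rV[R]_n => (pderive a f x)%:E).
  by apply/measurable_EFinP; apply: mc; exact: cd.
have [||_ _ C] := dominated_convergence measurableT mq md _ IM.
- apply: aeW => x _; apply/fine_cvgP; split; first by near=> k.
  exact: qc.
- apply: aeW => x k _; rewrite /= lee_fin indicE.
  case: (boolP (x \in B)) => xB; first by rewrite mulr1.
  by rewrite q0 ?normr0 ?mulr0//; move/negP: xB => xB Bx; apply: xB; exact/mem_set.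
have C0 : (fun k => (\int[@lebesgue_rV R n]_(x in setT) (q k x)%:E)%E) @ \oo --> 0%E.
  under eq_fun do rewrite int0.
  exact: cvg_cst.
exact: cvg_unique C C0.
Unshelve. all: by end_near. Qed.

End parts.

(** * The Levi-Civita connection under coordinate changes *)

Section matrix_calculus.
Context {R : realType} {n : nat}.
Implicit Types (U V : set 'rV[R]_n).

Definition mCk p q k U (F : 'rV[R]_n -> 'M[R]_(p, q)) :=
  forall i j, Ck k U (fun x => F x i j).

(* Sealed: unification must never unfold the entries of a derivative. *)
Fact dmx_def : {D : forall p q, 'I_n -> ('rV[R]_n -> 'M[R]_(p, q)) ->
    'rV[R]_n -> 'M[R]_(p, q) |
  forall p q a F x i j, D p q a F x i j = pderive a (fun y => F y i j) x}.
Proof.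
exists (fun p q a F x => \matrix_(i, j) pderive a (fun y => F y i j) x).
by move=> p q a F x i j; rewrite mxE.
Qed.

Definition dmx p q := sval dmx_def p q.

Lemma dmxE p q (a : 'I_n) (F : 'rV[R]_n -> 'M[R]_(p, q)) x i j :
  dmx a F x i j = pderive a (fun y => F y i j) x.
Proof. exact: (svalP dmx_def). Qed.

Lemma mCk_pred p q k U (F : 'rV[R]_n -> 'M[R]_(p, q)) : mCk k.+1 U F -> mCk k U F.
Proof. by move=> CF i j; exact: Ck_pred. Qed.

Lemma mCk_mul p q r k U (F : 'rV[R]_n -> 'M[R]_(p, q)) (G : 'rV[R]_n -> 'M[R]_(q, r)) :
  open U -> mCk k U F -> mCk k U G -> mCk k U (fun x => F x *m G x).
Proof.
move=> oU CF CG i j.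
apply: (@Ck_ext _ _ _ U _ (fun x => \sum_l F x i l * G x l j)) => //.
  by move=> x _; rewrite mxE.
apply: (@Ck_sum _ _ k U _ _ _ (fun l x => F x i l * G x l j)) => // l.
by apply: Ck_mul.
Qed.

Lemma mCk_add p q k U (F G : 'rV[R]_n -> 'M[R]_(p, q)) :
  open U -> mCk k U F -> mCk k U G -> mCk k U (fun x => F x + G x).
Proof.
move=> oU CF CG i j.
apply: (@Ck_ext _ _ _ U _ (fun x => F x i j + G x i j)) => //.
  by move=> x _; rewrite mxE.
exact: Ck_add.
Qed.

Lemma mCk_tr p q k U (F : 'rV[R]_n -> 'M[R]_(p, q)) :
  open U -> mCk k U F -> mCk k U (fun x => (F x)^T).
Proof.
move=> oU CF i j; apply: (@Ck_ext _ _ _ U _ (fun x => F x j i)) => //.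
by move=> x _; rewrite mxE.
Qed.

Lemma mCk_dmx p q k U (F : 'rV[R]_n -> 'M[R]_(p, q)) a :
  open U -> mCk k.+1 U F -> mCk k U (dmx a F).
Proof.
move=> oU CF i j.
apply: (@Ck_ext _ _ _ U _ (pderive a (fun x => F x i j))) => //.
  by move=> x _; rewrite dmxE.
exact: Ck_pderive.
Qed.

Lemma mCk_derivable p q k U (F : 'rV[R]_n -> 'M[R]_(p, q)) a x : mCk k.+1 U F -> U x ->
  forall i j, derivable (fun y => F y i j) x (delta_mx 0 a).
Proof. by move=> CF Ux i j; exact: Ck_derivable (CF i j) Ux. Qed.

Lemma dmx_ext p q U (F G : 'rV[R]_n -> 'M[R]_(p, q)) a x : open U -> U x ->
  (forall y, U y -> F y = G y) -> dmx a F x = dmx a G x.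
Proof.
move=> oU Ux FG; apply/matrixP => i j; rewrite !dmxE.
by apply: (pderive_ext _ oU Ux) => y Uy; rewrite FG.
Qed.

Lemma dmxD p q U (F G : 'rV[R]_n -> 'M[R]_(p, q)) a x : mCk 1 U F -> mCk 1 U G -> U x ->
  dmx a (fun y => F y + G y) x = dmx a F x + dmx a G x.
Proof.
move=> CF CG Ux; apply/matrixP => i j; rewrite mxE !dmxE.
have -> : (fun y => (F y + G y) i j) = (fun y => F y i j + G y i j).
  by apply/funext => y; rewrite mxE.
by rewrite pderiveD//; exact: mCk_derivable Ux _ _.
Qed.

Lemma dmxM p q r U (F : 'rV[R]_n -> 'M[R]_(p, q)) (G : 'rV[R]_n -> 'M[R]_(q, r)) a x :
  mCk 1 U F -> mCk 1 U G -> U x ->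
  dmx a (fun y => F y *m G y) x = dmx a F x *m G x + F x *m dmx a G x.
Proof.
move=> CF CG Ux; apply/matrixP => i j; rewrite mxE [X in _ + X]mxE [X in _ = X + _]mxE !dmxE.
have -> : (fun y => (F y *m G y) i j) = (fun y => \sum_l F y i l * G y l j).
  by apply/funext => y; rewrite mxE.
have dF := mCk_derivable (a := a) CF Ux; have dG := mCk_derivable (a := a) CG Ux.
rewrite (@pderive_sum _ _ _ _ _ (fun l y => F y i l * G y l j)); last first.
  by move=> l; exact: derivableM.
rewrite -big_split; apply: eq_bigr => l _ /=.
by rewrite pderiveM// !dmxE.
Qed.

Lemma dmx_tr p q (F : 'rV[R]_n -> 'M[R]_(p, q)) a x :
  dmx a (fun y => (F y)^T) x = (dmx a F x)^T.
Proof.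
by apply/matrixP => i j; rewrite mxE !dmxE; congr (pderive _ _ _); apply/funext => y; rewrite mxE.
Qed.

Lemma dmx_sumZ p q U (I : finType) (c : I -> 'rV[R]_n -> R)
    (F : I -> 'rV[R]_n -> 'M[R]_(p, q)) a x :
  (forall l, Ck 1 U (c l)) -> (forall l, mCk 1 U (F l)) -> U x ->
  dmx a (fun y => \sum_l c l y *: F l y) x =
  \sum_l (pderive a (c l) x *: F l x + c l x *: dmx a (F l) x).
Proof.
move=> Cc CF Ux; apply/matrixP => i j; rewrite dmxE summxE.
have -> : (fun y => (\sum_l c l y *: F l y) i j) = (fun y => \sum_l c l y * F l y i j).
  by apply/funext => y; rewrite summxE; apply: eq_bigr => l _; rewrite mxE.
have dc l : derivable (c l) x (delta_mx 0 a) by exact: Ck_derivable (Cc l) Ux.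
have dF l : derivable (fun y => F l y i j) x (delta_mx 0 a).
  exact: mCk_derivable (CF l) Ux _ _.
rewrite (@pderive_sum _ _ _ _ _ (fun l y => c l y * F l y i j)); last first.
  by move=> l; exact: derivableM.
by apply: eq_bigr => l _ /=; rewrite pderiveM// [RHS]mxE [X in _ = X + _]mxE
  [X in _ = _ + X]mxE dmxE.
Qed.

Lemma Ck_det m k U (F : 'rV[R]_n -> 'M[R]_m) : open U -> mCk k U F ->
  Ck k U (fun x => \det (F x)).
Proof.
move=> oU CF; rewrite /determinant.
apply: (@Ck_sum _ _ k U _ _ _ (fun (s : {perm 'I_m}) x => (-1) ^+ s * \prod_i F x i (s i))) => // s.
apply: Ck_mul => //; first exact: Ck_cst.
by apply: (@Ck_prod _ _ k U _ _ _ (fun i x => F x i (s i))).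
Qed.

Lemma mCk_invmx m U (F : 'rV[R]_n -> 'M[R]_m) : open U -> mCk 1 U F ->
  (forall x, U x -> F x \in unitmx) -> mCk 1 U (fun x => invmx (F x)).
Proof.
move=> oU CF uF i j.
apply: (@Ck_ext _ _ _ U _ (fun x => (\det (F x))^-1 * cofactor (F x) j i)) => //.
  by move=> x Ux; rewrite /invmx uF// !mxE.
apply: Ck_mul => //.
  apply: C1_inv => //; first exact: Ck_det.
  by move=> x Ux; rewrite -unitfE -unitmxE uF.
apply: Ck_mul => //; first exact: Ck_cst.
apply: Ck_det => // k l.
apply: (@Ck_ext _ _ _ U _ (fun x => F x (lift j k) (lift i l))) => //.
by move=> x _; rewrite !mxE.
Qed.

End matrix_calculus.

Section chain_matrix.
Context {R : realType} {n : nat}.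
Implicit Types (U V : set 'rV[R]_n).
Context (W V : set 'rV[R]_n) (T : 'I_n -> 'rV[R]_n -> R).
Hypotheses (oW : open W) (oV : open V).
Hypothesis CT : forall b, Ck 3 W (T b).
Let tau x : 'rV[R]_n := \row_b T b x.
Hypothesis TV : forall x, W x -> V (tau x).

Fact jac_def : {J : 'rV[R]_n -> 'M[R]_n | forall x a b, J x a b = pderive a (T b) x}.
Proof. by exists (fun x => \matrix_(a, b) pderive a (T b) x) => x a b; rewrite mxE. Qed.

(** Rows are indexed by the direction of differentiation, so that covariant 2-tensors transform by
    [J *m S *m J^T], as in [comp_change]. *)
Definition jac := sval jac_def.

Lemma jacE x a b : jac x a b = pderive a (T b) x.
Proof. exact: (svalP jac_def). Qed.

Lemma jac_C2 : mCk 2 W jac.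
Proof.
move=> a b; apply: (@Ck_ext _ _ _ W _ (pderive a (T b))) => //.
  by move=> x _; rewrite jacE.
exact: Ck_pderive.
Qed.

Let CT1 b : Ck 1 W (T b). Proof. exact/Ck_pred/Ck_pred. Qed.

Lemma mC1_comp p q (F : 'rV[R]_n -> 'M[R]_(p, q)) : mCk 1 V F -> mCk 1 W (fun x => F (tau x)).
Proof.
move=> CF i j.
exact: (@C1_comp _ _ _ W V (fun y => F y i j) T oW oV (CF i j) CT1 TV).
Qed.

Lemma dmx_comp p q (F : 'rV[R]_n -> 'M[R]_(p, q)) a x : mCk 1 V F -> W x ->
  dmx a (fun y => F (tau y)) x = \sum_b jac x a b *: dmx b F (tau x).
Proof.
move=> CF Wx; apply/matrixP => i j; rewrite dmxE summxE.
have dT b : derivable (T b) x (delta_mx 0 a) by exact: Ck_derivable (CT1 b) Wx.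
have := @pderive_chain _ _ _ V (fun y => F y i j) T x a oV (CF i j) (TV Wx) dT.
move=> ->; apply: eq_bigr => b _.
by rewrite [RHS]mxE dmxE jacE mulrC.
Qed.

Lemma dmx_jac_sym a b c x : W x -> dmx a jac x b c = dmx b jac x a c.
Proof.
move=> Wx; rewrite !dmxE.
have E d : pderive d (fun y => jac y a c) x = pderive d (pderive a (T c)) x.
  by apply: (pderive_ext _ oW Wx) => y _; rewrite jacE.
have E' d : pderive d (fun y => jac y b c) x = pderive d (pderive b (T c)) x.
  by apply: (pderive_ext _ oW Wx) => y _; rewrite jacE.
by rewrite E E'; apply: (schwarz _ _ oW _ Wx); exact: Ck_pred.
Qed.

Lemma dmx_dmx_jac a b x : W x -> dmx a (dmx b jac) x = dmx b (dmx a jac) x.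
Proof.
move=> Wx; apply/matrixP => i j; rewrite !dmxE.
have E d e : pderive d (fun y => dmx e jac y i j) x = pderive d (pderive e (fun y => jac y i j)) x.
  by apply: (pderive_ext _ oW Wx) => y _; rewrite dmxE.
by rewrite !E; apply: (schwarz _ _ oW _ Wx); exact: jac_C2.
Qed.

End chain_matrix.

(** * Connection matrices and curvature *)

Section levi_civita.
Context {R : realType} {n : nat}.
Implicit Types (U V : set 'rV[R]_n) (G H : 'rV[R]_n -> 'M[R]_n).

Fact conn_def : {C : ('rV[R]_n -> 'M[R]_n) -> 'I_n -> 'rV[R]_n -> 'M[R]_n |
  forall G a x b d, C G a x b d = christoffel G d a b x}.
Proof.
exists (fun G a x => \matrix_(b, d) christoffel G d a b x).
by move=> G a x b d; rewrite mxE.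
Qed.

(** The lower index is in the row and the upper one in the column: compatibility with the metric
    becomes the matrix equation of [conn_metric]. *)
Definition conn := sval conn_def.

Lemma connE G a x b d : conn G a x b d = christoffel G d a b x.
Proof. exact: (svalP conn_def). Qed.

Definition metric_on U G := mCk 2 U G /\ forall x, U x -> posdef (G x).

Lemma metric_unit U G x : metric_on U G -> U x -> G x \in unitmx.
Proof. by move=> [_ pG] Ux; exact: posdef_unit (pG x Ux). Qed.

Lemma dmx_sym U G a b c x : open U -> metric_on U G -> U x ->
  dmx a G x b c = dmx a G x c b.
Proof.
move=> oU [_ pG] Ux; rewrite !dmxE; apply: (pderive_ext _ oU Ux) => y Uy.
by have [<- _] := pG y Uy; rewrite mxE (pG y Uy).1.
Qed.

Lemma christoffelE G c a b x : christoffel G c a b x =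
  2^-1 * \sum_d invmx (G x) c d * (dmx a G x d b + dmx b G x d a - dmx d G x a b).
Proof. by congr (_ * _); apply: eq_bigr => d _; rewrite !dmxE. Qed.

(** The Koszul formula for a coordinate frame: multiplication by [G] cancels its inverse in the
    Christoffel symbols. *)
Lemma conn_lower U G a x b c : open U -> metric_on U G -> U x ->
  (conn G a x *m G x) b c =
  2^-1 * (dmx a G x c b + dmx b G x c a - dmx c G x a b).
Proof.
move=> oU mG Ux; have uG := metric_unit mG Ux.
have sG : (G x)^T = G x by have [_ /(_ x Ux)[]] := mG.
rewrite mxE.
under eq_bigr => d _ do rewrite connE christoffelE -mulrA mulr_suml.
rewrite -mulr_sumr exchange_big /=; congr (_ * _).
rewrite (bigD1 c)//= [X in _ + X]big1 ?addr0 => [|e ec].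
  under eq_bigr => d _ do rewrite mulrAC.
  rewrite -mulr_suml; have -> : \sum_d invmx (G x) d c * G x d c = 1; last by rewrite mul1r.
  have := mulmxV uG => /matrixP/(_ c c); rewrite mxE [X in _ = X]mxE eqxx => E.
  rewrite -[RHS]E.
  apply: eq_bigr => d _; rewrite mulrC; congr (_ * _).
  by rewrite -[in RHS]sG mxE.
under eq_bigr => d _ do rewrite mulrAC.
rewrite -mulr_suml; have -> : \sum_d invmx (G x) d e * G x d c = 0; last by rewrite mul0r.
have := mulmxV uG => /matrixP/(_ c e); rewrite mxE [X in _ = X]mxE eq_sym (negbTE ec) => E.
rewrite -[RHS]E.
apply: eq_bigr => d _; rewrite mulrC; congr (_ * _).
by rewrite -[in RHS]sG mxE.
Qed.

Lemma conn_metric U G a x : open U -> metric_on U G -> U x ->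
  dmx a G x = conn G a x *m G x + G x *m (conn G a x)^T.
Proof.
move=> oU mG Ux; have sG : (G x)^T = G x by have [_ /(_ x Ux)[]] := mG.
rewrite -[X in _ + X *m _]sG -trmx_mul; apply/matrixP => b c.
rewrite [RHS]mxE [X in _ + X]mxE !(conn_lower _ _ _ oU mG Ux).
rewrite (dmx_sym a c b oU mG Ux) (dmx_sym b c a oU mG Ux) (dmx_sym c b a oU mG Ux).
move: (dmx a G x b c) (dmx b G x a c) (dmx c G x a b) => p q r; lra.
Qed.

(** Torsion-freeness and compatibility with the metric determine the lowered symbols by a
    combination of three derivatives. The transformation law is obtained by checking these two
    properties, without transforming the Christoffel formula itself. *)
Lemma conn_unique U G x (B : 'I_n -> 'M[R]_n) : open U -> metric_on U G -> U x ->
  (forall a b d, B a b d = B b a d) ->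
  (forall a, dmx a G x = B a *m G x + G x *m (B a)^T) ->
  forall a, conn G a x = B a.
Proof.
move=> oU mG Ux symB metB a; have uG := metric_unit mG Ux.
have sG : (G x)^T = G x by have [_ /(_ x Ux)[]] := mG.
apply: (can_inj (mulmxK uG)); apply/matrixP => b c.
rewrite (conn_lower _ _ _ oU mG Ux).
have symL d e f : (B d *m G x) e f = (B e *m G x) d f.
  by rewrite !mxE; apply: eq_bigr => l _; rewrite symB.
have metL d e f : dmx d G x e f = (B d *m G x) e f + (B d *m G x) f e.
  by rewrite metB -[X in _ + X *m _]sG -trmx_mul mxE [X in _ + X]mxE.
rewrite !metL (symL b c a) (symL a c b) (symL b a c).
move: ((B c *m G x) a b) ((B a *m G x) b c) ((B c *m G x) b a) => p q r; lra.
Qed.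

Lemma conn_C1 U G a : open U -> metric_on U G -> mCk 1 U (conn G a).
Proof.
move=> oU mG b d; have [CG pG] := mG.
have CI := mCk_invmx oU (mCk_pred CG) (fun x Ux => metric_unit mG Ux).
have CD e f g : Ck 1 U (fun x => dmx e G x f g).
  by apply: mCk_dmx.
apply: (@Ck_ext _ _ _ U _ (fun x => 2^-1 * \sum_e invmx (G x) d e *
   (dmx a G x e b + dmx b G x e a + - dmx e G x a b))) => //.
  by move=> x _; rewrite connE christoffelE.
apply: Ck_mul => //; first exact: Ck_cst.
apply: (@Ck_sum _ _ 1 U _ _ _ (fun e x => invmx (G x) d e *
   (dmx a G x e b + dmx b G x e a + - dmx e G x a b))) => // e.
exact: (Ck_mul oU (CI d e)
  (Ck_add oU (Ck_add oU (CD a e b) (CD b e a)) (Ck_opp oU (CD e a b)))).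
Qed.

(** The curvature 2-form as a matrix. Its products are in reversed order because the upper index is
    in the column; Ric_bc is the sum over [a] of the entries in row [c] and column [a]. *)
Definition curv G a b x : 'M[R]_n :=
  dmx a (conn G b) x - dmx b (conn G a) x
  + (conn G b x *m conn G a x - conn G a x *m conn G b x).

Lemma scalar_localE G x :
  scalar_local G x = \sum_b \sum_a (invmx (G x) *m curv G a b x) b a.
Proof.
apply: eq_bigr => b _; rewrite /ricci.
under eq_bigr => c _ do rewrite mulr_sumr.
rewrite exchange_big /=; apply: eq_bigr => a _; rewrite mxE; apply: eq_bigr => c _.
congr (_ * _); rewrite /curv mxE [X in _ = X + _]mxE [X in _ = _ + X + _]mxE.
rewrite !dmxE [X in _ = _ + X]mxE [X in _ = _ + (_ + X)]mxE; congr (_ - _ + _).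
- by congr (pderive _ _ _); apply/funext => y; rewrite connE.
- by congr (pderive _ _ _); apply/funext => y; rewrite connE.
- rewrite mxE [X in _ = _ - X]mxE -sumrB; apply: eq_bigr => e _.
  by rewrite !connE; congr (_ - _); rewrite mulrC.
Qed.

Lemma nablaE G S c x : nabla G S c x =
  dmx c S x - (conn G c x *m S x + S x *m (conn G c x)^T).
Proof.
apply/matrixP => a b; rewrite mxE [RHS]mxE [X in _ = _ + X]mxE dmxE; congr (_ - _).
rewrite mxE [X in _ = X + _]mxE [X in _ = _ + X]mxE -big_split.
apply: eq_bigr => d _ /=; rewrite connE mxE connE.
by congr (_ + _); rewrite mulrC.
Qed.

End levi_civita.

(** * Matrix identities behind the transformation laws *)

Section congruence.
Context {R : realType} {n : nat}.
Implicit Types J D P h s A L : 'M[R]_n.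

(** Here [J] is the Jacobian matrix, [D] its derivative and [P] the pulled-back connection of [h];
    the left hand side is the derivative of [J *m h *m J^T] by the product rule. *)
Lemma congruence_conn J D P h : J \in unitmx ->
  D *m h *m J^T + J *m (P *m h + h *m P^T) *m J^T + J *m h *m D^T =
  (J *m P + D) *m invmx J *m (J *m h *m J^T)
  + J *m h *m J^T *m ((J *m P + D) *m invmx J)^T.
Proof.
move=> uJ.
have -> X : X *m invmx J *m (J *m h *m J^T) = X *m h *m J^T.
  by rewrite !mulmxA mulmxKV.
have -> X : J *m h *m J^T *m (X *m invmx J)^T = J *m h *m X^T.
  rewrite trmx_mul -!mulmxA [J^T *m (_ *m _)]mulmxA -trmx_mul mulVmx// trmx1.
  by rewrite mul1mx.
rewrite [(J *m P + D)^T]linearD /= trmx_mul !mulmxDl !mulmxDr !mulmxDl !mulmxA.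
move: (D *m h *m _) (J *m P *m _ *m _) (J *m h *m P^T *m _) (J *m h *m D^T).
by move=> a b c d; rewrite !addrA [a + b]addrC.
Qed.

Lemma congruence_nabla J D P s A L : A *m J = J *m P + D ->
  D *m s *m J^T + J *m L *m J^T + J *m s *m D^T
  - (A *m (J *m s *m J^T) + J *m s *m J^T *m A^T)
  = J *m (L - (P *m s + s *m P^T)) *m J^T.
Proof.
move=> AJ.
have -> : A *m (J *m s *m J^T) = (J *m P + D) *m s *m J^T by rewrite !mulmxA AJ.
have -> : J *m s *m J^T *m A^T = J *m s *m (J *m P + D)^T.
  by rewrite -mulmxA -trmx_mul AJ.
rewrite [(J *m P + D)^T]linearD /= trmx_mul mulmxBr mulmxBl !mulmxDl !mulmxDr !mulmxDl !mulmxA.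
move: (D *m s *m _) (J *m P *m _ *m _) (J *m s *m P^T *m _) (J *m s *m D^T) (J *m L *m _).
by move=> a b c d e; apply/matrixP => i j; rewrite !mxE; ring.
Qed.

Lemma invmx_congr J h : J \in unitmx -> h \in unitmx ->
  invmx (J *m h *m J^T) = invmx J^T *m invmx h *m invmx J.
Proof.
move=> uJ uh; have uJT : J^T \in unitmx by rewrite unitmx_tr.
have uM : J *m h *m J^T \in unitmx by rewrite !unitmx_mul uJ uh.
apply: (can_inj (mulKmx uM)).
by rewrite mulmxV// !mulmxA mulmxK// mulmxK// mulmxV.
Qed.

Lemma inner2_congr J h s t : J \in unitmx -> h \in unitmx ->
  inner2 (J *m h *m J^T) (J *m s *m J^T) (J *m t *m J^T) = inner2 h s t.
Proof.
move=> uJ uh; have uJT : J^T \in unitmx by rewrite unitmx_tr.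
rewrite /inner2 invmx_congr// !trmx_mul trmxK.
have -> : invmx J^T *m invmx h *m invmx J *m (J *m s *m J^T) *m
    (invmx J^T *m invmx h *m invmx J) *m (J *m (t^T *m J^T)) =
    invmx J^T *m (invmx h *m s *m invmx h *m t^T *m J^T).
  by rewrite !mulmxA mulmxKV// mulmxK// mulmxKV.
by rewrite mxtrace_mulC mulmxK.
Qed.

Lemma inner2_sum_congr J h (s t : 'I_n -> 'M[R]_n) c c' : J \in unitmx -> h \in unitmx ->
  inner2 (J *m h *m J^T) (J *m (\sum_d J c d *: s d) *m J^T)
    (J *m (\sum_d J c' d *: t d) *m J^T) =
  \sum_d \sum_d' J c d * J c' d' * inner2 h (s d) (t d').
Proof.
move=> uJ uh; rewrite inner2_congr// inner2_suml; apply: eq_bigr => d _.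
by rewrite inner2_sumr mulr_sumr; apply: eq_bigr => d' _; rewrite mulrA.
Qed.

Lemma inner3_congr J h (s t : 'I_n -> 'M[R]_n) : J \in unitmx -> h \in unitmx ->
  inner3 (J *m h *m J^T) (fun c => J *m (\sum_d J c d *: s d) *m J^T)
    (fun c => J *m (\sum_d J c d *: t d) *m J^T) = inner3 h s t.
Proof.
move=> uJ uh; have uJT : J^T \in unitmx by rewrite unitmx_tr.
rewrite /inner3.
under eq_bigr => c _ do under eq_bigr => c' _ do
  rewrite inner2_sum_congr// mulr_sumr.
under eq_bigr => c _ do rewrite exchange_big /=.
rewrite exchange_big /=; apply: eq_bigr => d _.
under eq_bigr => c _ do under eq_bigr => c' _ do rewrite mulr_sumr.
under eq_bigr => c _ do rewrite exchange_big /=.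
rewrite exchange_big /=; apply: eq_bigr => d' _.
have -> : invmx h d d' = \sum_c \sum_c' J c d * invmx (J *m h *m J^T) c c' * J c' d'.
  have -> : invmx h = J^T *m invmx (J *m h *m J^T) *m J.
    by rewrite invmx_congr// !mulmxA mulmxV// mul1mx mulmxKV.
  rewrite mxE exchange_big /=; apply: eq_bigr => c' _.
  rewrite mxE mulr_suml; apply: eq_bigr => c _; by rewrite [J^T _ _]mxE.
rewrite mulr_suml; apply: eq_bigr => c _; rewrite mulr_suml; apply: eq_bigr => c' _.
by ring.
Qed.

(** The hypotheses on [X] and [Y] are two derivatives of the transformation law of the connection.
    The second derivative [DD] of the Jacobian is the same in both and cancels, which makes the
    curvature a tensor. *)
Lemma congruence_curv J (Aa Ab Pa Pb Da Db X Y p q DD : 'M[R]_n) :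
  Aa *m J = J *m Pa + Da -> Ab *m J = J *m Pb + Db ->
  X *m J + Ab *m Da = Da *m Pb + J *m p + DD ->
  Y *m J + Aa *m Db = Db *m Pa + J *m q + DD ->
  (X - Y + (Ab *m Aa - Aa *m Ab)) *m J = J *m (p - q + (Pb *m Pa - Pa *m Pb)).
Proof.
move=> ea eb ex ey.
have {}ex : X *m J = Da *m Pb + J *m p + DD - Ab *m Da by rewrite -ex addrK.
have {}ey : Y *m J = Db *m Pa + J *m q + DD - Aa *m Db by rewrite -ey addrK.
have e1 : Ab *m Aa *m J = J *m Pb *m Pa + Db *m Pa + Ab *m Da.
  by rewrite -mulmxA ea mulmxDr mulmxA eb mulmxDl.
have e2 : Aa *m Ab *m J = J *m Pa *m Pb + Da *m Pb + Aa *m Db.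
  by rewrite -mulmxA eb mulmxDr mulmxA ea mulmxDl.
rewrite mulmxDl !mulmxBl ex ey e1 e2 mulmxDr !mulmxBr !mulmxA.
move: (Da *m Pb) (J *m p) (Ab *m Da) (Db *m Pa) (J *m q) (Aa *m Db).
move: (J *m Pb *m Pa) (J *m Pa *m Pb) => u1 u2 u3 u4 u5 u6 u7 u8.
by apply/matrixP => i j; rewrite !mxE; ring.
Qed.

Lemma scalar_congr J h (C : 'I_n -> 'I_n -> 'M[R]_n) (F : 'I_n -> 'I_n -> 'M[R]_n) :
  J \in unitmx -> h \in unitmx ->
  (forall a b, F a b *m J = J *m \sum_c \sum_d (J a c * J b d) *: C c d) ->
  \sum_b \sum_a (invmx (J *m h *m J^T) *m F a b) b a =
  \sum_b \sum_a (invmx h *m C a b) b a.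
Proof.
move=> uJ uh FC; have uJT : J^T \in unitmx by rewrite unitmx_tr.
have E a b : invmx (J *m h *m J^T) *m F a b =
    \sum_c \sum_d (J a c * J b d) *: (invmx J^T *m (invmx h *m C c d) *m invmx J).
  rewrite -[F a b](mulmxK uJ) FC invmx_congr// !mulmxA mulmxKV//.
  rewrite mulmx_sumr mulmx_suml; apply: eq_bigr => c _.
  rewrite mulmx_sumr mulmx_suml; apply: eq_bigr => d _.
  by rewrite -scalemxAr -scalemxAl !mulmxA.
under eq_bigr => b _ do under eq_bigr => a _ do rewrite E summxE.
under eq_bigr => b _ do rewrite exchange_big /=.
rewrite exchange_big /= [RHS]exchange_big /=; apply: eq_bigr => c _.
under eq_bigr => b _ do under eq_bigr => a _ do rewrite summxE.
under eq_bigr => b _ do rewrite exchange_big /=.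
rewrite exchange_big /=; apply: eq_bigr => d _.
set M := invmx h *m C c d.
have -> : M d c = (J^T *m (invmx J^T *m M *m invmx J) *m J) d c.
  by rewrite !mulmxA mulmxV// mul1mx mulmxKV.
rewrite mxE exchange_big /=; apply: eq_bigr => a _.
rewrite mxE mulr_suml; apply: eq_bigr => b _.
by rewrite mxE [J^T _ _]mxE; ring.
Qed.

End congruence.

(** * Transformation laws of connection and curvature *)

Section transformation.
Context {R : realType} {n : nat}.
Context (W V : set 'rV[R]_n) (T : 'I_n -> 'rV[R]_n -> R) (G H : 'rV[R]_n -> 'M[R]_n).
Hypotheses (oW : open W) (oV : open V).
Hypothesis CT : forall b, Ck 3 W (T b).
Let tau x : 'rV[R]_n := \row_b T b x.
Hypothesis TV : forall x, W x -> V (tau x).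
Hypotheses (mG : metric_on W G) (mH : metric_on V H).
Hypothesis GH : forall x, W x -> G x = jac T x *m H (tau x) *m (jac T x)^T.
Local Notation J := (jac T).

Lemma jac_unit x : W x -> J x \in unitmx.
Proof.
by move=> Wx; have := metric_unit mG Wx; rewrite GH// !unitmx_mul => /andP[/andP[]].
Qed.

Let CJ : mCk 2 W J := jac_C2 oW CT.
Let CH := mH.1.
Let dmxc p q F a x := @dmx_comp R n W V T oV CT TV p q F a x.
Let C1c p q F := @mC1_comp R n W V T oW oV CT TV p q F.

(** Only the direction of differentiation is transformed; rows and columns still refer to the target
    chart. *)
Definition pull_conn (a : 'I_n) x : 'M[R]_n := \sum_b J x a b *: conn H b (tau x).

Lemma dmx_congr (S : 'rV[R]_n -> 'M[R]_n) a x : mCk 1 V S -> W x ->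
  dmx a (fun y => J y *m S (tau y) *m (J y)^T) x =
  dmx a J x *m S (tau x) *m (J x)^T
  + J x *m (\sum_b J x a b *: dmx b S (tau x)) *m (J x)^T
  + J x *m S (tau x) *m (dmx a J x)^T.
Proof.
move=> CS Wx; have CSc := C1c CS.
have CJ1 := mCk_pred CJ.
rewrite (@dmxM _ _ _ _ _ W)//; [|exact: mCk_mul|exact: mCk_tr].
by rewrite (dmxM _ CJ1 CSc Wx) dmx_tr (dmxc _ CS Wx) mulmxDl.
Qed.

(** Multiplied by the inverse Jacobian, the right hand side is torsion-free by the symmetry of the
    Christoffel symbols of [H] and of the second derivatives of [T], and compatible with [G] by
    [congruence_conn]; [conn_unique] then identifies it. *)
Lemma conn_change a x : W x -> conn G a x *m J x = J x *m pull_conn a x + dmx a J x.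
Proof.
move=> Wx; have uJ := jac_unit Wx.
have key : forall a, conn G a x = (J x *m pull_conn a x + dmx a J x) *m invmx (J x).
  apply: (@conn_unique _ _ W G) => //.
    move=> b c d; rewrite !mxE; apply: eq_bigr => e _; congr (_ * _).
    rewrite !mxE (dmx_jac_sym oW CT _ _ _ Wx); congr (_ + _).
    under eq_bigr => k _ do rewrite summxE mulr_sumr.
    under [RHS]eq_bigr => k _ do rewrite summxE mulr_sumr.
    rewrite exchange_big /=; apply: eq_bigr => l _; apply: eq_bigr => k _.
    rewrite mxE [in RHS]mxE mulrCA; congr (_ * (_ * _)).
    by rewrite !connE !christoffelE; congr (_ * _); apply: eq_bigr => m _;
      rewrite (dmx_sym m k l oV mH (TV Wx)) [X in _ * (X - _)]addrC.
  move=> b.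
  rewrite (@dmx_ext _ _ _ _ W _ (fun y => J y *m H (tau y) *m (J y)^T) b x oW Wx GH).
  rewrite (dmx_congr b (mCk_pred CH) Wx) (GH Wx).
  have -> : \sum_c J x b c *: dmx c H (tau x) =
      pull_conn b x *m H (tau x) + H (tau x) *m (pull_conn b x)^T.
    rewrite /pull_conn raddf_sum /= mulmx_suml mulmx_sumr -big_split.
    apply: eq_bigr => c _ /=; rewrite (conn_metric c oV mH (TV Wx)) scalerDr.
    by rewrite linearZ /= -scalemxAl -scalemxAr.
  exact: congruence_conn.
by rewrite key mulmxKV.
Qed.

Lemma nabla_change (S : 'rV[R]_n -> 'M[R]_n) c x : mCk 1 V S -> W x ->
  nabla G (fun y => J y *m S (tau y) *m (J y)^T) c x =
  J x *m (\sum_d J x c d *: nabla H S d (tau x)) *m (J x)^T.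
Proof.
move=> CS Wx; rewrite nablaE (dmx_congr c CS Wx).
rewrite (congruence_nabla _ _ (conn_change c Wx)); congr (_ *m _ *m _).
rewrite /pull_conn raddf_sum /= mulmx_suml mulmx_sumr -big_split -sumrB.
apply: eq_bigr => d _ /=; rewrite nablaE scalerBr scalerDr.
by rewrite linearZ /= -scalemxAl -scalemxAr.
Qed.

Lemma dmx_pull_conn a b x : W x -> dmx b (pull_conn a) x =
  \sum_c (dmx b J x a c *: conn H c (tau x)
          + J x a c *: \sum_d J x b d *: dmx d (conn H c) (tau x)).
Proof.
move=> Wx.
have Cc c : mCk 1 V (conn H c) := conn_C1 c oV mH.
have CJ1 := mCk_pred CJ.
rewrite (@dmx_sumZ _ _ _ _ W _ (fun c y => J y a c) (fun c y => conn H c (tau y)))//.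
  by apply: eq_bigr => c _; rewrite -dmxE (dmxc _ (Cc c) Wx).
by move=> c; apply: C1c.
Qed.

Lemma pull_conn_C1 a : mCk 1 W (pull_conn a).
Proof.
move=> i j; have CJ1 := mCk_pred CJ.
apply: (@Ck_ext _ _ _ W _ (fun x => \sum_b J x a b * conn H b (tau x) i j)) => //.
  by move=> x _; rewrite summxE; apply: eq_bigr => b _; rewrite mxE.
apply: (@Ck_sum _ _ 1 W _ _ _ (fun b x => J x a b * conn H b (tau x) i j)) => // b.
exact: (Ck_mul oW (CJ1 a b) (C1c (conn_C1 b oV mH) i j)).
Qed.

Lemma dmx_conn_change a b x : W x ->
  dmx b (conn G a) x *m J x + conn G a x *m dmx b J x =
  dmx b J x *m pull_conn a x + J x *m dmx b (pull_conn a) x + dmx b (dmx a J) x.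
Proof.
move=> Wx; have CJ1 := mCk_pred CJ.
rewrite -(dmxM b (conn_C1 a oW mG) CJ1 Wx).
rewrite (@dmx_ext _ _ _ _ W _ (fun y => J y *m pull_conn a y + dmx a J y) b x oW Wx
  (fun y Wy => conn_change a Wy)).
have CdJ : mCk 1 W (dmx a J) by apply: mCk_dmx.
rewrite (dmxD b (mCk_mul oW CJ1 (pull_conn_C1 a)) CdJ Wx).
by rewrite (dmxM b CJ1 (pull_conn_C1 a) Wx).
Qed.

(** Antisymmetrising the derivative of [conn_change] in [a] and [b] cancels the second derivatives
    of the Jacobian; its first derivatives cancel in the derivatives of [pull_conn] because they are
    symmetric. *)
Lemma curv_change a b x : W x -> curv G a b x *m J x =
  J x *m \sum_c \sum_d (J x a c * J x b d) *: curv H c d (tau x).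
Proof.
move=> Wx; rewrite /curv.
have E := dmx_conn_change a b Wx.
rewrite (dmx_dmx_jac oW CT b a Wx) in E.
rewrite (congruence_curv (conn_change a Wx) (conn_change b Wx)
  (dmx_conn_change b a Wx) E).
congr (_ *m _); rewrite !dmx_pull_conn// !big_split /=.
have -> : \sum_c dmx a J x b c *: conn H c (tau x) = \sum_c dmx b J x a c *: conn H c (tau x).
  by apply: eq_bigr => c _; rewrite (dmx_jac_sym oW CT _ _ _ Wx).
have cancel_l (s u v : 'M[R]_n) : s + u - (s + v) = u - v.
  by rewrite opprD addrACA subrr add0r.
rewrite cancel_l.
under eq_bigr => c _ do rewrite scaler_sumr.
rewrite exchange_big /=.
have prod u v : pull_conn u x *m pull_conn v x =
    \sum_c \sum_d (J x u c * J x v d) *: (conn H c (tau x) *m conn H d (tau x)).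
  rewrite mulmx_suml; apply: eq_bigr => c _; rewrite mulmx_sumr.
  by apply: eq_bigr => d _; rewrite -scalemxAl -scalemxAr scalerA.
rewrite !prod [X in _ + (X - _)]exchange_big /= -!sumrB -big_split.
apply: eq_bigr => c _ /=.
rewrite scaler_sumr -!sumrB -big_split; apply: eq_bigr => d _ /=.
by rewrite !scalerA [J x b d * _]mulrC -!scalerBr -scalerDr.
Qed.

Lemma scalar_local_change x : W x -> scalar_local G x = scalar_local H (tau x).
Proof.
move=> Wx; rewrite !scalar_localE (GH Wx).
apply: scalar_congr; [exact: jac_unit|exact: metric_unit mH (TV Wx)|].
by move=> a b; exact: curv_change.
Qed.

End transformation.

(** * Integration by parts for the scalar curvature *)

(** Arithmetic of [approxM]: [X], [Y] are the errors of the factors, [P], [Q] the sizes of the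
    limits, [a], [b] powers of [1 + w]. As [a] and [b] are at least 1, each of [a - 1], [b - 1] and
    their product is at most [a * b - 1]. *)
Lemma approx_mul_bound (R : realType) (delta s C C' D D' a b X Y P Q : R) :
  0 < s -> s <= 1 -> s * (3 * (C + C')) <= delta -> 1 <= C -> 1 <= C' ->
  0 <= D -> 0 <= D' -> 1 <= a -> 1 <= b ->
  0 <= X -> 0 <= Y -> 0 <= P -> 0 <= Q ->
  X <= s + D * (a - 1) -> Y <= s + D' * (b - 1) -> P <= C -> Q <= C' ->
  X * Q + X * Y + P * Y <=
    delta + (D * (C' + 1 + D') + (C + 1) * D') * (a * b - 1).
Proof.
move=> s0 s1 s2 C1 C'1 D0 D'0 a1 b1 X0 Y0 P0 Q0 xD yD pC qC.
have g1 : X * Q <= (s + D * (a - 1)) * C' by rewrite ler_pM.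
have g2 : X * Y <= (s + D * (a - 1)) * (s + D' * (b - 1)) by rewrite ler_pM.
have g3 : P * Y <= C * (s + D' * (b - 1)) by rewrite ler_pM.
apply: le_trans (lerD (lerD g1 g2) g3) _; clear X Y P Q X0 Y0 P0 Q0 xD yD pC qC g1 g2 g3.
have a0 : 0 <= a - 1 by lra. have b0 : 0 <= b - 1 by lra.
have ab0 : 0 <= (a - 1) * (b - 1) by exact: mulr_ge0.
have abE : a * b - 1 = (a - 1) * (b - 1) + (a - 1) + (b - 1) by ring.
have ab1 : a - 1 <= a * b - 1 by rewrite abE; lra.
have ab2 : b - 1 <= a * b - 1 by rewrite abE; lra.
have ab3 : (a - 1) * (b - 1) <= a * b - 1 by rewrite abE; lra.
have t1 : s * C' + s * s + C * s <= delta.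
  apply: le_trans s2; have : s * s <= s by rewrite ler_piMl// ltW.
  have := ler_wpM2l (ltW s0) C1; have := ler_wpM2l (ltW s0) C'1.
  rewrite mulr1 (_ : s * (3 * (C + C')) = 3 * (s * C) + 3 * (s * C')); last by ring.
  rewrite [C * s]mulrC; move: (s * s) (s * C) (s * C') => x y z; clear -s0; lra.
have sC1 : C' + s <= C' + 1 by rewrite lerD2l.
have sC2 : C + s <= C + 1 by rewrite lerD2l.
have sC3 : 0 <= C' + s by rewrite addr_ge0 ?(ltW s0)// (le_trans ler01).
have sC4 : 0 <= C + s by rewrite addr_ge0 ?(ltW s0)// (le_trans ler01).
have t2 : D * (a - 1) * (C' + s) <= D * (a * b - 1) * (C' + 1).
  by apply: ler_pM => //; [exact: mulr_ge0|rewrite ler_wpM2l].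
have t3 : D' * (b - 1) * (C + s) <= D' * (a * b - 1) * (C + 1).
  by apply: ler_pM => //; [exact: mulr_ge0|rewrite ler_wpM2l].
have t4 : D * D' * ((a - 1) * (b - 1)) <= D * D' * (a * b - 1).
  by rewrite ler_wpM2l// mulr_ge0.
rewrite [X in X <= _](_ : _ = (s * C' + s * s + C * s) + D * (a - 1) * (C' + s)
  + D' * (b - 1) * (C + s) + D * D' * ((a - 1) * (b - 1))); last by ring.
apply: le_trans (lerD (lerD (lerD t1 t2) t3) t4) _.
by rewrite le_eqVlt; apply/orP; left; apply/eqP; ring.
Qed.

(** * Calculus of approximations by degree *)

Section approximation.
Context {R : realType} (I : Type) (near_ : R -> I -> Prop) (w : I -> R).
Hypothesis near_le : forall e e' i, e <= e' -> near_ e i -> near_ e' i.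
Hypothesis w_ge0 : forall i, 0 <= w i.

(* [u] is close to the bounded [v] up to a small error plus a polynomial of
   degree [d] in [w] without constant term, once [near_ e] holds with [e] small. *)
Definition approx_deg (d : nat) (u v : I -> R) :=
  (exists C, forall i, near_ 1 i -> `|v i| <= C) /\
  (forall delta, 0 < delta -> exists e C, 0 < e <= 1 /\ 0 <= C /\
     forall i, near_ e i -> `|u i - v i| <= delta + C * ((1 + w i) ^+ d - 1)).

Let pow_ge1 d i : 1 <= (1 + w i) ^+ d.
Proof. by rewrite exprn_ege1// lerDl. Qed.

Lemma approx_ext d u v u' v' : (forall i, near_ 1 i -> u i = u' i) ->
  (forall i, near_ 1 i -> v i = v' i) -> approx_deg d u v -> approx_deg d u' v'.
Proof.
move=> uu vv [[C HC] H]; split.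
  by exists C => i ni; rewrite -vv//; exact: HC.
move=> delta d0; have [e [C' [/andP[e0 e1] [C0 HC']]]] := H _ d0.
exists e, C'; rewrite e0 e1; do 2 split=> //; move=> i ni.
have n1 : near_ 1 i by exact: near_le ni.
by rewrite -uu// -vv//; exact: HC'.
Qed.

Lemma approx_refl u C : (forall i, near_ 1 i -> `|u i| <= C) -> approx_deg 0 u u.
Proof.
move=> uC; split; first by exists C.
move=> delta d0; exists 1, 0; rewrite ltr01 lexx; do 2 split=> //; move=> i _.
by rewrite subrr normr0 mul0r addr0 ltW.
Qed.

Lemma approx_le d d' u v : (d <= d')%N -> approx_deg d u v -> approx_deg d' u v.
Proof.
move=> dd [B H]; split=> // delta d0; have [e [C [e0 [C0 HC]]]] := H _ d0.
exists e, C; do 2 split=> //; move=> i ni; apply: le_trans (HC i ni) _.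
by rewrite lerD2l ler_wpM2l// lerD2r ler_weXn2l// lerDl.
Qed.

Lemma approxD d u v u' v' : approx_deg d u v -> approx_deg d u' v' ->
  approx_deg d (fun i => u i + u' i) (fun i => v i + v' i).
Proof.
move=> [[C HC] H] [[C' HC'] H']; split.
  exists (C + C') => i ni; rewrite (le_trans (ler_normD _ _))// lerD//; [exact: HC|exact: HC'].
move=> delta d0; have d20 : 0 < delta / 2 by rewrite divr_gt0.
have [e [D [/andP[e0 e1] [D0 HD]]]] := H _ d20.
have [e' [D' [/andP[e'0 e'1] [D'0 HD']]]] := H' _ d20.
exists (Num.min e e'), (D + D'); rewrite lt_min e0 e'0 ge_min e1; split=> //.
split=> [|i ni]; first exact: addr_ge0.
have n1 : near_ e i by apply: near_le ni; rewrite ge_min lexx.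
have n2 : near_ e' i by apply: near_le ni; rewrite ge_min lexx orbT.
rewrite (_ : _ - _ = (u i - v i) + (u' i - v' i)); last by ring.
rewrite (le_trans (ler_normD _ _))// (le_trans (lerD (HD i n1) (HD' i n2)))//.
rewrite mulrDl; move: (D * _) (D' * _) => p q; lra.
Qed.

(** The error is expanded around [v] and [v'], since [u] and [u'] need not be bounded when [w] is
    large. With errors of the shape [(1 + w i) ^+ d - 1], degrees add. *)
Lemma approxM d d' u v u' v' : approx_deg d u v -> approx_deg d' u' v' ->
  approx_deg (d + d') (fun i => u i * u' i) (fun i => v i * v' i).
Proof.
move=> [[C0 HC0] H] [[C0' HC0'] H'].
pose C := `|C0| + 1; pose C' := `|C0'| + 1.
have C1 : 1 <= C by rewrite lerDr. have C'1 : 1 <= C' by rewrite lerDr.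
have HC i : near_ 1 i -> `|v i| <= C.
  by move=> /HC0/le_trans; apply; rewrite /C (le_trans (ler_norm _))// lerDl.
have HC' i : near_ 1 i -> `|v' i| <= C'.
  by move=> /HC0'/le_trans; apply; rewrite /C' (le_trans (ler_norm _))// lerDl.
split.
  exists (C * C') => i ni; rewrite normrM ler_pM//; [exact: HC|exact: HC'].
move=> delta d0.
pose s := Num.min 1 (delta / (3 * (C + C'))).
have CC : 0 < 3 * (C + C') by lra.
have s0 : 0 < s by rewrite lt_min ltr01 divr_gt0.
have s1 : s <= 1 by rewrite ge_min lexx.
have s2 : s * (3 * (C + C')) <= delta.
  by rewrite -ler_pdivlMr// ge_min lexx orbT.
have [e [D [/andP[e0 e1] [D0 HD]]]] := H _ s0.
have [e' [D' [/andP[e'0 e'1] [D'0 HD']]]] := H' _ s0.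
exists (Num.min e e'), (D * (C' + 1 + D') + (C + 1) * D').
rewrite lt_min e0 e'0 ge_min e1; split=> //.
have K0 : 0 <= D * (C' + 1 + D') by rewrite mulr_ge0//; lra.
have K1 : 0 <= (C + 1) * D' by rewrite mulr_ge0//; lra.
split=> [|i ni]; first exact: addr_ge0.
have n1 : near_ e i by apply: near_le ni; rewrite ge_min lexx.
have n2 : near_ e' i by apply: near_le ni; rewrite ge_min lexx orbT.
have n3 : near_ 1 i by apply: near_le n1.
rewrite (_ : _ - _ = (u i - v i) * v' i + (u i - v i) * (u' i - v' i) + v i * (u' i - v' i)); last by ring.
have := HD i n1; have := HD' i n2; have := HC i n3; have := HC' i n3.
rewrite exprD.
have := pow_ge1 d i; have := pow_ge1 d' i.
move: (u i - v i) (u' i - v' i) => x y; move: (v i) (v' i) => p q.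
move: ((1 + w i) ^+ d) ((1 + w i) ^+ d') => a b b1 a1 qC pC yD xD.
rewrite (le_trans (ler_normD _ _))// (le_trans (lerD (ler_normD _ _) (lexx _)))//.
rewrite !normrM.
exact: (approx_mul_bound s0 s1 s2).
Qed.

Lemma approxN d u v : approx_deg d u v -> approx_deg d (fun i => - u i) (fun i => - v i).
Proof.
move=> H; have A1 : approx_deg 0 (fun=> -1) (fun=> -1).
  by apply: (@approx_refl _ 1) => i _; rewrite normrN1.
apply: (approx_ext _ _ (approxM A1 H)) => i _; by rewrite mulN1r.
Qed.

Lemma approx_sum d (J : Type) (r : seq J) (P : pred J) (u v : J -> I -> R) :
  (forall j, approx_deg d (u j) (v j)) ->
  approx_deg d (fun i => \sum_(j <- r | P j) u j i) (fun i => \sum_(j <- r | P j) v j i).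
Proof.
move=> H; elim: r => [|j r IH].
  apply: (@approx_ext d (fun=> 0) (fun=> 0)); try by move=> i _; rewrite big_nil.
  by apply: (@approx_le 0) => //; apply: (@approx_refl _ 0) => i _; rewrite normr0.
case Pj : (P j).
  apply: (approx_ext _ _ (approxD (H j) IH)) => i _; by rewrite big_cons Pj.
by apply: (approx_ext _ _ IH) => i _; rewrite big_cons Pj.
Qed.

(** Degree 0 makes [u] uniformly close to [v], hence at least [c / 2]; an error growing with [w]
    would allow [u] to come near 0. *)
Lemma approx_inv u v c : 0 < c -> (forall i, near_ 1 i -> c <= v i) ->
  approx_deg 0 u v -> approx_deg 0 (fun i => (u i)^-1) (fun i => (v i)^-1).
Proof.
move=> c0 cv [_ H]; split.
  exists c^-1 => i ni; have v0 : 0 < v i by exact: lt_le_trans (cv i ni).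
  by rewrite ger0_norm ?invr_ge0 ?(ltW v0)// lef_pV2// ?posrE//; exact: cv.
move=> delta d0; pose s := Num.min (c / 2) (delta * (c * c / 2)).
have c20 : 0 < c / 2 by rewrite divr_gt0.
have s0 : 0 < s by rewrite lt_min c20 mulr_gt0// divr_gt0// mulr_gt0.
have [e [D [/andP[e0 e1] [D0 HD]]]] := H _ s0.
exists e, 0; rewrite e0 e1; do 2 split=> //; move=> i ni; rewrite mul0r addr0.
have n1 : near_ 1 i by exact: near_le ni.
have := HD i ni; rewrite expr0 subrr mulr0 addr0; have := cv i n1.
move: (u i) (v i) => x y cy xy.
have y0 : 0 < y by exact: lt_le_trans cy.
have xc : c / 2 <= x.
  have : `|x - y| <= c / 2 by rewrite (le_trans xy)// ge_min lexx.
  by rewrite ler_norml => /andP[]; lra.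
have x0 : 0 < x by exact: lt_le_trans xc.
rewrite (_ : x^-1 - y^-1 = (y - x) / (x * y)); last first.
  by field; rewrite !gt_eqF.
rewrite normrM normfV (gtr0_norm (mulr_gt0 x0 y0)) ler_pdivrMr ?mulr_gt0// distrC.
apply: le_trans xy _; rewrite ge_min; apply/orP; right.
by rewrite ler_wpM2l ?(ltW d0)// mulrAC; apply: ler_pM => //; exact: ltW.
Qed.

(** The difference of the square roots is that of [u] and [v] divided by the sum of the roots, which
    is at least the root of [c]. *)
Lemma approx_sqrt u v c : 0 < c -> (forall i, near_ 1 i -> c <= v i) ->
  (forall i, near_ 1 i -> 0 <= u i) ->
  approx_deg 0 u v -> approx_deg 0 (fun i => Num.sqrt (u i)) (fun i => Num.sqrt (v i)).
Proof.
move=> c0 cv u0 [[C HC] H]; split.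
  exists (1 + C) => i ni; rewrite ger0_norm ?sqrtr_ge0//.
  have v0 : 0 <= v i by rewrite (le_trans (ltW c0))// cv.
  have := HC i ni; rewrite ger0_norm// => vC.
  have := sqr_sqrtr v0; move: (Num.sqrt (v i)) => t tE.
  have : 0 <= (t - 1) ^+ 2 by exact: sqr_ge0.
  by rewrite sqrrB tE; lra.
move=> delta d0; pose s := delta * Num.sqrt c.
have sc0 : 0 < Num.sqrt c by rewrite sqrtr_gt0.
have s0 : 0 < s by rewrite mulr_gt0.
have [e [D [/andP[e0 e1] [D0 HD]]]] := H _ s0.
exists e, 0; rewrite e0 e1; do 2 split=> //; move=> i ni; rewrite mul0r addr0.
have n1 : near_ 1 i by exact: near_le ni.
have := HD i ni; rewrite expr0 subrr mulr0 addr0 => uv.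
have v0 : 0 <= v i by rewrite (le_trans (ltW c0))// cv.
have sv : Num.sqrt c <= Num.sqrt (v i) by rewrite ler_wsqrtr// cv.
have tt : 0 <= Num.sqrt (u i) by exact: sqrtr_ge0.
have E : u i - v i = (Num.sqrt (u i) - Num.sqrt (v i)) * (Num.sqrt (u i) + Num.sqrt (v i)).
  by rewrite -subr_sqr !sqr_sqrtr// u0.
move: uv; rewrite E normrM /s => uv.
rewrite -(ler_pM2r sc0); apply: le_trans uv; apply: ler_wpM2l => //.
by rewrite ger0_norm; lra.
Qed.

End approximation.

(** * The weak form of the scalar curvature *)

Section weak_form.
Context {R : realType} {n : nat}.
Local Notation lam := (@lebesgue_rV R n).
Implicit Types (U : set 'rV[R]_n) (G : 'rV[R]_n -> 'M[R]_n).

Lemma open_compl_compact (K : set 'rV[R]_n) : compact K -> open (~` K).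
Proof. by move=> cK; apply: closed_openC; apply: compact_closed => //; exact: norm_hausdorff. Qed.

(** [U] and the complement of [K] are open and cover the space; [f] is C^k on the first and zero on
    the second. *)
Lemma Ck_extend0 k U (K : set 'rV[R]_n) f : open U -> compact K -> K `<=` U ->
  Ck k U f -> (forall x, ~ K x -> f x = 0) -> Ck k setT f.
Proof.
move=> oU cK KU Cf f0; apply: Ck_near => x _.
have [Ux|nUx] := pselect (U x); first by exists U; split=> //; exists f.
exists (~` K); split; [exact: open_compl_compact|by move=> /KU|].
by exists (fun=> 0); [exact: Ck_cst|move=> y nKy; rewrite f0].
Qed.

Lemma pderive_outside (K : set 'rV[R]_n) f a x : compact K ->
  (forall x, ~ K x -> f x = 0) -> ~ K x -> pderive a f x = 0.
Proof.
move=> cK f0 nKx.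
by rewrite (pderive_ext a (open_compl_compact cK) nKx f0) pderive_cst.
Qed.

Lemma C0_compact_integrable (K : set 'rV[R]_n) f : compact K -> Ck 0 setT f ->
  (forall x, ~ K x -> f x = 0) -> lam.-integrable setT (EFin \o f).
Proof.
move=> cK Cf f0.
have cf : continuous f by move=> x; exact: Ck_continuous Cf I.
have mK : measurable (K : set (borel 'rV[R]_n)).
  by rewrite -[K]setCK; apply: measurableC; apply: open_borel_measurable; exact: open_compl_compact.
have [M M0 MP] := compact_bound cK (continuous_subspaceT cf).
apply: (bounded_support_integrable (M := M) mK (lebesgue_rV_compact_lty cK)) => //.
  exact: continuous_borel_measurable_real.
by move=> x; have [/MP//|nK] := pselect (K x); rewrite f0// normr0.
Qed.

Definition density G (phi : 'rV[R]_n -> R) x : 'M[R]_n :=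
  (phi x * Num.sqrt (\det (G x))) *: invmx (G x).

(** The Gamma-Gamma form of the scalar curvature. Derivatives of the density are affine in the first
    derivatives of [G], the derivative of [phi] giving the part of order zero, so the whole is at
    most quadratic in them. *)
Definition weak_scalar G phi x : R :=
  \sum_b \sum_a (density G phi x *m (conn G b x *m conn G a x - conn G a x *m conn G b x)
    - (dmx a (density G phi) x *m conn G b x - dmx b (density G phi) x *m conn G a x)) b a.

(** With N the density, this is the classical vector density N^bc Gamma^a_bc - N^ac Gamma^b_bc,
    whose divergence contains all second derivatives of the metric in the weighted curvature. *)
Definition scalar_flux G phi a x : R :=
  \sum_b ((density G phi x *m conn G b x) b a - (density G phi x *m conn G b x) a b).

Context (U : set 'rV[R]_n) (G : 'rV[R]_n -> 'M[R]_n) (phi : 'rV[R]_n -> R) (K : set 'rV[R]_n).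
Hypotheses (oU : open U) (mG : metric_on U G) (Cphi : Ck 1 setT phi)
  (cK : compact K) (KU : K `<=` U) (phi0 : forall x, ~ K x -> phi x = 0).

Lemma sqrt_det_C1 : Ck 1 U (fun x => Num.sqrt (\det (G x))).
Proof.
have [CG pG] := mG.
by apply: (C1_sqrt oU (Ck_det oU (mCk_pred CG)) _).1 => x Ux; exact: posdef_det (pG x Ux).
Qed.

Lemma density_C1 : mCk 1 U (density G phi).
Proof.
move=> i j; have [CG pG] := mG.
have CI := mCk_invmx oU (mCk_pred CG) (fun x Ux => metric_unit mG Ux).
have CU : Ck 1 U phi by exact: Ck_sub Cphi.
apply: (Ck_ext oU _ (Ck_mul oU (Ck_mul oU CU sqrt_det_C1) (CI i j))) => x _.
by rewrite mxE.
Qed.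

Lemma density_out x : ~ K x -> density G phi x = 0.
Proof. by move=> nK; rewrite /density phi0// mul0r scale0r. Qed.

Lemma dmx_density_out a x : ~ K x -> dmx a (density G phi) x = 0.
Proof.
move=> nK; apply/matrixP => i j; rewrite dmxE mxE.
by apply: (pderive_outside a cK) => // y nKy; rewrite density_out// mxE.
Qed.

Lemma scalar_flux_C1 a : Ck 1 U (scalar_flux G phi a).
Proof.
apply: (@Ck_sum _ _ 1 U _ _ _ (fun b x => (density G phi x *m conn G b x) b a
  - (density G phi x *m conn G b x) a b)) => // b.
have C := mCk_mul oU density_C1 (conn_C1 b oU mG).
exact: (Ck_add oU (C b a) (Ck_opp oU (C a b))).
Qed.

Lemma scalar_flux_out a x : ~ K x -> scalar_flux G phi a x = 0.
Proof.
by move=> nK; apply: big1 => b _; rewrite density_out// mul0mx !mxE subrr.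
Qed.

Lemma weak_scalar_C0 : Ck 0 setT (weak_scalar G phi).
Proof.
have Cc b : mCk 0 U (conn G b) := mCk_pred (conn_C1 b oU mG).
have Cd : mCk 0 U (density G phi) := mCk_pred density_C1.
have Cdd a : mCk 0 U (dmx a (density G phi)) := mCk_dmx a oU density_C1.
have mCk_opp (F : 'rV[R]_n -> 'M[R]_n) : mCk 0 U F -> mCk 0 U (fun x => - F x).
  move=> CF i j; apply: (Ck_ext oU _ (Ck_opp oU (CF i j))) => x _; by rewrite mxE.
apply: (@Ck_extend0 0 U K) => //.
  apply: (@Ck_sum _ _ 0 U _ _ _ (fun b x => \sum_a (density G phi x *m (conn G b x *m conn G a x - conn G a x *m conn G b x)
    - (dmx a (density G phi) x *m conn G b x - dmx b (density G phi) x *m conn G a x)) b a)) => // b.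
  apply: (@Ck_sum _ _ 0 U _ _ _ (fun a x => (density G phi x *m (conn G b x *m conn G a x - conn G a x *m conn G b x)
    - (dmx a (density G phi) x *m conn G b x - dmx b (density G phi) x *m conn G a x)) b a)) => // a.
  have C1 := mCk_mul oU Cd (mCk_add oU (mCk_mul oU (Cc b) (Cc a))
    (mCk_opp _ (mCk_mul oU (Cc a) (Cc b)))).
  have C2 := mCk_add oU (mCk_mul oU (Cdd a) (Cc b)) (mCk_opp _ (mCk_mul oU (Cdd b) (Cc a))).
  exact: (mCk_add oU C1 (mCk_opp _ C2) b a).
move=> x nK; apply: big1 => b _; apply: big1 => a _.
by rewrite density_out// !dmx_density_out// !mul0mx subr0 subr0 mxE.
Qed.

Lemma weak_scalar_out x : ~ K x -> weak_scalar G phi x = 0.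
Proof.
move=> nK; apply: big1 => b _; apply: big1 => a _.
by rewrite density_out// !dmx_density_out// !mul0mx subr0 subr0 mxE.
Qed.

Lemma scalar_flux_pderive a x : U x -> pderive a (scalar_flux G phi a) x =
  \sum_b (dmx a (fun y => density G phi y *m conn G b y) x b a
          - dmx a (fun y => density G phi y *m conn G b y) x a b).
Proof.
move=> Ux.
have C b := mCk_mul oU density_C1 (conn_C1 b oU mG).
have D b := mCk_derivable (a := a) (C b) Ux.
rewrite (@pderive_sum _ _ _ _ _ (fun b x => (density G phi x *m conn G b x) b a
  - (density G phi x *m conn G b x) a b)); last first.
  by move=> b; apply: derivableB; exact: D.
apply: eq_bigr => b _; rewrite !dmxE.
rewrite pderiveD; [|exact: D|by apply: derivableN; exact: D].
by rewrite pderiveN//; exact: D.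
Qed.

(* Integrating by parts moves the second derivatives of the metric onto the
   density, leaving a quadratic polynomial in the first derivatives. *)
Lemma scalar_divergence x : U x ->
  phi x * (Num.sqrt (\det (G x)) * scalar_local G x) =
  \sum_a pderive a (scalar_flux G phi a) x + weak_scalar G phi x.
Proof.
move=> Ux.
have Cc b := conn_C1 b oU mG; have Cd := density_C1.
under eq_bigr => a _ do rewrite scalar_flux_pderive// sumrB.
rewrite sumrB [X in X - _]exchange_big /=.
rewrite -sumrB -big_split scalar_localE !mulr_sumr /=; apply: eq_bigr => b _.
rewrite -sumrB -big_split !mulr_sumr /=; apply: eq_bigr => a _.
rewrite !(dmxM _ Cd (Cc _) Ux).
have -> : phi x * (Num.sqrt (\det (G x)) * (invmx (G x) *m curv G a b x) b a) =
   (density G phi x *m curv G a b x) b a.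
  by rewrite /density -scalemxAl [RHS]mxE mulrA.
have -> : density G phi x *m curv G a b x = density G phi x *m dmx a (conn G b) x
    - density G phi x *m dmx b (conn G a) x
    + density G phi x *m (conn G b x *m conn G a x - conn G a x *m conn G b x).
  have ml (N X Y Z : 'M[R]_n) : N *m (X - Y + Z) = N *m X - N *m Y + N *m Z.
    by rewrite mulmxDr mulmxBr.
  exact: ml.
move: (density G phi x *m (_ *m _ - _)) (density G phi x *m dmx a _ _) (density G phi x *m dmx b _ _).
move: (dmx a _ x *m _) (dmx b _ x *m _) => p q r s t.
by rewrite !mxE; ring.
Qed.

(** [conn] is C^1 because the metric is C^2, so the flux extended by zero is C^1 on R^n, vanishes
    off [K], and its divergence integrates to 0. *)
Lemma weak_form :
  (\int[lam]_(x in setT) (phi x * (Num.sqrt (\det (G x)) * scalar_local G x))%:E =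
   \int[lam]_(x in setT) (weak_scalar G phi x)%:E)%E.
Proof.
have CF a : Ck 1 setT (scalar_flux G phi a).
  exact: (Ck_extend0 oU cK KU (scalar_flux_C1 a) (@scalar_flux_out a)).
have ID a : lam.-integrable setT (EFin \o pderive a (scalar_flux G phi a)).
  apply: (C0_compact_integrable cK); first exact: Ck_pderive (CF a).
  by move=> x nK; apply: (pderive_outside a cK) => // y; exact: scalar_flux_out.
have IW := C0_compact_integrable cK weak_scalar_C0 weak_scalar_out.
have E x : phi x * (Num.sqrt (\det (G x)) * scalar_local G x) =
    \sum_a pderive a (scalar_flux G phi a) x + weak_scalar G phi x.
  have [Ux|nU] := pselect (U x); first exact: scalar_divergence.
  have nK : ~ K x by move=> /KU.
  rewrite phi0// mul0r weak_scalar_out// addr0 big1// => a _.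
  by apply: (pderive_outside a cK) => // y; exact: scalar_flux_out.
under eq_integral => x _ do rewrite E EFinD -sumEFin.
rewrite integralD//; last first.
  exact: (integrable_sum measurableT _ (fun a _ => ID a)).
rewrite integral_sum// big1 ?add0e// => a _.
exact: integral_pderive0 (CF a) cK (@scalar_flux_out a).
Qed.

End weak_form.

(** * The Riemannian volume measure *)

Section density_pushforward.
Local Open Scope ereal_scope.
Context d1 d2 (X : measurableType d1) (Y : measurableType d2) (R : realType).
Variables (m : {measure set X -> \bar R}) (D : set X) (phi : X -> Y) (h : X -> R).
Hypotheses (mD : measurable D) (mphi : measurable_fun D phi)
  (mh : measurable_fun D h) (h0 : forall x, D x -> (0 <= h x)%R).

Let mphiA A : measurable A -> measurable (D `&` phi @^-1` A).
Proof. exact: mphi. Qed.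

Let mEh : measurable_fun D (EFin \o h). Proof. exact/measurable_EFinP. Qed.

Let mEhA A : measurable A -> measurable_fun (D `&` phi @^-1` A) (EFin \o h).
Proof. by move=> mA; apply: measurable_funS mEh => //; exact: subIsetl. Qed.

(** Used in both directions: chart volumes are pushforwards of a density under [cinv], and with
    [h = 1] they are transported back to R^n under [cmap]. *)
Lemma density_pushforward_measure : exists p : {measure set Y -> \bar R},
  p = (fun A => \int[m]_(x in D `&` phi @^-1` A) (h x)%:E) :> (set Y -> \bar R).
Proof.
pose q (A : set Y) := \int[m]_(x in D `&` phi @^-1` A) (h x)%:E.
have q0 : q set0 = 0 by rewrite /q preimage_set0 setI0 integral_set0.
have qge A : 0 <= q A by apply: integral_ge0 => x [Dx _]; rewrite lee_fin h0.
have qs : semi_sigma_additive q.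
  move=> F mF tF mUF.
  have -> : q (\bigcup_n F n) = \sum_(n <oo) q (F n).
    rewrite /q preimage_bigcup setI_bigcupr ge0_integral_bigcup//.
    - by move=> k; exact: mphiA.
    - rewrite -setI_bigcupr -preimage_bigcup; exact: mEhA.
    - by move=> x [k _ [Dx _]]; rewrite lee_fin h0.
    - apply/trivIsetP => i j _ _ ij; apply/seteqP; split=> // x [[_ Fi] [_ Fj]].
      by move/trivIsetP : tF => /(_ i j I I ij)/seteqP[/(_ _ (conj Fi Fj))].
  by apply: is_cvg_nneseries => n _ _; exact: qge.
pose p0 : {measure set Y -> \bar R} := HB.pack q (isMeasure.Build _ _ _ q q0 qge qs).
by exists p0.
Qed.

Variable p : {measure set Y -> \bar R}.
Hypothesis pE : forall A, measurable A ->
  p A = \int[m]_(x in D `&` phi @^-1` A) (h x)%:E.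

Import HBNNSimple.

(** For simple functions this reduces to [pE] on level sets; the general case follows by monotone
    convergence on both sides. *)
Lemma ge0_integral_density (F : Y -> \bar R) : measurable_fun setT F ->
  (forall y, 0 <= F y) ->
  \int[p]_(y in setT) F y = \int[m]_(x in D) (F (phi x) * (h x)%:E).
Proof.
move=> mF F0; pose f_ := nnsfun_approx measurableT mF.
have mfk n r : measurable (f_ n @^-1` [set r]) by [].
have nd n k y : (n <= k)%N -> (f_ n y <= f_ k y)%R.
  by move=> nk; exact/lefP/nd_nnsfun_approx.
transitivity (limn (fun n => \int[p]_(x in setT) (f_ n x)%:E)).
  rewrite -monotone_convergence//.
  - apply: eq_integral => y _; apply/esym/cvg_lim => //.
    by apply: cvg_nnsfun_approx => // *.
  - by move=> n; exact/measurable_EFinP/measurable_funP.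
  - by move=> n y _; rewrite lee_fin.
  - by move=> y _ n k nk; rewrite lee_fin nd.
have mfphi n : measurable_fun D (f_ n \o phi).
  exact: measurableT_comp.
rewrite [X in limn X](_ : _ = (fun n => \int[m]_(x in D) ((f_ n (phi x))%:E * (h x)%:E))).
  rewrite -monotone_convergence//.
  - apply: eq_integral => x /[!inE] Dx; apply/cvg_lim => //.
    by apply: cvgeZr => //; apply: cvg_nnsfun_approx => // *.
  - move=> n; apply: emeasurable_funM => //.
    exact: (measurableT_comp _ (mfphi n)).
  - by move=> n x Dx; rewrite mule_ge0// lee_fin ?h0.
  - by move=> x Dx n k nk; rewrite lee_wpmul2r ?lee_fin ?h0 ?nd.
apply/funext => n.
have ind0 k x : D x -> 0 <= (k * \1_(f_ n @^-1` [set k]) (phi x))%:E * (h x)%:E.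
  by move=> Dx; rewrite mule_ge0 ?nnfun_muleindic_ge0// lee_fin h0.
have mind k : measurable_fun D (fun x => \1_(f_ n @^-1` [set k]) (phi x) : R).
  apply: (@measurableT_comp _ _ _ _ _ _ (\1_(f_ n @^-1` [set k]) : Y -> R)) => //.
transitivity (\sum_(k \in range (f_ n))
    \int[m]_(x in D) ((k * \1_(f_ n @^-1` [set k]) (phi x))%:E * (h x)%:E)).
  under eq_integral do rewrite fimfunE -fsumEFin//.
  rewrite ge0_integral_fsum//; last 2 first.
  - by move=> y; exact/measurable_EFinP/measurable_funM.
  - by move=> y x _; rewrite nnfun_muleindic_ge0.
  apply: eq_fsbigr => r _; rewrite integralZl_indic_nnsfun// integral_indic// setIT.
  rewrite pE// integral_mkcondr.
  (* A negative [r] is not a value of the nonnegative simple function: its level set is empty and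
     both sides vanish. Otherwise [r] can be taken out of the integral. *)
  have [r0|r0] := ltP r 0%R.
    rewrite (preimage_nnfun0 (f_ n) r0) preimage_set0.
    under eq_integral do rewrite patchE in_set0.
    under [RHS]eq_integral do rewrite indic0 mulr0 mul0e.
    by rewrite integral0 mule0.
  under [RHS]eq_integral do rewrite EFinM -muleA.
  rewrite [RHS]ge0_integralZl//; last 2 first.
  - by apply: emeasurable_funM => //; exact/measurable_EFinP.
  - by move=> x Dx; rewrite mule_ge0// lee_fin ?h0.
  congr (_ * _); apply: eq_integral => x _.
  rewrite patchE indicE.
  rewrite (_ : (x \in phi @^-1` _) = (phi x \in f_ n @^-1` [set r]))//.
  by case: (_ \in _); rewrite ?mul1e ?mul0e.
rewrite -ge0_integral_fsum//.
- apply: eq_integral => x /[!inE] Dx.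
  rewrite -ge0_mule_fsuml => [|y]; last exact: nnfun_muleindic_ge0.
  by rewrite fsumEFin// -fimfunE.
- by move=> r; apply: emeasurable_funM => //; apply/measurable_EFinP/measurable_funM.
Qed.

Lemma integral_density (F : Y -> R) : measurable_fun setT F ->
  \int[p]_(y in setT) (F y)%:E = \int[m]_(x in D) (F (phi x) * h x)%:E.
Proof.
move=> mF; rewrite [LHS]integralE [RHS]integralE.
have mEF : measurable_fun setT (EFin \o F) by exact/measurable_EFinP.
rewrite !ge0_integral_density; last 4 first.
- exact: measurable_funeneg.
- by [].
- exact: measurable_funepos.
- by [].
congr (_ - _); apply: eq_integral => x /[!inE] Dx.
- by rewrite !funeposE -!EFin_max -EFinM maxr_pMl ?h0// mul0r.
- by rewrite !funenegE -!EFinN -!EFin_max -EFinM maxr_pMl ?h0// mul0r mulNr.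
Qed.

End density_pushforward.

Section open_continuous.
Context {T : ptopologicalType}.

Lemma open_continuous_measurable (S : ptopologicalType) (U : set T) (f : T -> S) :
  open U -> (forall x, U x -> {for x, continuous f}) ->
  measurable_fun (U : set (borel T)) (f : borel T -> borel S).
Proof.
move=> oU cf.
have /(continuous_inP f oU) cfU : {in U, continuous f} by move=> x /[!inE] /cf.
apply: (@measurability _ _ (borel T) (borel S) U f (@open S) erefl) => // _ [V oV <-].
by apply: open_borel_measurable; exact: cfU.
Qed.

Lemma open_continuous_measurable_real (R : realType) (U : set T) (f : T -> R) :
  open U -> (forall x, U x -> {for x, continuous f}) ->
  measurable_fun (U : set (borel T)) (f : borel T -> measurableTypeR R).
Proof.
move=> oU cf.
have /(continuous_inP f oU) cfU : {in U, continuous f} by move=> x /[!inE] /cf.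
apply: (measurability _ (RGenOpens.measurableE R)) => _ [_ [a [b ->] <-]].
by apply: open_borel_measurable; apply: cfU; exact: interval_open.
Qed.

End open_continuous.

Section chart_facts.
Context {R : realType} {n : nat} {M : ptopologicalType} (c : chart R n M).

Lemma cimg_openT : open (cimg c). Proof. exact: cimg_open. Qed.

Lemma cmap_continuous_at p : cdom c p -> {for p, continuous (cmap c)}.
Proof.
move=> cp; have := @cmap_continuous _ _ _ c.
by rewrite continuous_open_subspace; [apply; rewrite inE|exact: cdom_open].
Qed.

Lemma cinv_continuous_at x : cimg c x -> {for x, continuous (cinv c)}.
Proof.
move=> cx; have := @cinv_continuous _ _ _ c.
by rewrite continuous_open_subspace; [apply; rewrite inE|exact: cimg_open].
Qed.

Lemma cmap_img p : cdom c p -> cimg c (cmap c p).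
Proof. by move=> cp; exists p. Qed.

Lemma cinv_dom x : cimg c x -> cdom c (cinv c x).
Proof. by move=> [p cp <-]; rewrite cmapK. Qed.

Lemma cinvK x : cimg c x -> cmap c (cinv c x) = x.
Proof. by move=> [p cp <-]; rewrite cmapK. Qed.

(** Replaces the direct image in [volume_along] by a preimage under the continuous [cinv], which
    preserves open and measurable sets. *)
Lemma chart_image A : cmap c @` (A `&` cdom c) = cimg c `&` cinv c @^-1` A.
Proof.
apply/seteqP; split=> [_ [p [Ap cp] <-]|x [cx Ax]].
  by split; [exact: cmap_img|rewrite /= cmapK].
by exists (cinv c x); [split=> //; exact: cinv_dom|rewrite cinvK].
Qed.

Lemma open_chart_image A : open A -> open (cmap c @` (A `&` cdom c)).
Proof.
rewrite chart_image; have /(continuous_inP (cinv c) (@cimg_openT)) : {in cimg c, continuous (cinv c)}.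
  by move=> x /[!inE]; exact: cinv_continuous_at.
exact.
Qed.

Lemma open_chart_preimage V : open V -> open (cdom c `&` cmap c @^-1` V).
Proof.
have /(continuous_inP (cmap c) (@cdom_open _ _ _ c)) : {in cdom c, continuous (cmap c)}.
  by move=> x /[!inE]; exact: cmap_continuous_at.
exact.
Qed.

Lemma measurable_cinv :
  measurable_fun (cimg c : set (borel _)) (cinv c : borel 'rV[R]_n -> borel M).
Proof. by apply: open_continuous_measurable; [exact: cimg_openT|exact: cinv_continuous_at]. Qed.

Lemma measurable_cmap :
  measurable_fun (cdom c : set (borel M)) (cmap c : borel M -> borel 'rV[R]_n).
Proof. by apply: open_continuous_measurable; [exact: cdom_open|exact: cmap_continuous_at]. Qed.

End chart_facts.

Section chart_volume.
Context {R : realType} {n : nat} {M : closed_manifold R n} (g : riem_metric M).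
Local Open Scope ereal_scope.
Local Notation lam := (@lebesgue_rV R n).
Local Notation dom i := (cdom (charts i) : set (borel M)).
Implicit Types i j : cindex M.

Definition sqdet i x := Num.sqrt (\det (g i x)).

Lemma riem_metric_on i : metric_on (cimg (charts i)) (g i).
Proof.
split; first by move=> a b; exact: comp_C2.
move=> x ix; split; first exact: comp_sym.
by move=> v; exact: comp_pos.
Qed.

Lemma sqdet_gt0 i x : cimg (charts i) x -> (0 < sqdet i x)%R.
Proof. by move=> ix; rewrite sqrtr_gt0; apply: posdef_det; apply: (riem_metric_on i).2. Qed.

Lemma sqdet_continuous i x : cimg (charts i) x -> {for x, continuous (sqdet i)}.
Proof.
exact: (Ck_continuous (sqrt_det_C1 (@cimg_openT _ _ _ (charts i)) (riem_metric_on i))).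
Qed.

Lemma measurable_sqdet i : measurable_fun (cimg (charts i) : set (borel _))
  (sqdet i : borel 'rV[R]_n -> R).
Proof.
by apply: open_continuous_measurable_real; [exact: cimg_openT|exact: sqdet_continuous].
Qed.

Definition chart_volume i (A : set (borel M)) : \bar R :=
  \int[lam]_(x in (cmap (charts i) @` (A `&` dom i) : set (borel _))) (sqdet i x)%:E.

Let mimg i : measurable (cimg (charts i) : set (borel 'rV[R]_n)).
Proof. by apply: open_borel_measurable; exact: cimg_openT. Qed.

Lemma measurable_dom i : measurable (dom i).
Proof. by apply: open_borel_measurable; exact: cdom_open. Qed.

Lemma chart_volume_spec i : exists p : {measure set (borel M) -> \bar R},
  p = chart_volume i :> (set (borel M) -> \bar R).
Proof.
have [p pE] := density_pushforward_measure lam (@mimg i)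
  (@measurable_cinv _ _ _ (charts i)) (@measurable_sqdet i) (fun x ix => ltW (sqdet_gt0 ix)).
by exists p; rewrite pE; apply/funext => A; rewrite /chart_volume chart_image.
Qed.

Let cv0 i : chart_volume i set0 = 0.
Proof. by have [p <-] := chart_volume_spec i; exact: measure0. Qed.
Let cv_ge0 i A : 0 <= chart_volume i A.
Proof. by have [p <-] := chart_volume_spec i; exact: measure_ge0. Qed.
Let cv_sigma i : semi_sigma_additive (chart_volume i).
Proof. by have [p <-] := chart_volume_spec i; exact: measure_semi_sigma_additive. Qed.

HB.instance Definition _ i :=
  isMeasure.Build _ _ _ (chart_volume i) (cv0 i) (@cv_ge0 i) (@cv_sigma i).

(** The tail of the list sees [A] only outside [dom i], that is, through the restriction of a
    measure; sums and restrictions of measures are measures. *)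
Lemma volume_along_spec (s : seq (cindex M)) :
  exists p : {measure set (borel M) -> \bar R},
  p = volume_along g s :> (set (borel M) -> \bar R).
Proof.
elim: s => [|i s [p pE]]; first by exists mzero.
have mC : measurable (~` (dom i)) by apply: measurableC; exact: measurable_dom.
exists (measure_add (chart_volume i) (mrestr p mC)).
apply/funext => A; rewrite [LHS]measure_addE.
by transitivity (chart_volume i A + p (A `&` ~` dom i)) => //; rewrite pE -setDE.
Qed.

Let volume0 : volume g set0 = 0.
Proof.
by have [p E] := volume_along_spec (finite_atlas M); rewrite /volume -E; exact: measure0.
Qed.
Let volume_ge0 A : 0 <= volume g A.
Proof. by have [p E] := volume_along_spec (finite_atlas M); rewrite /volume -E. Qed.
Let volume_sigma : semi_sigma_additive (volume g).
Proof.
by have [p E] := volume_along_spec (finite_atlas M); rewrite /volume -E; exact: measure_semi_sigma_additive.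
Qed.

HB.instance Definition _ := isMeasure.Build _ _ _ (volume g) volume0 volume_ge0 volume_sigma.

End chart_volume.

(** * Chart volumes of small cubes *)

Section cube_image.
Context {R : realType} {n : nat}.
Local Notation lam := (@lebesgue_rV R n).

(* The image of a small cube under [T] lies in a slightly larger cube after the
   linear change of variables [jac T x0]. *)
Lemma C1_cube_image (U : set 'rV[R]_n) (T : 'I_n -> 'rV[R]_n -> R) x0 (eta : R) :
  open U -> (forall b, Ck 1 U (T b)) -> U x0 -> jac T x0 \in unitmx -> 0 < eta ->
  exists2 V, nbhs x0 V & forall k z, dyadic k z `<=` V ->
    exists E : set (borel 'rV[R]_n), [/\ measurable E,
      forall x, dyadic k z x -> E (\row_b T b x) &
      (lam E <= (`|\det (jac T x0)| * (1 + eta) ^+ n)%:E * lam (dyadic k z))%E].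
Proof.
move=> oU CT Ux0 Ju eta0; set J := jac T x0; pose Ji := invmx J.
(* Applying [Ji] enlarges the error of the linear approximation by at most the factor [C]. With the
   precision [e] this costs at most half of the allowed [eta]; the other half makes the bound
   strict, as the upper faces of boxes are open. *)
pose C : R := \sum_b \sum_d `|Ji b d|.
have C0 : 0 <= C by apply: sumr_ge0 => b _; apply: sumr_ge0.
pose e := eta / 2 / (C + 1).
have e0 : 0 < e by rewrite !divr_gt0// ltr_wpDl.
have /choice[r rP] : forall b, exists r : R, 0 < r /\ (forall y z, ball x0 r y -> ball x0 r z ->
    `|T b z - T b y - \sum_a pderive a (T b) x0 * (z 0 a - y 0 a)| <= e * `|z - y|).
  by move=> b; have [r r0 [_ rP]] := C1_strict_diff oU (CT b) Ux0 e0; exists r.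
exists [set y | forall b, ball x0 (r b) y].
  apply: (near_forall_fin (P := fun b y => ball x0 (r b) y)) => b.
  by have [r0 _] := rP b; exact: nbhsx_ballx.
move=> k z zV.
have s0 : (0 : R) < 2 ^+ k by rewrite exprn_gt0.
pose s : R := (2 ^+ k)^-1; have s_gt0 : 0 < s by rewrite invr_gt0.
have sk : 2 ^+ k * s = 1 by rewrite /s divff// gt_eqF.
pose xc : 'rV[R]_n := \row_i ((z 0 i)%:~R * s + s / 2).
have Qxc : dyadic k z xc.
  apply/dyadicP => i; rewrite mxE mulrDr mulrCA sk mulr1 mulrA sk intrD.
  by apply/andP; split; lra.
have Qs x : dyadic k z x -> forall i, `|x 0 i - xc 0 i| <= s / 2.
  move=> /dyadicP Qx i; have /andP[] := Qx i; rewrite intrD => h1 h2.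
  rewrite -(ler_pM2l s0) -[X in X * _](gtr0_norm s0) -normrM mulrBr mxE.
  rewrite mulrDr mulrCA sk mulr1 mulrA sk ler_norml.
  by apply/andP; split; lra.
have tau_approx x b : dyadic k z x ->
    `|(T b x - T b xc) - ((x - xc) *m J) 0 b| <= e * (s / 2).
  move=> Qx; have [r0 /(_ xc x)] := rP b.
  rewrite (_ : \sum_a _ = ((x - xc) *m J) 0 b); last first.
    by rewrite mxE; apply: eq_bigr => a _; rewrite jacE !mxE mulrC.
  move=> /(_ (zV _ Qxc b) (zV _ Qx b)) /le_trans; apply.
  rewrite ler_pM2l//; apply: norm_rV_le; first by rewrite divr_ge0// ltW.
  by move=> i; rewrite !mxE; have := Qs x Qx i; rewrite mxE.
pose tau x : 'rV[R]_n := \row_b T b x.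
pose h := (1 + eta) * (s / 2).
have h0 : 0 < h by rewrite mulr_gt0 ?divr_gt0// addr_gt0.
pose B := box (const_mx (- h)) (const_mx h : 'rV[R]_n).
have mB : measurable (B : set (borel _)) by exact: measurable_box.
pose E : set (borel 'rV[R]_n) := [set y | B (y *m Ji + (- (tau xc *m Ji)))].
have mE : measurable E by exact: measurable_affine_mx.
exists E; split => //.
  move=> x Qx i; rewrite !mxE.
  suff : `|(tau x *m Ji) 0 i - (tau xc *m Ji) 0 i| < h.
    by rewrite !mxE ltr_norml => /andP[/ltW -> ->].
  pose rho : 'rV[R]_n := tau x - tau xc - (x - xc) *m J.
  have -> : (tau x *m Ji) 0 i - (tau xc *m Ji) 0 i = (x 0 i - xc 0 i) + (rho *m Ji) 0 i.
    have : tau x *m Ji - tau xc *m Ji = (x - xc) + rho *m Ji.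
      by rewrite -mulmxBl /rho [in RHS]mulmxBl /Ji mulmxK// [RHS]addrC subrK.
    by move/(congr1 (fun v : 'rV[R]_n => v 0 i)); rewrite [LHS]mxE [X in _ + X]mxE => ->; rewrite !mxE.
  apply: le_lt_trans (ler_normD _ _) _.
  have rC : `|(rho *m Ji) 0 i| <= e * (s / 2) * C.
    rewrite mxE; apply: le_trans (ler_norm_sum _ _ _) _.
    rewrite /C mulr_sumr; apply: ler_sum => b _; rewrite normrM.
    apply: ler_pM => //; first by have := tau_approx x b Qx; rewrite !mxE.
    by rewrite (bigD1 i)//= lerDl sumr_ge0.
  have eC : e * C <= eta / 2.
    rewrite /e -mulrA ler_piMr ?divr_ge0 ?(ltW eta0)// mulrC ler_pdivrMr ?mul1r ?ler_wpDr//.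
    by rewrite ltr_wpDl.
  have := Qs x Qx i; rewrite /h; move: rC eC s_gt0 eta0; clear.
  set A := `|_|; set D := `|_|; move=> rC eC s0 e0 DA.
  have : e * (s / 2) * C <= eta / 2 * (s / 2).
    by rewrite mulrAC ler_pM2r// divr_gt0.
  have : 0 < eta * s by rewrite mulr_gt0.
  by lra.
have := lebesgue_rV_linear (- (tau xc *m Ji)) (_ : Ji \in unitmx) mB.
rewrite unitmx_inv => /(_ Ju) LB.
have dJ : `|\det J| != 0 by rewrite normr_eq0; move: Ju; rewrite unitmxE unitfE.
have -> : lam E = (`|\det J|%:E * lam B)%E.
  rewrite [lam B]LB /Ji det_inv normfV muleA -EFinM divff// mul1e //.
rewrite dyadic_box !lebesgue_rV_box; last 2 first.
- by move=> i; rewrite !mxE; clear -h0; lra.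
- by move=> i; rewrite !mxE ler_pM2r ?invr_gt0// ler_int lerDl.
rewrite -!EFinM lee_fin -mulrA ler_pM2l ?lt_def ?dJ ?normr_ge0//.
under eq_bigr do rewrite !mxE.
under [in leRHS]eq_bigr do rewrite !mxE -mulrBl intrD addrAC subrr add0r mul1r.
rewrite !prodr_const card_ord -exprMn /h.
by rewrite (_ : _ - _ = (1 + eta) * (2 ^+ k)^-1)// -/s; clear; lra.
Qed.

End cube_image.

Section overlap.
Context {R : realType} {n : nat} {M : closed_manifold R n} (g : riem_metric M).
Local Notation lam := (@lebesgue_rV R n).
Local Notation dom i := (cdom (charts i) : set (borel M)).
Local Notation trans i j := (transition (charts i) (charts j)).
Implicit Types i j : cindex M.

Definition overlap i j := cmap (charts i) @` (cdom (charts i) `&` cdom (charts j)).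

Definition change i j x : 'rV[R]_n := \row_b trans i j b x.

Lemma changeE i j x : change i j x = cmap (charts j) (cinv (charts i) x).
Proof. by apply/rowP => b; rewrite mxE. Qed.

Lemma change_cmap i j p : cdom (charts i) p ->
  change i j (cmap (charts i) p) = cmap (charts j) p.
Proof. by move=> ip; rewrite changeE cmapK. Qed.

Lemma open_overlap i j : open (overlap i j).
Proof. by rewrite /overlap setIC; apply: open_chart_image; exact: cdom_open. Qed.

Lemma overlap_img i j x : overlap i j x -> cimg (charts i) x.
Proof. by move=> [p [ip _] <-]; exists p. Qed.

Lemma overlap_change i j x : overlap i j x -> cimg (charts j) (change i j x).
Proof. by move=> [p [ip jp] <-]; rewrite change_cmap//; exists p. Qed.

Lemma overlapE i j x : overlap i j x <->
  cimg (charts i) x /\ cdom (charts j) (cinv (charts i) x).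
Proof.
split=> [[p [ip jp] <-]|[ix jx]]; first by rewrite cmapK//; split => //; exists p.
by exists (cinv (charts i) x); [split=> //; exact: cinv_dom|rewrite cinvK].
Qed.

Lemma transition_Ck k i j b : Ck k (overlap i j) (trans i j b).
Proof. exact: charts_smooth. Qed.

Lemma metric_overlap i j x : overlap i j x ->
  g i x = jac (trans i j) x *m g j (change i j x) *m (jac (trans i j) x)^T.
Proof.
move=> [p [ip jp] <-]; rewrite (comp_change g ip jp) change_cmap//.
by set J := \matrix_(_, _) _; have -> : J = jac (trans i j) (cmap (charts i) p)
  by apply/matrixP => a b; rewrite mxE jacE.
Qed.

Lemma metric_on_overlap i j : metric_on (overlap i j) (g i).
Proof.
have [C P] := riem_metric_on g i; split.
  by move=> a b; apply: Ck_sub (C a b); exact: overlap_img.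
by move=> x /overlap_img /P.
Qed.

Lemma jac_trans_unit i j x : overlap i j x -> jac (trans i j) x \in unitmx.
Proof.
apply: (jac_unit (G := g i) (H := g j)).
- exact: metric_on_overlap.
- exact: metric_overlap.
Qed.

Lemma sqdet_overlap i j x : overlap i j x ->
  sqdet g i x = `|\det (jac (trans i j) x)| * sqdet g j (change i j x).
Proof.
move=> ijx; rewrite /sqdet (metric_overlap ijx) !det_mulmx det_tr mulrAC -expr2.
by rewrite sqrtrM ?sqr_ge0// sqrtr_sqr.
Qed.

Lemma change_continuous i j x : overlap i j x -> {for x, continuous (change i j)}.
Proof. by move=> ijx; apply: continuous_row => b; exact: Ck_continuous (transition_Ck 0 i j b) ijx. Qed.

Local Open Scope ereal_scope.

Lemma chart_preimage_open (i : cindex M) (B : set (borel 'rV[R]_n)) :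
  measurable B -> measurable (dom i `&` cmap (charts i) @^-1` B : set (borel M)).
Proof. exact: (measurable_cmap (measurable_dom i)). Qed.

Lemma chart_volume_preimage i (B : set (borel 'rV[R]_n)) : B `<=` cimg (charts i) ->
  chart_volume g i (dom i `&` cmap (charts i) @^-1` B) =
  \int[lam]_(x in B) (sqdet g i x)%:E.
Proof.
move=> BU; rewrite /chart_volume; congr (integral lam _ _).
rewrite chart_image; apply/seteqP; split=> x /=.
  by move=> [ix [_ ]]; rewrite cinvK.
by move=> Bx; have ix := BU x Bx; split=> //; split; [exact: cinv_dom|rewrite /= cinvK].
Qed.

Lemma measurable_sqdetS i (Q : set (borel 'rV[R]_n)) : Q `<=` cimg (charts i) ->
  measurable_fun Q (fun x => (sqdet g i x)%:E).
Proof.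
move=> Qi; apply/measurable_EFinP; apply: measurable_funS (@measurable_sqdet _ _ _ g i) => //.
by apply: open_borel_measurable; exact: cimg_openT.
Qed.

(** Of the exponent [n.+2], [n] comes from the enlarged cube of [C1_cube_image] and one each from
    the oscillation of the two densities near [x0]. The Jacobian determinant cancels by
    [sqdet_overlap]. *)
Lemma cube_estimate i j x0 (eta : R) : overlap i j x0 -> (0 < eta)%R ->
  exists2 V, nbhs x0 V & forall k z, dyadic k z `<=` V ->
    chart_volume g j (dom i `&` cmap (charts i) @^-1` dyadic k z) <=
    ((1 + eta) ^+ n.+2)%:E *
      chart_volume g i (dom i `&` cmap (charts i) @^-1` dyadic k z).
Proof.
move=> ijx0 eta0; have e1 : (1 < 1 + eta)%R by rewrite ltrDl.
have e10 : (0 < 1 + eta)%R by exact: lt_trans ltr01 e1.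
have [V1 V1x V1P] := C1_cube_image (@open_overlap i j)
  (@transition_Ck 1 i j) ijx0 (jac_trans_unit ijx0) eta0.
pose di := sqdet g i x0; pose dj := sqdet g j (change i j x0).
have di0 : (0 < di)%R by apply: sqdet_gt0; exact: overlap_img ijx0.
have dj0 : (0 < dj)%R by apply: sqdet_gt0; exact: overlap_change.
have V2 : \forall x \near x0, (sqdet g j (change i j x) < (1 + eta) * dj)%R.
  have : {for x0, continuous (sqdet g j \o change i j)}.
    apply: continuous_comp; first exact: change_continuous.
    by apply: sqdet_continuous; exact: overlap_change.
  by move/cvgr_lt; apply; rewrite ltr_pMl.
have V3 : \forall x \near x0, (di / (1 + eta) < sqdet g i x)%R.
  have : {for x0, continuous (sqdet g i)} by apply: sqdet_continuous; exact: overlap_img ijx0.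
  by move/cvgr_gt; apply; rewrite ltr_pdivrMr ?ltr_pMr//.
exists (V1 `&` overlap i j `&` [set x | (sqdet g j (change i j x) < (1 + eta) * dj)%R]
  `&` [set x | (di / (1 + eta) < sqdet g i x)%R]).
  apply: filterI => //; apply: filterI => //; apply: filterI => //.
  by apply: open_nbhs_nbhs; split => //; exact: open_overlap.
move=> k z zV.
have [E [mE QE lamE]] := V1P k z (fun x Qx => (zV x Qx).1.1.1).
have mQ : measurable (dyadic k z : set (borel 'rV[R]_n)) by exact: measurable_dyadic.
set Q : set (borel 'rV[R]_n) := dyadic k z in mQ *.
have Qi : Q `<=` cimg (charts i) by move=> x /zV[[[_ /overlap_img]]].
have lower : (di / (1 + eta))%:E * lam Q <=
    chart_volume g i (dom i `&` cmap (charts i) @^-1` Q).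
  rewrite chart_volume_preimage// -integral_cst//; apply: ge0_le_integral => //.
  - by move=> x _; rewrite lee_fin divr_ge0 ?ltW//.
  - exact: measurable_sqdetS.
  - by move=> x Qx; rewrite lee_fin ltW//; have [] := zV x Qx.
have upper : chart_volume g j (dom i `&` cmap (charts i) @^-1` Q) <=
    ((1 + eta) * dj)%:E * lam E.
  rewrite /chart_volume chart_image; set C : set (borel 'rV[R]_n) := (X in integral _ X).
  have CP y : C y -> exists2 x, Q x & y = change i j x.
    move=> [jy [ip Qp]]; exists (cmap (charts i) (cinv (charts j) y)) => //.
    by rewrite change_cmap// cinvK.
  have mC : measurable C.
    apply: (@measurable_cinv _ _ _ (charts j)).
      by apply: open_borel_measurable; exact: cimg_openT.
    exact: chart_preimage_open.
  apply: (@le_trans _ _ (((1 + eta) * dj)%:E * lam C)); last first.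
    rewrite lee_pmul2l ?lte_fin ?mulr_gt0//.
    by apply: le_measure; rewrite ?inE// => y /CP[x Qx ->]; exact: QE.
  rewrite -integral_cst//; apply: ge0_le_integral => //.
  - by move=> y [jy _]; rewrite lee_fin ltW// sqdet_gt0.
  - by apply: measurable_sqdetS => y [].
  - by move=> y /CP[x Qx ->]; rewrite lee_fin ltW//; have [[_]] := zV x Qx.
apply: le_trans upper _; apply: le_trans (_ : _ <= ((1 + eta) * dj)%:E *
    ((`|\det (jac (trans i j) x0)| * (1 + eta) ^+ n)%:E * lam Q)) _.
  by rewrite lee_pmul2l ?lte_fin ?mulr_gt0.
rewrite muleA -EFinM.
have -> : ((1 + eta) * dj * (`|\det (jac (trans i j) x0)| * (1 + eta) ^+ n) =
    (1 + eta) ^+ n.+2 * (di / (1 + eta)))%R.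
  rewrite /di (sqdet_overlap ijx0) -/dj !exprS; field.
  by rewrite gt_eqF//.
rewrite EFinM -muleA lee_pmul2l ?lte_fin ?exprn_gt0//.
Qed.

End overlap.

Lemma lee_powD1_gt0 (R : realType) (m : nat) (x y : \bar R) : (0 <= y)%E ->
  (forall eta : R, 0 < eta -> (x <= ((1 + eta) ^+ m)%:E * y)%E) -> (x <= y)%E.
Proof.
case: y => [r| |]// _ H; last by rewrite leey.
suff L : (fun k : nat => ((1 + k.+1%:R^-1) ^+ m * r)%:E) @ \oo --> r%:E.
  by apply: (cvge_to_ge L); near=> k; rewrite EFinM; apply: H; rewrite invr_gt0.
apply: cvg_EFin; first by near=> k.
rewrite -[X in _ --> X]mul1r; apply: cvgM; last exact: cvg_cst.
rewrite -[X in _ --> X](expr1n _ m).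
apply: (@cvg_comp _ _ _ _ (fun t : R => t ^+ m) \oo _ _ _ (@exprn_continuous R m 1)).
have := @cvgD R R^o nat _ _ (cst (1 : R)) (fun k => k.+1%:R^-1) 1 0 (cvg_cst _) (@cvg_harmonic R).
by rewrite addr0; apply.
Unshelve. all: by end_near. Qed.

(** * Independence of the volume from the charts *)

Section chart_volume_eq.
Context {R : realType} {n : nat} {M : closed_manifold R n} (g : riem_metric M).
Local Notation lam := (@lebesgue_rV R n).
Local Notation dom i := (cdom (charts i) : set (borel M)).
Implicit Types i j : cindex M.
Local Open Scope ereal_scope.

Lemma chart_volume_push (m : {measure set (borel M) -> \bar R}) i :
  exists p : {measure set (borel 'rV[R]_n) -> \bar R},
    forall B, measurable B -> p B = m (dom i `&` cmap (charts i) @^-1` B).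
Proof.
have [p pE] := density_pushforward_measure m (@measurable_dom _ _ _ i)
  (@measurable_cmap _ _ _ (charts i)) (@measurable_cst _ _ _ _ _ (1%R : R)) (fun x _ => ler01).
exists p => B mB; rewrite pE -[RHS]mul1e -integral_cst//.
exact: chart_preimage_open.
Qed.

(** Both volumes are transported to the chart [i], where cubes are compared up to the factor
    [(1 + eta) ^+ n.+2]; then [eta] tends to 0. *)
Lemma chart_volume_le i j (P : set M) : open P ->
  P `<=` cdom (charts i) `&` cdom (charts j) ->
  chart_volume g j P <= chart_volume g i P.
Proof.
move=> oP PW; pose B := cmap (charts i) @` P.
have PD : P = P `&` cdom (charts i) by apply/seteqP; split=> [p Pp|p []//]; split=> //; exact: (PW p Pp).1.
have oB : open B by rewrite /B PD; exact: open_chart_image.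
have BW : B `<=` overlap i j by move=> _ [p Pp <-]; exists p => //; exact: PW.
have PE : P = dom i `&` cmap (charts i) @^-1` B.
  apply/seteqP; split=> [p Pp|p [ip [q Pq qp]]].
    by split; [exact: (PW p Pp).1|exists p].
  by rewrite -(cmapK ip) -qp cmapK//; exact: (PW q Pq).1.
have mB : measurable (B : set (borel _)) by exact: open_borel_measurable.
apply: (@lee_powD1_gt0 _ n.+2) => // eta eta0.
have [mu muE] := chart_volume_push (chart_volume g i) i.
have [nu nuE] := chart_volume_push (chart_volume g j) i.
rewrite [X in chart_volume g j X]PE [X in chart_volume g i X]PE -muE// -nuE//.
apply: dyadic_comparison => //; first by rewrite exprn_ge0// addr_ge0// ltW.
move=> x /BW ijx; have [V Vx VP] := cube_estimate g ijx eta0.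
by exists V => // k z /VP; rewrite nuE ?muE//; exact: measurable_dyadic.
Qed.

Lemma chart_volume_open i j (P : set M) : open P ->
  P `<=` cdom (charts i) `&` cdom (charts j) ->
  chart_volume g i P = chart_volume g j P.
Proof.
by move=> oP PW; apply/eqP; rewrite eq_le !chart_volume_le// setIC.
Qed.

(** Uniqueness of measures agreeing on open sets asks for finite mass, which is not yet known on a
    whole overlap. So the overlap is exhausted by the open sets [W k], on which coordinates and
    density are bounded by [k]. *)
Lemma chart_volume_eq i j (A : set (borel M)) : measurable A ->
  A `<=` cdom (charts i) `&` cdom (charts j) ->
  chart_volume g i A = chart_volume g j A.
Proof.
move=> mA AW.
pose V k := overlap i j `&` [set x | (`|x| < k%:R)%R] `&` [set x | (sqdet g i x < k%:R)%R].
have VU k : V k `<=` cimg (charts i) by move=> x [[/overlap_img]].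
have oV k : open (V k).
  have : {in cimg (charts i), continuous (sqdet g i)}.
    by move=> x /[!inE]; exact: sqdet_continuous.
  move=> /(continuous_inP _ (@cimg_openT _ _ _ (charts i))) /(_ _ (@open_lt R k%:R)) oS.
  have -> : V k = overlap i j `&` [set x | (`|x| < k%:R)%R] `&`
      (cimg (charts i) `&` sqdet g i @^-1` [set y | (y < k%:R)%R]).
    by apply/seteqP; split=> x [[ijx xk] H]; split=> //; [split=> //; exact: overlap_img ijx|case: H].
  apply: openI => //; apply: openI; first exact: open_overlap.
  apply: (open_comp (f := fun x : 'rV[R]_n => `|x|%R) (D := [set y : R | (y < k%:R)%R])) => //.
    by move=> x _; exact: norm_continuous.
pose W k : set (borel M) := dom i `&` cmap (charts i) @^-1` V k.
have oW k : open (W k : set M) by exact: open_chart_preimage.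
have WW k : W k `<=` cdom (charts i) `&` cdom (charts j).
  by move=> p [ip [[/overlapE[_]]]]; rewrite cmapK.
have mW k : measurable (W k) by apply: open_borel_measurable.
have Wfin k : chart_volume g i (W k) < +oo.
  rewrite chart_volume_preimage//.
  have mV : measurable (V k : set (borel 'rV[R]_n)) by exact: open_borel_measurable.
  apply: le_lt_trans (_ : (k%:R)%:E * lam (V k) < +oo).
    rewrite -integral_cst//; apply: ge0_le_integral => //.
    - by move=> x /VU ix; rewrite lee_fin ltW// sqdet_gt0.
    - exact: measurable_sqdetS.
    - by move=> x [_ xk]; rewrite lee_fin ltW.
  apply: lte_mul_pinfty => //.
  apply: (@le_lt_trans _ _ (lam (box (const_mx (- k%:R)%R) (const_mx k%:R : 'rV[R]_n)%R)));
    last exact: lebesgue_rV_box_lty.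
  apply: le_measure; rewrite ?inE//; first exact: measurable_box.
  move=> x [[_ xk] _] a; rewrite !mxE.
  have := le_lt_trans (coord_le_norm x a) xk; rewrite ltr_norml => /andP[/ltW -> ->//].
have eqk k : chart_volume g i (A `&` W k) = chart_volume g j (A `&` W k).
  have := @measure_unique _ R (borel M) (@open M) (fun=> setT) erefl (@openI M)
    (fun=> openT) _ (mrestr (chart_volume g i) (mW k)) (mrestr (chart_volume g j) (mW k)).
  apply => //.
  - by rewrite bigcup_const.
  - move=> B oB; apply: chart_volume_open; first exact: openI.
    by move=> p [_ /WW].
  - by move=> _; change (chart_volume g i (setT `&` W k) < +oo); rewrite setTI.
have lim m : (m = chart_volume g i \/ m = chart_volume g j) -> m (A `&` W k) @[k --> \oo] --> m A.
  move=> Hm; have AE : A = \bigcup_k (A `&` W k).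
    apply/seteqP; split=> [p Ap|p [k _ []//]]; have [ip jp] := AW p Ap.
    have [k hk] : exists k : nat, (Num.max `|cmap (charts i) p| (sqdet g i (cmap (charts i) p)) < k%:R)%R.
      by eexists; exact: truncnS_gt.
    exists k => //; split=> //; split=> //; move: hk; rewrite gt_max => /andP[h1 h2].
    by split; first by split => //; exists p.
  have nd : nondecreasing_seq (fun k => A `&` W k).
    move=> k l kl; apply/subsetPset => p [Ap [ip [[ijp h1] h2]]].
    have klR : (k%:R <= l%:R :> R)%R by rewrite ler_nat.
    by split=> //; split=> //; split; [split=> //|]; apply: lt_le_trans klR.
  have mAW k : measurable (A `&` W k) by exact: measurableI.
  case: Hm => ->; rewrite {2}AE.
    by apply: (nondecreasing_cvg_mu (mu := chart_volume g i)) => //; rewrite -AE.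
  by apply: (nondecreasing_cvg_mu (mu := chart_volume g j)) => //; rewrite -AE.
have l1 := lim _ (or_introl erefl); have l2 := lim _ (or_intror erefl).
apply: (cvg_unique _ l1) => //.
by rewrite (_ : (fun k => chart_volume g i (A `&` W k)) = fun k => chart_volume g j (A `&` W k))//;
  apply/funext.
Qed.

(** In the induction over the list, each piece lies in both [dom i] and [dom j] and is measured in
    the chart [j] instead; additivity reassembles [A]. *)
Lemma volume_chart j (A : set (borel M)) : measurable A -> A `<=` cdom (charts j) ->
  volume g A = chart_volume g j A.
Proof.
move=> mA Aj; rewrite /volume.
have : forall p, A p -> exists2 i, i \in finite_atlas M & cdom (charts i) p.
  by move=> p _; rewrite /finite_atlas; case: cid => /= s.
elim: (finite_atlas M) A mA Aj => [|i s IH] A mA Aj cov.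
  by have -> : A = set0 by [apply/seteqP; split=> // p /cov[]]; rewrite /= measure0.
have mD := @measurable_dom _ _ _ i.
rewrite (_ : volume_along g (i :: s) A = chart_volume g i A + volume_along g s (A `\` dom i))//.
rewrite IH; last 3 first.
- exact: measurableD.
- by move=> p [/Aj].
- move=> p [Ap ip]; have [k] := cov p Ap.
  by rewrite inE => /predU1P[->//|ks kp]; exists k.
have -> : chart_volume g i A = chart_volume g i (A `&` dom i).
  by rewrite /chart_volume -setIA setIid.
rewrite (@chart_volume_eq i j); last 2 first.
- exact: measurableI.
- by move=> p [/Aj].
rewrite addeC; apply/esym.
by rewrite -(@measureDI _ _ _ (chart_volume g j) A (dom i)).
Qed.

End chart_volume_eq.

Section integral_volume.
Context {R : realType} {n : nat} {M : closed_manifold R n} (g : riem_metric M).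
Local Notation lam := (@lebesgue_rV R n).
Local Notation dom i := (cdom (charts i) : set (borel M)).
Local Open Scope ereal_scope.

Lemma integral_volume_chart j (F : M -> R) :
  measurable_fun setT (F : borel M -> measurableTypeR R) ->
  \int[volume g]_(p in dom j) (F p)%:E =
  \int[lam]_(x in (cimg (charts j) : set (borel _)))
    (F (cinv (charts j) x) * sqdet g j x)%:E.
Proof.
move=> mF; have mD := @measurable_dom _ _ _ j : measurable (dom j).
rewrite (eq_measure_integral (chart_volume g j)); last first.
  by move=> A mA Aj; exact: volume_chart.
have -> : \int[chart_volume g j]_(p in dom j) (F p)%:E =
    \int[chart_volume g j]_(p in setT) ((F \_ (dom j)) p)%:E.
  by rewrite integral_mkcond; apply: eq_integral => p _; rewrite restrict_EFin.
rewrite (@integral_density _ _ _ _ R lam (cimg (charts j)) (cinv (charts j) : borel _ -> borel M) (sqdet g j)).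
- apply: eq_integral => x /[!inE] jx; rewrite patchE mem_set//.
  exact: cinv_dom.
- by apply: open_borel_measurable; exact: cimg_openT.
- exact: measurable_cinv.
- exact: measurable_sqdet.
- by move=> x jx; rewrite ltW// sqdet_gt0.
- move=> A mA; transitivity (chart_volume g j A) => //.
  by rewrite /chart_volume chart_image.
- apply/(measurable_restrictT _ mD); exact: measurable_funTS.
Qed.

End integral_volume.

(** * Partition of unity *)

Section bump.
Context {R : realType} {n : nat}.

Definition bump (x0 : 'rV[R]_n) (r : R) (x : 'rV[R]_n) : R :=
  Num.max 0 (r ^+ 2 - \sum_a (x 0 a - x0 0 a) ^+ 2) ^+ 2.

Lemma bump_C1 x0 r : Ck 1 setT (bump x0 r).
Proof.
apply: C1_sqpos; first exact: openT.
apply: Ck_add; [exact: openT|exact: Ck_cst|apply: Ck_opp; first exact: openT].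
apply: Ck_sum; first exact: openT; move=> a.
have C1a : Ck 1 setT (fun x : 'rV[R]_n => x 0 a - x0 0 a).
  by apply: Ck_add; [exact: openT|apply: Ck_coord; exact: openT|exact: Ck_cst].
by under eq_fun do rewrite expr2; apply: Ck_mul => //; exact: openT.
Qed.

Lemma bump_center x0 r : 0 < r -> 0 < bump x0 r x0.
Proof.
move=> r0; rewrite /bump big1; last by move=> a _; rewrite subrr expr0n.
by rewrite subr0 max_r ?sqr_ge0// !exprn_gt0.
Qed.

Lemma bump_support x0 r x : 0 < r -> bump x0 r x != 0 ->
  forall a, `|x 0 a - x0 0 a| <= r.
Proof.
move=> r0 b0 a; have : 0 < r ^+ 2 - \sum_a (x 0 a - x0 0 a) ^+ 2.
  rewrite ltNge; apply/negP => h; move: b0.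
  by rewrite /bump max_l// expr0n eqxx.
rewrite subr_gt0 (bigD1 a)//= => /ltW h.
rewrite -(ger0_norm (ltW r0)) -ler_sqr ?nnegrE// !real_normK ?num_real//.
by apply: le_trans h; rewrite lerDl sumr_ge0// => b _; rewrite sqr_ge0.
Qed.

End bump.

Lemma nbhs_cube (R : realType) n (U : set 'rV[R]_n) (x0 : 'rV[R]_n) : nbhs x0 U ->
  exists r : R, [/\ 0 < r, compact [set x : 'rV[R]_n | forall a, `|x 0 a - x0 0 a| <= r] &
    [set x : 'rV[R]_n | forall a, `|x 0 a - x0 0 a| <= r] `<=` U].
Proof.
move=> /nbhs_ballP[e /= e0 eU]; exists (e / 2); have e20 : 0 < e / 2 by rewrite divr_gt0.
split => //.
  rewrite (_ : [set x | _] = [set v : 'rV[R]_n | forall a, `[x0 0 a - e / 2, x0 0 a + e / 2]%classic (v ord0 a)]).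
    apply: (@rV_compact R n (fun a => `[x0 0 a - e / 2, x0 0 a + e / 2]%classic)) => a.
    exact: segment_compact.
  by apply/seteqP; split=> x xK a; have := xK a; rewrite /= in_itv/= ler_distl.
move=> x xK; apply: eU; apply/ball_rVP => // a; rewrite distrC.
by apply: le_lt_trans (xK a) _; rewrite ltr_pdivrMr// ltr_pMr// ltr1n.
Qed.

Section partition_of_unity.
Context {R : realType} {n : nat} {M : closed_manifold R n}.
Local Notation c_ p := (charts (chart_at (p : M))).

Lemma chart_atP (p : M) : cdom (c_ p) p.
Proof. by rewrite /chart_at; case: cid. Qed.

Lemma chartwise_continuous (F : M -> R) :
  (forall i, Ck 0 (cimg (charts i)) (F \o cinv (charts i))) -> continuous F.
Proof.
move=> CF p; have cp := chart_atP p.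
have h : {for p, continuous ((F \o cinv (c_ p)) \o cmap (c_ p))}.
  apply: continuous_comp; first exact: cmap_continuous_at.
  by apply: Ck_continuous (CF _) _; exact: cmap_img.
apply: near_continuous h; apply: (near_open _ cp); first exact: cdom_open.
by move=> q cq; rewrite /= cmapK.
Qed.

Definition chart_bump (p : M) (r : R) (q : M) : R :=
  ((bump (cmap (c_ p) p) r \o cmap (c_ p)) \_ (cdom (c_ p))) q.

(** [S] is compact, hence closed in the Hausdorff space [M]. The image of the chart [i] is covered
    by the overlap, where the bump is composed with the transition, and by the part away from [S],
    where it is zero. *)
Lemma chart_bump_C1 (p : M) r (K : set 'rV[R]_n) i : compact K -> K `<=` cimg (c_ p) ->
  (forall x, bump (cmap (c_ p) p) r x != 0 -> K x) ->
  Ck 1 (cimg (charts i)) (chart_bump p r \o cinv (charts i)).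
Proof.
move=> cK KU supp; pose S := cinv (c_ p) @` K.
have cS : closed S.
  apply: compact_closed; first exact: mf_hausdorff.
  apply: continuous_compact cK; apply: continuous_subspaceW KU _.
  exact: cinv_continuous.
apply: Ck_near => x ix; have [Sx|nSx] := pselect (S (cinv (charts i) x)).
  exists (overlap i (chart_at p)); split.
  - exact: open_overlap.
  - apply/overlapE; split=> //; case: Sx => y /KU py <-; exact: cinv_dom.
  exists (fun y => bump (cmap (c_ p) p) r (\row_b transition (charts i) (c_ p) b y)).
    apply: (C1_comp (V := setT)) => //; [exact: open_overlap|exact: openT|exact: bump_C1|].
    by move=> b; exact: transition_Ck.
  move=> y /overlapE[iy py]; rewrite /chart_bump /= patchE mem_set//=.
  by rewrite -/(change i (chart_at p) y) changeE.
exists (cimg (charts i) `&` cinv (charts i) @^-1` (~` S)); split => //.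
  have : {in cimg (charts i), continuous (cinv (charts i))}.
    by move=> y /[!inE]; exact: cinv_continuous_at.
  move=> /(continuous_inP _ (@cimg_openT _ _ _ (charts i))); apply.
  exact: closed_openC.
exists (fun=> 0); first exact: Ck_cst.
move=> y [iy nSy]; rewrite /chart_bump /= patchE; case: ifPn => // /[!inE] py.
apply/esym/eqP; apply: contrapT => /negP b0; apply: nSy.
by exists (cmap (c_ p) (cinv (charts i) y)); [exact: supp|rewrite cmapK].
Qed.

(** Every point gets a bump in its own chart, so [psi] and [K] are indexed by points; compactness
    selects the list [s] of points that is summed. Division by the sum [S] does not enlarge
    supports. *)
Lemma partition_of_unity : exists (s : seq M) (psi : M -> M -> R) (K : M -> set 'rV[R]_n),
  [/\ forall p, compact (K p) /\ K p `<=` cimg (c_ p),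
      forall p i, Ck 1 (cimg (charts i)) (psi p \o cinv (charts i)),
      forall p q, psi p q != 0 -> cdom (c_ p) q /\ K p (cmap (c_ p) q) &
      forall q, \sum_(p <- s) psi p q = 1].
Proof.
have /choice[r rP] := fun p : M =>
  nbhs_cube (open_nbhs_nbhs (conj (@cimg_openT _ _ _ (c_ p)) (cmap_img (chart_atP p)))).
pose K p : set 'rV[R]_n := [set x | forall a, `|x 0 a - cmap (c_ p) p 0 a| <= r p].
pose b p := chart_bump p (r p).
have bK p q : b p q != 0 -> cdom (c_ p) q /\ K p (cmap (c_ p) q).
  rewrite /b /chart_bump patchE; case: ifPn; last by rewrite eqxx.
  by rewrite inE => pq /bump_support pK; split=> // a; apply: pK; case: (rP p).
have b0 p q : 0 <= b p q.
  by rewrite /b /chart_bump patchE; case: ifP => // _; rewrite /= /bump sqr_ge0.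
have Cb p i : Ck 1 (cimg (charts i)) (b p \o cinv (charts i)).
  have [r0 cK KU] := rP p; apply: chart_bump_C1 cK KU _ => x.
  exact: bump_support.
have bp p : 0 < b p p.
  rewrite /b /chart_bump patchE mem_set /=; last exact: chart_atP.
  by apply: bump_center; case: (rP p).
have := @manifold_compact R n M; rewrite compact_cover => cM.
have [|p _|D _ covD] := cM M setT (fun p => [set q | 0 < b p q]).
- move=> p _; have /continuousP : continuous (b p).
    by apply: chartwise_continuous => i; exact: Ck_pred.
  by move=> /(_ _ (@open_gt R 0)).
- by exists p => //; exact: bp.
pose S q := \sum_(p <- finmap.enum_fset D) b p q.
have S0 q : 0 < S q.
  have [p /= pD bpq] := covD q I; apply: lt_le_trans bpq _.
  by rewrite /S (big_rem p)//= lerDl sumr_ge0.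
exists (finmap.enum_fset D), (fun p q => b p q / S q), K; split.
- by move=> p; have [] := rP p.
- move=> p i; apply: (@Ck_mul _ _ 1 _ (b p \o cinv (charts i)) (fun x => (S (cinv (charts i) x))^-1)).
  + exact: cimg_openT.
  + exact: Cb.
  + apply: C1_inv; first exact: cimg_openT.
      by apply: Ck_sum => [|p']; [exact: cimg_openT|exact: (Cb p')].
    by move=> x _; rewrite gt_eqF.
- by move=> p q; rewrite mulf_eq0 => /norP[/bK].
- by move=> q; rewrite -mulr_suml -/(S q) divff// gt_eqF.
Qed.

End partition_of_unity.

(** * Perturbation of the metric on a compact subset of a chart *)

Section metric_perturbation.
Context {R : realType} {n : nat}.
Context (U : set 'rV[R]_n) (G : 'rV[R]_n -> 'M[R]_n) (K : set 'rV[R]_n).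
Hypotheses (oU : open U) (mG : metric_on U G) (cK : compact K) (KU : K `<=` U).

Local Notation idx := ('rV[R]_n * ('rV[R]_n -> 'M[R]_n))%type.
Local Notation functional := (('rV[R]_n -> 'M[R]_n) -> 'rV[R]_n -> R).

(** An index is a point together with a metric, so that one approximation is uniform over [K] and
    over all metrics close to [G]. *)
Definition metric_near (e : R) (i : idx) :=
  [/\ K i.1, metric_on U i.2 & forall a b, `|i.2 i.1 a b - G i.1 a b| <= e].

Definition metric_var (i : idx) : R :=
  \sum_c \sum_a \sum_b `|dmx c i.2 i.1 a b - dmx c G i.1 a b|.

Let near_le e e' i : e <= e' -> metric_near e i -> metric_near e' i.
Proof. by move=> ee' [? ? h]; split=> // a b; exact: le_trans (h a b) ee'. Qed.

Let var_ge0 i : 0 <= metric_var i.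
Proof. by do 3 (apply: sumr_ge0 => ? _). Qed.

Local Notation close d u v := (approx_deg metric_near metric_var d u v).

Let within_K f : Ck 0 U f -> {within K, continuous f}.
Proof.
move=> Cf; apply: continuous_subspaceW KU _; rewrite continuous_open_subspace//.
by move=> x /[!inE]; exact: Ck_continuous Cf.
Qed.

Let bounded_K f : Ck 0 U f -> exists C, forall i, metric_near 1 i -> `|f i.1| <= C.
Proof.
by move=> /within_K /(compact_bound cK)[C _ CP]; exists C => i [Ki _ _]; exact: CP.
Qed.

Let lower_K f : Ck 1 U f -> (forall x, U x -> 0 < f x) ->
  exists2 c, 0 < c & forall i, metric_near 1 i -> c <= f i.1.
Proof.
move=> Cf f0; have C1V : Ck 1 U (fun x => (f x)^-1).
  by apply: C1_inv => // x /f0; rewrite lt0r => /andP[].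
have [C C0 CP] := compact_bound cK (within_K (Ck_pred C1V)).
exists (C + 1)^-1 => [|i [Ki _ _]]; first by rewrite invr_gt0 ltr_wpDl.
have fi := f0 _ (KU Ki); rewrite -[leRHS]invrK lef_pV2 ?posrE ?invr_gt0// ?ltr_wpDl//.
by apply: le_trans (ler_norm _) _; apply: le_trans (CP _ Ki) _; rewrite lerDl.
Qed.

Let close_cst d f : Ck 0 U f -> close d (fun i => f i.1) (fun i => f i.1).
Proof.
move=> /bounded_K[C CP]; apply: (approx_le var_ge0 (leq0n d)).
exact: (approx_refl metric_var CP).
Qed.

(* Closed under sums, products, inverses and square roots, hence satisfied by
   the entries of [invmx H] and by [sqrt (det H)]. *)
Definition stable (f : functional) :=
  [/\ forall H, metric_on U H -> Ck 1 U (f H),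
      close 0 (fun i => f i.2 i.1) (fun i => f G i.1) &
      forall a, close 1 (fun i => pderive a (f i.2) i.1) (fun i => pderive a (f G) i.1)].

Lemma stable_ext f g : (forall H, metric_on U H -> forall x, U x -> f H x = g H x) ->
  stable f -> stable g.
Proof.
move=> fg [Cf f0 f1]; split.
- by move=> H mH; apply: Ck_ext (Cf H mH) => // y Uy; rewrite fg.
- by apply: (approx_ext near_le _ _ f0) => i [Ki mi _]; apply: fg => //; exact: KU.
- move=> a; apply: (approx_ext near_le _ _ (f1 a)) => i [Ki mi _];
    by apply: (pderive_ext _ oU (KU Ki)) => y; exact: fg.
Qed.

Lemma stable_cst phi : Ck 1 U phi -> stable (fun=> phi).
Proof.
move=> Cphi; split=> //; first by apply: close_cst; exact: Ck_pred.
by move=> a; apply: close_cst; exact: Ck_pderive.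
Qed.

Let dmx_entry (H : 'rV[R]_n -> 'M[R]_n) a b c x : pderive c (fun y => H y a b) x = dmx c H x a b.
Proof. by rewrite dmxE. Qed.

(** The source of the degrees: an entry differs by at most [e], and a first derivative by one of the
    summands of [metric_var]. *)
Lemma stable_entry a b : stable (fun H x => H x a b).
Proof.
have CG : Ck 2 U (fun x => G x a b) by exact: mG.1.
split.
- by move=> H [CH _]; exact/Ck_pred/CH.
- split; first by apply: (bounded_K (f := fun x => G x a b)); exact/Ck_pred/Ck_pred.
  move=> d d0; exists (Num.min d 1), 0; split; first by rewrite lt_min d0 ltr01 ge_min lexx orbT.
  split=> // i [_ _ h]; rewrite mul0r addr0; apply: le_trans (h a b) _.
  by rewrite ge_min lexx.
- move=> c; split.
    by apply: (bounded_K (f := pderive c (fun x => G x a b))); exact/Ck_pred/Ck_pderive.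
  move=> d d0; exists 1, 1; split; first by rewrite ltr01 lexx.
  split=> // i _; rewrite expr1 mul1r addrAC subrr add0r !dmx_entry.
  apply: ler_wpDl; first exact: ltW.
  rewrite /metric_var (bigD1 c)//= (bigD1 a)//= (bigD1 b)//= -!addrA lerDl.
  by rewrite !addr_ge0// ?sumr_ge0// => *; rewrite ?sumr_ge0// => *; rewrite sumr_ge0.
Qed.

Let stable_at f x a : stable f -> U x -> forall H, metric_on U H -> derivable (f H) x (delta_mx 0 a).
Proof. by move=> [Cf _ _] Ux H /Cf Ch; exact: Ck_derivable Ch Ux. Qed.

Lemma stableD f g : stable f -> stable g -> stable (fun H x => f H x + g H x).
Proof.
move=> sf sg; have [Cf f0 f1] := sf; have [Cg g0 g1] := sg; split.
- by move=> H mH; apply: Ck_add; [|exact: Cf|exact: Cg].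
- exact: (approxD near_le).
- move=> a; apply: (approx_ext near_le _ _ (approxD near_le (f1 a) (g1 a))) => i [Ki mi _];
  by rewrite pderiveD//; apply: stable_at => //; exact: KU.
Qed.

Lemma stableM f g : stable f -> stable g -> stable (fun H x => f H x * g H x).
Proof.
move=> sf sg; have [Cf f0 f1] := sf; have [Cg g0 g1] := sg; split.
- by move=> H mH; apply: Ck_mul; [|exact: Cf|exact: Cg].
- exact: (approxM near_le var_ge0 f0 g0).
- move=> a.
  have := approxD near_le (approxM near_le var_ge0 (f1 a) g0) (approxM near_le var_ge0 f0 (g1 a)).
  by apply: (approx_ext near_le) => i [Ki mi _]; rewrite pderiveM//; apply: stable_at => //; exact: KU.
Qed.

Lemma stable_sum (J : Type) (r : seq J) (P : pred J) (f : J -> functional) :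
  (forall j, stable (f j)) -> stable (fun H x => \sum_(j <- r | P j) f j H x).
Proof.
move=> sf; elim: r => [|j r IH].
  by apply: (stable_ext (f := fun _ _ => 0)) => [H _ x _|]; [rewrite big_nil|apply: stable_cst; exact: Ck_cst].
apply: (stable_ext (f := fun H x => (if P j then f j H x else 0) + \sum_(j <- r | P j) f j H x)).
  by move=> H _ x _; rewrite big_cons; case: (P j); rewrite ?add0r.
apply: stableD => //; case: (P j) => //.
by apply: stable_cst; exact: Ck_cst.
Qed.

Lemma stable_prod (J : Type) (r : seq J) (P : pred J) (f : J -> functional) :
  (forall j, stable (f j)) -> stable (fun H x => \prod_(j <- r | P j) f j H x).
Proof.
move=> sf; elim: r => [|j r IH].
  by apply: (stable_ext (f := fun _ _ => 1)) => [H _ x _|]; [rewrite big_nil|apply: stable_cst; exact: Ck_cst].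
apply: (stable_ext (f := fun H x => (if P j then f j H x else 1) * \prod_(j <- r | P j) f j H x)).
  by move=> H _ x _; rewrite big_cons; case: (P j); rewrite ?mul1r.
apply: stableM => //; case: (P j) => //.
by apply: stable_cst; exact: Ck_cst.
Qed.

Lemma stable_inv f : stable f -> (forall H, metric_on U H -> forall x, U x -> 0 < f H x) ->
  stable (fun H x => (f H x)^-1).
Proof.
move=> sf f_gt0; have [Cf f0 f1] := sf.
have CV H : metric_on U H -> Ck 1 U (fun x => (f H x)^-1).
  by move=> mH; apply: C1_inv => // [|x Ux]; [exact: Cf|rewrite gt_eqF// f_gt0].
have [c c0 cP] := lower_K (Cf _ mG) (f_gt0 _ mG).
have V0 := approx_inv near_le c0 cP f0.
split=> // a.
have := approxN near_le var_ge0 (approxM near_le var_ge0 (approxM near_le var_ge0 V0 V0) (f1 a)).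
have dV H x : metric_on U H -> U x ->
    - ((f H x)^-1 * (f H x)^-1 * pderive a (f H) x) = pderive a (fun y => (f H y)^-1) x.
  move=> mH Ux; apply/esym.
  have fx0 : f H x != 0 by rewrite gt_eqF// f_gt0.
  have dv : derivable (f H) x (delta_mx 0 a) by exact: Ck_derivable (Cf H mH) Ux.
  apply: etrans (deriveV fx0 dv) _.
  by rewrite expr2 invfM scaleNr.
by apply: (approx_ext near_le) => i [Ki mi _]; apply: dV => //; exact: KU.
Qed.

Lemma stable_sqrt f : stable f -> (forall H, metric_on U H -> forall x, U x -> 0 < f H x) ->
  stable (fun H x => Num.sqrt (f H x)).
Proof.
move=> sf f_gt0; have [Cf f0 f1] := sf.
have CS H : metric_on U H -> _ := fun mH => C1_sqrt oU (Cf H mH) (f_gt0 H mH).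
have S_gt0 H : metric_on U H -> forall x, U x -> 0 < 2 * Num.sqrt (f H x).
  by move=> mH x Ux; rewrite mulr_gt0// sqrtr_gt0 f_gt0.
have [c c0 cP] := lower_K (Cf _ mG) (f_gt0 _ mG).
have S0 : close 0 (fun i => Num.sqrt (f i.2 i.1)) (fun i => Num.sqrt (f G i.1)).
  apply: (approx_sqrt near_le c0 cP) => //.
  by move=> i [Ki mi _]; rewrite ltW// f_gt0//; exact: KU.
split=> [H /CS[]//| //|a].
have C2 : Ck 1 U (fun x => 2 * Num.sqrt (f G x)).
  by apply: Ck_mul => //; [exact: Ck_cst|exact: (CS _ mG).1].
have [c' c'0 c'P] := lower_K C2 (S_gt0 _ mG).
have T0 : close 0 (fun i => 2 * Num.sqrt (f i.2 i.1)) (fun i => 2 * Num.sqrt (f G i.1)).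
  by apply: (approxM near_le var_ge0 (d := 0)) S0; apply: (close_cst 0 (f := fun=> 2)); exact: Ck_cst.
have := approxM near_le var_ge0 (approx_inv near_le c'0 c'P T0) (f1 a).
by apply: (approx_ext near_le) => i [Ki mi _]; rewrite (CS _ _).2//; exact: KU.
Qed.

(** Stated for a matrix of functionals because the cofactors in [stable_invmx] are determinants of
    minors. *)
Lemma stable_det m (F : 'I_m -> 'I_m -> functional) : (forall k l, stable (F k l)) ->
  stable (fun H x => \det (\matrix_(k, l) F k l H x)).
Proof.
move=> sF.
apply: (stable_ext (f := fun H x => \sum_(s : {perm 'I_m}) (-1) ^+ s * \prod_k F k (s k) H x)).
  by move=> H _ x _; apply: eq_bigr => s _; congr (_ * _); apply: eq_bigr => k _; rewrite mxE.
apply: stable_sum => s; apply: stableM; first by apply: stable_cst; exact: Ck_cst.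
exact: stable_prod.
Qed.

Let stable_det_metric : stable (fun H x => \det (H x)).
Proof.
apply: stable_ext (stable_det stable_entry) => H _ x _.
by congr (\det _); apply/matrixP => a b; rewrite mxE.
Qed.

Let det_gt0 H : metric_on U H -> forall x, U x -> 0 < \det (H x).
Proof. by move=> [_ pH] x /pH; exact: posdef_det. Qed.

Lemma stable_invmx a b : stable (fun H x => invmx (H x) a b).
Proof.
apply: (stable_ext (f := fun H x => (\det (H x))^-1 * ((-1) ^+ (b + a) *
   \det (\matrix_(k, l) H x (lift b k) (lift a l))))).
  move=> H mH x Ux; rewrite /invmx (metric_unit mH Ux) !mxE; congr (_ * (_ * \det _)).
  by apply/matrixP => k l; rewrite !mxE.
apply: stableM; first exact: stable_inv.
apply: stableM; first by apply: stable_cst; exact: Ck_cst.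
by apply: (stable_det (F := fun k l H x => H x (lift b k) (lift a l))) => k l; exact: stable_entry.
Qed.

Lemma stable_density phi a b : Ck 1 U phi -> stable (fun H x => density H phi x a b).
Proof.
move=> Cphi; apply: (stable_ext (f := fun H x => phi x * Num.sqrt (\det (H x)) * invmx (H x) a b)).
  by move=> H _ x _; rewrite mxE.
apply: stableM; last exact: stable_invmx.
by apply: stableM; [exact: stable_cst|exact: stable_sqrt].
Qed.

Definition mclose d p q (A B : idx -> 'M[R]_(p, q)) :=
  forall a b, close d (fun i => A i a b) (fun i => B i a b).

Let mclose_mul d d' p q r (A B : idx -> 'M[R]_(p, q)) (C D : idx -> 'M[R]_(q, r)) :
  mclose d A B -> mclose d' C D ->
  mclose (d + d') (fun i => A i *m C i) (fun i => B i *m D i).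
Proof.
move=> AB CD a b.
have := approx_sum near_le var_ge0 (index_enum 'I_q) xpredT
  (fun k => approxM near_le var_ge0 (AB a k) (CD k b)).
by apply: (approx_ext near_le) => i _; rewrite mxE.
Qed.

Let mclose_sub d p q (A B C D : idx -> 'M[R]_(p, q)) :
  mclose d A B -> mclose d C D -> mclose d (fun i => A i - C i) (fun i => B i - D i).
Proof.
move=> AB CD a b.
have := approxD near_le (AB a b) (approxN near_le var_ge0 (CD a b)).
by apply: (approx_ext near_le) => i _; rewrite !mxE.
Qed.

Let close_dmx a b c : close 1 (fun i => dmx a i.2 i.1 b c) (fun i => dmx a G i.1 b c).
Proof. by have [_ _ /(_ a)] := stable_entry b c; apply: (approx_ext near_le) => i _; rewrite dmxE. Qed.

Lemma close_conn a : mclose 1 (fun i => conn i.2 a i.1) (fun i => conn G a i.1).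
Proof.
move=> b d.
have [_ I0 _] := stable_invmx d b.
have T c := approxM near_le var_ge0 (let: And3 _ I0 _ := stable_invmx d c in I0)
  (approxD near_le (approxD near_le (close_dmx a c b) (close_dmx b c a))
     (approxN near_le var_ge0 (close_dmx c a b))).
have := approxM near_le var_ge0 (close_cst 0 (Ck_cst 0 U 2^-1))
  (approx_sum near_le var_ge0 (index_enum 'I_n) xpredT T).
by apply: (approx_ext near_le) => i _; rewrite connE christoffelE.
Qed.

(** Degree count: the density has degree 0, its derivatives and the connection degree 1, so all
    products have degree 2, the highest that L^2 control of first derivatives permits. *)
Lemma close_weak_scalar phi : Ck 1 U phi ->
  close 2 (fun i => weak_scalar i.2 phi i.1) (fun i => weak_scalar G phi i.1).
Proof.
move=> Cphi.
have N0 : mclose 0 (fun i => density i.2 phi i.1) (fun i => density G phi i.1).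
  by move=> a b; have [_] := stable_density a b Cphi.
have N1 c : mclose 1 (fun i => dmx c (density i.2 phi) i.1) (fun i => dmx c (density G phi) i.1).
  move=> a b; have [_ _ /(_ c)] := stable_density a b Cphi.
  by apply: (approx_ext near_le) => i _; rewrite dmxE.
do 2 (apply: (approx_sum near_le var_ge0) => ?).
apply: mclose_sub.
  apply: (mclose_mul (d := 0) (d' := 2)) => //; apply: mclose_sub;
    by apply: (mclose_mul (d := 1) (d' := 1)); exact: close_conn.
by apply: mclose_sub; apply: (mclose_mul (d := 1) (d' := 1)) => //; exact: close_conn.
Qed.

End metric_perturbation.

Lemma nabla_ext (R : realType) n (U : set 'rV[R]_n) (G S S' : 'rV[R]_n -> 'M[R]_n) c x :
  open U -> U x -> (forall y, U y -> S y = S' y) -> nabla G S c x = nabla G S' c x.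
Proof. by move=> oU Ux SS; rewrite !nablaE (dmx_ext c oU Ux SS) SS. Qed.

Section local_continuity.
Context {R : realType} {n : nat} (U : set 'rV[R]_n) (G : 'rV[R]_n -> 'M[R]_n).
Hypotheses (oU : open U) (mG : metric_on U G).

Lemma invmx_metric_C1 : mCk 1 U (fun x => invmx (G x)).
Proof. by apply: mCk_invmx; [|exact/mCk_pred/mG.1|move=> x; exact: metric_unit mG]. Qed.

Lemma scalar_local_C0 : Ck 0 U (scalar_local G).
Proof.
apply: (@Ck_ext _ _ 0 U _ (fun x => \sum_b \sum_a (invmx (G x) *m curv G a b x) b a)) => //.
  by move=> x _; rewrite scalar_localE.
do 2 (apply: Ck_sum => // ?).
suff : forall a b, mCk 0 U (fun x => invmx (G x) *m curv G a b x) by apply.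
move=> a b; apply: mCk_mul => //; first exact: mCk_pred invmx_metric_C1.
have C1c c := conn_C1 c oU mG; have C0c c := mCk_pred (C1c c).
have CN F : @mCk R n n n 0 U F -> mCk 0 U (fun x => - F x).
  move=> CF i j; apply: (@Ck_ext _ _ 0 U _ (fun x => - F x i j)) => //; last exact: Ck_opp (CF i j).
  by move=> x _; rewrite mxE.
apply: mCk_add => //; apply: mCk_add => //.
- exact: mCk_dmx.
- by apply: CN; exact: mCk_dmx.
- exact: mCk_mul.
- by apply: CN; exact: mCk_mul.
Qed.

Lemma nabla_C0 S c : mCk 1 U S -> mCk 0 U (nabla G S c).
Proof.
move=> CS a b; have C0S := mCk_pred CS; have C0c := mCk_pred (conn_C1 c oU mG).
apply: (@Ck_ext _ _ 0 U _ (fun x => dmx c S x a b - (conn G c x *m S x + S x *m (conn G c x)^T) a b)) => //.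
  by move=> x _; rewrite nablaE !mxE.
apply: Ck_add => //; first exact: (mCk_dmx c oU CS).
apply: Ck_opp => //.
suff : mCk 0 U (fun x => conn G c x *m S x + S x *m (conn G c x)^T) by apply.
by apply: mCk_add => //; apply: mCk_mul => //; exact: mCk_tr.
Qed.

Lemma inner3_C0 (S : 'I_n -> 'rV[R]_n -> 'M[R]_n) : (forall c, mCk 0 U (S c)) ->
  Ck 0 U (fun x => inner3 (G x) (S^~ x) (S^~ x)).
Proof.
move=> CS; have CI := mCk_pred invmx_metric_C1.
apply: Ck_sum => // c; apply: Ck_sum => // c'.
apply: (@Ck_mul _ _ 0 U (fun x => invmx (G x) c c') (fun x => inner2 (G x) (S c x) (S c' x)) oU).
  exact: (CI c c').
apply: (@Ck_sum _ _ 0 U _ _ _ (fun a x => (invmx (G x) *m S c x *m invmx (G x) *m (S c' x)^T) a a)) => // a.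
have CP : mCk 0 U (fun x => invmx (G x) *m S c x *m invmx (G x) *m (S c' x)^T).
  apply: mCk_mul => //; last exact: mCk_tr.
  by apply: mCk_mul => //; exact: mCk_mul.
exact: (CP a a).
Qed.

End local_continuity.

(** * Independence of curvature and norms from the chart *)

Section chart_independence.
Context {R : realType} {n : nat} {M : closed_manifold R n} (g h : riem_metric M).
Implicit Types i j : cindex M.
Local Notation trans i j := (transition (charts i) (charts j)).
Local Notation diffc := (Defs.diff_comp g h).

Lemma scalar_local_overlap i j x : overlap i j x ->
  scalar_local (g i) x = scalar_local (g j) (change i j x).
Proof.
apply: (@scalar_local_change R n (overlap i j) (cimg (charts j)) (trans i j) (g i) (g j)).
- exact: open_overlap.
- exact: cimg_openT.
- by move=> b; exact: transition_Ck.
- exact: overlap_change.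
- exact: metric_on_overlap.
- exact: riem_metric_on.
- exact: metric_overlap.
Qed.

(** The choice made by [chart_at] varies without continuity from point to point; continuity and
    integration require a fixed chart [j]. *)
Lemma scalar_curvature_chart j p : cdom (charts j) p ->
  scalar_curvature g p = scalar_local (g j) (cmap (charts j) p).
Proof.
move=> jp; have cp := chart_atP p; rewrite -(change_cmap j cp).
by apply: scalar_local_overlap; exists p.
Qed.

Lemma diff_comp_C2 i : mCk 2 (cimg (charts i)) (diffc i).
Proof.
move=> a b; have oi := @cimg_openT _ _ _ (charts i).
apply: (@Ck_ext _ _ 2 _ _ (fun x => h i x a b + - g i x a b)) => //.
  by move=> x _; rewrite /Defs.diff_comp !mxE.
by apply: Ck_add => //; [exact: (comp_C2 h)|apply: Ck_opp => //; exact: (comp_C2 g)].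
Qed.

Lemma diff_comp_overlap i j x : overlap i j x -> diffc i x =
  jac (trans i j) x *m diffc j (change i j x) *m (jac (trans i j) x)^T.
Proof.
by move=> ijx; rewrite /Defs.diff_comp mulmxBr mulmxBl -!metric_overlap.
Qed.

Lemma diff_norm_chart j p : cdom (charts j) p ->
  diff_norm g h p = Num.sqrt (inner2 (g j (cmap (charts j) p))
    (diffc j (cmap (charts j) p)) (diffc j (cmap (charts j) p))).
Proof.
move=> jp; have cp := chart_atP p; rewrite /diff_norm /coord.
have ijx : overlap (chart_at p) j (cmap (charts (chart_at p)) p) by exists p.
rewrite (metric_overlap g ijx) (diff_comp_overlap ijx) change_cmap// inner2_congr//.
  exact: (@jac_trans_unit _ _ _ g _ _ _ ijx).
by apply: (metric_unit (riem_metric_on g j)); exact: cmap_img.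
Qed.

Lemma nabla_overlap i j x c : overlap i j x ->
  nabla (g i) (diffc i) c x =
  jac (trans i j) x *m (\sum_d jac (trans i j) x c d *:
    nabla (g j) (diffc j) d (change i j x)) *m (jac (trans i j) x)^T.
Proof.
move=> ijx; have oO := @open_overlap _ _ _ i j.
rewrite (nabla_ext _ _ oO ijx (@diff_comp_overlap i j)).
apply: (nabla_change (W := overlap i j) (V := cimg (charts j)) (T := trans i j)) => //.
- exact: cimg_openT.
- by move=> b; exact: transition_Ck.
- exact: overlap_change.
- exact: metric_on_overlap.
- exact: riem_metric_on.
- exact: metric_overlap.
- exact/mCk_pred/diff_comp_C2.
Qed.

Definition nabla_diff j c x := nabla (g j) (diffc j) c x.

Lemma nabla_diff_norm_chart j p : cdom (charts j) p ->
  nabla_diff_norm g h p = Num.sqrt (inner3 (g j (cmap (charts j) p))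
    ((nabla_diff j)^~ (cmap (charts j) p)) ((nabla_diff j)^~ (cmap (charts j) p))).
Proof.
move=> jp; have cp := chart_atP p; rewrite /nabla_diff_norm /coord; congr Num.sqrt.
have ijx : overlap (chart_at p) j (cmap (charts (chart_at p)) p) by exists p.
have E : (fun c => nabla (g (chart_at p)) (diffc (chart_at p)) c
    (cmap (charts (chart_at p)) p)) = _ := funext (fun c => nabla_overlap c ijx).
rewrite E (metric_overlap g ijx) change_cmap// inner3_congr//.
  exact: (@jac_trans_unit _ _ _ g _ _ _ ijx).
by apply: (metric_unit (riem_metric_on g j)); exact: cmap_img.
Qed.

Lemma nabla_diff_norm_sqr j p : cdom (charts j) p ->
  nabla_diff_norm g h p ^+ 2 = inner3 (g j (cmap (charts j) p))
    ((nabla_diff j)^~ (cmap (charts j) p)) ((nabla_diff j)^~ (cmap (charts j) p)).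
Proof.
move=> jp; rewrite (nabla_diff_norm_chart jp) sqr_sqrtr//.
by apply: (frob2_inner3 _ _).1; apply: (riem_metric_on g j).2; exact: cmap_img.
Qed.

Lemma scalar_curvature_continuous : continuous (scalar_curvature g : M -> R).
Proof.
apply: chartwise_continuous => i; have oi := @cimg_openT _ _ _ (charts i).
apply: (Ck_ext oi) (scalar_local_C0 oi (riem_metric_on g i)) => x ix.
by rewrite /= (scalar_curvature_chart (cinv_dom ix)) cinvK.
Qed.

Lemma nabla_diff_norm_sqr_continuous :
  continuous ((fun p => nabla_diff_norm g h p ^+ 2) : M -> R).
Proof.
apply: chartwise_continuous => i; have oi := @cimg_openT _ _ _ (charts i).
apply: (Ck_ext oi) (inner3_C0 oi (riem_metric_on g i) (S := nabla_diff i) _).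
  by move=> x ix; rewrite /= (nabla_diff_norm_sqr (cinv_dom ix)) cinvK.
move=> c; have := nabla_C0 oi (riem_metric_on g i) c (mCk_pred (diff_comp_C2 i)).
by apply.
Qed.

End chart_independence.

(** * Bounds on a compact subset of a chart *)

Section local_bounds.
Context {R : realType} {n : nat} {M : closed_manifold R n} (g : riem_metric M).
Context (i : cindex M) (K : set 'rV[R]_n).
Hypotheses (cK : compact K) (KU : K `<=` cimg (charts i)).
Local Notation diffc h := (Defs.diff_comp g h i).

Let oi : open (cimg (charts i)). Proof. exact: cimg_openT. Qed.

Lemma bounded_on_compact (I : finType) (F : I -> 'rV[R]_n -> R) :
  (forall j, Ck 0 (cimg (charts i)) (F j)) ->
  exists2 C : R, 0 <= C & forall j x, K x -> `|F j x| <= C.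
Proof.
move=> CF; have /choice[C CP] : forall j, exists C : R, 0 <= C /\ forall x, K x -> `|F j x| <= C.
  move=> j; have [|C C0 CP] := compact_bound cK (f := F j); last by exists C.
  apply: continuous_subspaceW KU _; rewrite continuous_open_subspace//.
  by move=> x /[!inE]; exact: Ck_continuous (CF j).
exists (\sum_j C j); first by apply: sumr_ge0 => j _; have [] := CP j.
move=> j x Kx; have [_ /(_ x Kx)/le_trans] := CP j; apply.
by rewrite (bigD1 j)//= lerDl sumr_ge0// => k _; have [] := CP k.
Qed.

Let entry_C0 a b : Ck 0 (cimg (charts i)) (fun x => g i x a b).
Proof. exact/Ck_pred/Ck_pred/comp_C2. Qed.

Lemma trace_bound : exists2 A : R, 0 <= A & forall x, K x -> `|\tr (g i x)| <= A.
Proof.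
have [|A A0 AP] := @bounded_on_compact unit (fun _ x => \tr (g i x)).
  by move=> _; apply: (@Ck_sum _ _ 0 _ _ _ _ (fun a x => g i x a a)).
by exists A => // x; exact: AP tt x.
Qed.

(** [A] bounds the trace of [g] on [K], the constant in [frob2_inner2], and is therefore the same
    for all [h]. *)
Lemma diff_entry_bound : exists2 A : R, 0 <= A & forall h x a b, K x ->
  `|diffc h x a b| <= A * diff_norm g h (cinv (charts i) x).
Proof.
have [A A0 AP] := trace_bound; exists A => // h x a b Kx.
have ix := KU Kx.
rewrite (diff_norm_chart _ _ (cinv_dom ix)) cinvK//.
have [I0 IP] := frob2_inner2 (diffc h x) ((riem_metric_on g i).2 _ ix).
rewrite -ler_sqr ?nnegrE ?mulr_ge0 ?sqrtr_ge0// real_normK ?num_real// exprMn sqr_sqrtr//.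
apply: le_trans (entry_frob2 _ a b) _; apply: le_trans IP _.
rewrite ler_wpM2r// -real_normK ?num_real// ler_sqr ?nnegrE//.
exact: AP.
Qed.

(** Partial derivatives of [h - g] are its covariant derivatives plus products of the connection of
    [g] with its entries, and the connection is bounded on [K]. *)
Lemma metric_var_bound : exists2 B : R, 0 <= B & forall h x (e : R), K x -> 0 <= e ->
  (forall a b, `|diffc h x a b| <= e) ->
  metric_var (g i) (x, h i : 'rV[R]_n -> 'M[R]_n)
    <= B * (nabla_diff_norm g h (cinv (charts i) x) + e).
Proof.
have [A A0 AP] := trace_bound.
have [|C C0 CP] := @bounded_on_compact ('I_n * 'I_n * 'I_n)%type
    (fun k x => conn (g i) k.1.1 x k.1.2 k.2).
  move=> [[c a] b]; exact: (mCk_pred (conn_C1 c oi (riem_metric_on g i))).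
(* The square of [T] dominates [A ^+ 3], which bounds the constant in [frob2_inner3], so [T] serves
   as a bound for its square root. *)
pose T := 1 + A ^+ 3; have T0 : 0 <= T by rewrite addr_ge0// exprn_ge0.
pose D := T + n%:R * C + n%:R * C.
have D0 : 0 <= D by rewrite !addr_ge0 ?mulr_ge0.
exists (\sum_(c < n) \sum_(a < n) \sum_(b < n) D).
  by do 3 (apply: sumr_ge0 => ? _).
move=> h x e Kx e0 He; have ix := KU Kx.
set N := nabla_diff_norm _ _ _.
have N0 : 0 <= N by rewrite /N /nabla_diff_norm sqrtr_ge0.
have NE := nabla_diff_norm_sqr g h (cinv_dom ix); rewrite cinvK// -/N in NE.
have nabla_le c a b : `|nabla (g i) (Defs.diff_comp g h i) c x a b| <= T * N.
  rewrite -ler_sqr ?nnegrE ?mulr_ge0// real_normK ?num_real// exprMn NE.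
  have [I0 IP] := frob2_inner3 (fun c => nabla_diff g h i c x) ((riem_metric_on g i).2 _ ix).
  apply: le_trans (entry_frob2 _ a b) _.
  apply: (@le_trans _ _ (\sum_c frob2 (nabla_diff g h i c x))).
    by rewrite (bigD1 c)//= lerDl sumr_ge0// => k _; exact: frob2_ge0.
  apply: le_trans IP _; apply: ler_wpM2r => //.
  apply: le_trans (ler_norm _) _; rewrite normrX.
  apply: (@le_trans _ _ (A ^+ 3)); first by apply: lerXn2r; rewrite ?nnegrE//; exact: AP.
  have A3 : 0 <= A ^+ 3 by rewrite exprn_ge0.
  by rewrite /T sqrrD expr1n mul1r mulr2n !addrA ler_wpDr ?sqr_ge0// lerDr addr_ge0.
rewrite /metric_var mulr_suml; apply: ler_sum => c _.
rewrite mulr_suml; apply: ler_sum => a _; rewrite mulr_suml; apply: ler_sum => b _.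
have -> : dmx c (h i) x a b - dmx c (g i) x a b = dmx c (Defs.diff_comp g h i) x a b.
  rewrite !dmxE -pderiveN; last exact: Ck_derivable (comp_C2 g i a b) ix.
  rewrite -pderiveD; first last.
  - have := Ck_opp oi (comp_C2 g i a b); move/Ck_derivable; apply => //.
  - exact: Ck_derivable (comp_C2 h i a b) ix.
  by congr (pderive c _ x); apply/funext => y; rewrite /Defs.diff_comp !mxE.
have -> : dmx c (Defs.diff_comp g h i) x a b = nabla (g i) (Defs.diff_comp g h i) c x a b
    + (conn (g i) c x *m diffc h x) a b + (diffc h x *m (conn (g i) c x)^T) a b.
  have /matrixP/(_ a b) -> : dmx c (Defs.diff_comp g h i) x = nabla (g i) (Defs.diff_comp g h i) c x
      + (conn (g i) c x *m diffc h x + diffc h x *m (conn (g i) c x)^T) by rewrite nablaE subrK.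
  by rewrite mxE [X in _ + X = _]mxE addrA.
have prod_le (P Q : 'M[R]_n) : (forall a b, `|P a b| <= C) -> (forall a b, `|Q a b| <= e) ->
    `|(P *m Q) a b| <= n%:R * C * e /\ `|(Q *m P^T) a b| <= n%:R * C * e.
  move=> PC Qe; rewrite -mulrA -[n in n%:R]card_ord -sum1_card natr_sum mulr_suml.
  split; rewrite mxE; apply: le_trans (ler_norm_sum _ _ _) _; apply: ler_sum => k _;
    rewrite mul1r normrM; first by apply: ler_pM.
  by rewrite mulrC; apply: ler_pM => //; rewrite mxE.
have [h1 h2] := prod_le (conn (g i) c x) (diffc h x) (fun a b => CP (c, a, b) x Kx) He.
apply: le_trans (ler_normD _ _) _; apply: le_trans (lerD (ler_normD _ _) (lexx _)) _.
apply: le_trans (lerD (lerD (nabla_le c a b) h1) h2) _.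
rewrite /D; have : 0 <= n%:R * C :> R by rewrite mulr_ge0.
move: T0 e0 N0; generalize (n%:R * C : R) => z; clear => T0 e0 N0 z0.
have : 0 <= T * e by rewrite mulr_ge0.
have : 0 <= z * N by rewrite mulr_ge0.
by rewrite !mulrDl !mulrDr; lra.
Qed.

End local_bounds.

(** * Estimates for one weight of the partition *)

Section patch.
Context {R : realType} {n : nat} {M : closed_manifold R n} (g : riem_metric M).
Context (i : cindex M) (K : set 'rV[R]_n) (phi : 'rV[R]_n -> R).
Hypotheses (cK : compact K) (KU : K `<=` cimg (charts i)).
Hypotheses (Cphi : Ck 1 setT phi) (phi0 : forall x, ~ K x -> phi x = 0).
Local Notation lam := (@lebesgue_rV R n).

Let oi : open (cimg (charts i)). Proof. exact: cimg_openT. Qed.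
Let mU : measurable (cimg (charts i) : set (borel 'rV[R]_n)).
Proof. exact: open_borel_measurable. Qed.

Lemma measurable_compact_rV : measurable (K : set (borel 'rV[R]_n)).
Proof.
by rewrite -[K]setCK; apply: measurableC; apply: open_borel_measurable; exact: open_compl_compact.
Qed.

Lemma L2_norm_lt (f : M -> R) e : 0 < e -> (L2_norm g f < e%:E)%E ->
  (\int[volume g]_p (f p ^+ 2)%:E <= (e ^+ 2)%:E)%E.
Proof.
move=> e0; rewrite /L2_norm.
have : (0 <= \int[volume g]_p (f p ^+ 2)%:E)%E.
  by apply: integral_ge0 => p _; rewrite lee_fin sqr_ge0.
case: (\int[_]_p _)%E => [r| |]//; last by rewrite poweRyr// ?invr_neq0.
rewrite lee_fin => r0; rewrite poweR_EFin lte_fin lee_fin powR12_sqrt// => /ltW re.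
by rewrite -(sqr_sqrtr r0) ler_sqr ?nnegrE ?sqrtr_ge0// ltW.
Qed.

Lemma C0_dist_lt (h : riem_metric M) e p : (C0_dist g h < e%:E)%E -> diff_norm g h p <= e.
Proof.
move=> /ltW he; rewrite -lee_fin; apply: le_trans he.
by apply: ereal_sup_ubound; exists p.
Qed.

Lemma weak_scalar_integrable (h : riem_metric M) :
  lam.-integrable setT (EFin \o weak_scalar (h i) phi).
Proof.
apply: (C0_compact_integrable cK).
  exact: (weak_scalar_C0 oi (riem_metric_on h i) Cphi cK KU phi0).
by move=> x; exact: weak_scalar_out.
Qed.

(** [m] bounds the inverse of the density [sqdet g i] on [K], so the Lebesgue integral is at most
    [m] times the integral for the volume of [g]. *)
Lemma integral_nabla_le : exists2 m : R, 0 <= m & forall (h : riem_metric M) (e : R),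
  0 < e -> C0W12_ball g e h ->
  (\int[lam]_(x in K) (nabla_diff_norm g h (cinv (charts i) x) ^+ 2)%:E <= (m * e ^+ 2)%:E)%E.
Proof.
have mK := measurable_compact_rV.
have C1 := sqrt_det_C1 oi (riem_metric_on g i).
have Cinv : Ck 1 (cimg (charts i)) (fun x => (sqdet g i x)^-1).
  by apply: C1_inv => // x ix; rewrite gt_eqF// sqdet_gt0.
have [|m m0 mP] := compact_bound cK (f := fun x => (sqdet g i x)^-1).
  apply: continuous_subspaceW KU _; rewrite continuous_open_subspace//.
  by move=> x /[!inE]; exact: Ck_continuous Cinv.
exists m => // h e e0 [_ _ /(L2_norm_lt e0) he].
pose N2 p := nabla_diff_norm g h p ^+ 2.
have mN : measurable_fun setT (N2 : borel M -> measurableTypeR R).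
  by apply: continuous_borel_measurable_real; exact: nabla_diff_norm_sqr_continuous.
have mNi : measurable_fun (cimg (charts i) : set (borel _))
    (fun x : borel 'rV[R]_n => N2 (cinv (charts i) x) : R).
  exact: (measurableT_comp mN (@measurable_cinv _ _ _ (charts i))).
have mNs : measurable_fun (cimg (charts i) : set (borel _))
    (fun x : borel 'rV[R]_n => (N2 (cinv (charts i) x) * sqdet g i x)%:E).
  by apply/measurable_EFinP; apply: measurable_funM => //; exact: measurable_sqdet.
have N0 x : cimg (charts i) x -> (0 <= (N2 (cinv (charts i) x) * sqdet g i x)%:E)%E.
  by move=> ix; rewrite lee_fin mulr_ge0 ?sqr_ge0// ltW// sqdet_gt0.
apply: (@le_trans _ _ (\int[lam]_(x in K) (m%:E * (N2 (cinv (charts i) x) * sqdet g i x)%:E))%E).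
  apply: ge0_le_integral => //.
  - by move=> x _; rewrite lee_fin sqr_ge0.
  - by apply/measurable_EFinP; exact: measurable_funS mNi.
  - by apply: measurable_funeM; exact: measurable_funS mNs.
  - move=> x Kx; rewrite -EFinM lee_fin mulrCA -[leLHS]mulr1 ler_wpM2l ?sqr_ge0//.
    have s0 := sqdet_gt0 g (KU Kx); rewrite -ler_pdivrMr// mul1r.
    by apply: le_trans (ler_norm _) _; exact: mP.
rewrite ge0_integralZl//; last 2 first.
- exact: measurable_funS mNs.
- by move=> x /KU; exact: N0.
rewrite EFinM; apply: lee_wpmul2l; first by rewrite lee_fin.
apply: le_trans (ge0_subset_integral _ _ _ mNs N0 KU) _ => //.
rewrite -integral_volume_chart//; apply: le_trans he.
apply: ge0_subset_integral => //; first exact: measurable_dom.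
- by apply/measurable_EFinP.
- by move=> p _; rewrite lee_fin sqr_ge0.
Qed.

(** The radius [r] is separate from the threshold [e]: once [C] is known, [r] can be shrunk further
    to make [C * r ^+ 2] small. *)
Lemma weak_scalar_pointwise (delta : R) : 0 < delta ->
  exists e C, [/\ 0 < e, 0 <= C & forall (h : riem_metric M) r x, r <= e ->
    C0W12_ball g r h -> K x ->
    `|weak_scalar (h i) phi x - weak_scalar (g i) phi x| <=
      delta + C * r ^+ 2 + C * nabla_diff_norm g h (cinv (charts i) x) ^+ 2].
Proof.
move=> d0; have [A A0 AP] := diff_entry_bound g cK KU.
have [B B0 BP] := metric_var_bound g cK KU.
have CU : Ck 1 (cimg (charts i)) phi by apply: Ck_sub Cphi.
have [_ /(_ (delta / 2))] := close_weak_scalar oi (riem_metric_on g i) cK KU CU.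
move=> /(_ (divr_gt0 d0 (ltr0Sn _ _)))[e1 [C [/andP[e10 _] [C0 CP]]]].
(* Completing the square bounds the linear part [2 * C * w] of the error by
   [delta / 2 + 2 * C ^+ 2 / delta * w ^+ 2]; hence this coefficient of [w ^+ 2]. *)
pose C' := C + 2 * C ^+ 2 / delta.
have C'0 : 0 <= C' by rewrite addr_ge0// divr_ge0 ?mulr_ge0 ?sqr_ge0// ltW.
(* The square of [B * (N + A * r)] is at most [2 * B ^+ 2 * (N ^+ 2 + A ^+ 2 * r ^+ 2)]; the factor
   [1 + A ^+ 2] covers both coefficients. *)
pose D := C' * (2 * B ^+ 2 * (1 + A ^+ 2)).
have D0 : 0 <= D by rewrite mulr_ge0// mulr_ge0 ?addr_ge0 ?sqr_ge0// mulr_ge0 ?sqr_ge0.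
exists (e1 / (A + 1)), D; split => // [|h r x re hr Kx].
  by rewrite divr_gt0// ltr_wpDl.
have dn := C0_dist_lt (cinv (charts i) x) (let: And3 a _ _ := hr in a).
have dn0 : 0 <= diff_norm g h (cinv (charts i) x) by rewrite sqrtr_ge0.
have r0 : 0 <= r by exact: le_trans dn.
have Ar a b : `|Defs.diff_comp g h i x a b| <= A * r.
  by apply: le_trans (AP h x a b Kx) _; rewrite ler_wpM2l.
have Are : A * r <= e1.
  rewrite (le_trans (ler_wpM2l A0 re))// mulrCA -[leRHS]mulr1 ler_wpM2l ?(ltW e10)//.
  by rewrite ler_pdivrMr ?mul1r ?lerDl// ltr_wpDl.
have near : metric_near (cimg (charts i)) (g i) K e1 (x, h i : 'rV[R]_n -> 'M[R]_n).
  split=> //; first exact: riem_metric_on.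
  by move=> a b; apply: le_trans Are; have := Ar a b; rewrite /Defs.diff_comp !mxE.
have := CP _ near; have := BP h x (A * r) Kx (mulr_ge0 A0 r0) Ar.
set w := metric_var _ _; set N := nabla_diff_norm _ _ _; set u := `|_ - _| => wB uC.
have w0 : 0 <= w by do 3 (apply: sumr_ge0 => ? _).
have N0 : 0 <= N by rewrite sqrtr_ge0.
have Cw : C * ((1 + w) ^+ 2 - 1) <= delta / 2 + C' * w ^+ 2.
  have : 0 <= (delta - 2 * C * w) ^+ 2 / (2 * delta) by rewrite divr_ge0 ?sqr_ge0// mulr_ge0// ltW.
  suff -> : (delta - 2 * C * w) ^+ 2 / (2 * delta) =
      delta / 2 + C' * w ^+ 2 - C * ((1 + w) ^+ 2 - 1) by rewrite subr_ge0.
  by rewrite /C'; field; rewrite gt_eqF.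
have w2 : w ^+ 2 <= 2 * B ^+ 2 * (N ^+ 2 + A ^+ 2 * r ^+ 2).
  apply: (@le_trans _ _ ((B * (N + A * r)) ^+ 2)).
    by rewrite ler_sqr ?nnegrE ?mulr_ge0 ?addr_ge0 ?mulr_ge0.
  rewrite -subr_ge0 (_ : _ - _ = B ^+ 2 * (N - A * r) ^+ 2).
    by rewrite mulr_ge0 ?sqr_ge0.
  by clear; ring.
apply: le_trans uC _; apply: le_trans (lerD (lexx _) Cw) _.
rewrite addrA -splitr -addrA lerD2l -mulrDr; apply: le_trans (ler_wpM2l C'0 w2) _.
rewrite -subr_ge0 (_ : _ - _ = C' * (2 * B ^+ 2) * (r ^+ 2 + A ^+ 2 * N ^+ 2)).
  apply: mulr_ge0; first by rewrite mulr_ge0// mulr_ge0 ?sqr_ge0.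
  by rewrite addr_ge0 ?mulr_ge0 ?sqr_ge0.
by rewrite /D; clear; ring.
Qed.

Lemma weak_scalar_near (delta : R) : 0 < delta -> exists2 e : R, 0 < e &
  forall h, C0W12_ball g e h ->
  (`|\int[lam]_(x in setT) (weak_scalar (h i) phi x)%:E -
     \int[lam]_(x in setT) (weak_scalar (g i) phi x)%:E| <= delta%:E)%E.
Proof.
move=> d0; have mK := measurable_compact_rV.
have lamKoo := lebesgue_rV_compact_lty cK.
have lamK0 : (0 <= lam K)%E by exact: measure_ge0.
have lamKf : lam K \is a fin_num by rewrite ge0_fin_numE.
pose L := fine (lam K); have L0 : 0 <= L by exact: fine_ge0.
have L1 : 0 < L + 1 by rewrite ltr_wpDl.
(* The constant part [d1] of the pointwise error integrates over [K] to at most [delta / 2]. *)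
pose d1 := delta / 2 / (L + 1); have d10 : 0 < d1 by rewrite !divr_gt0.
have [e1 [C [e10 C0 CP]]] := weak_scalar_pointwise d10.
have [m m0 mP] := integral_nabla_le.
pose Q := C * (L + m); have Q0 : 0 <= Q by rewrite mulr_ge0// addr_ge0.
(* [e <= 1] gives [e ^+ 2 <= e], so the terms of order [e ^+ 2], whose total coefficient is [Q], are
   at most [delta / 2]. *)
pose e := Num.min 1 (Num.min e1 (delta / 2 / (Q + 1))).
have e0 : 0 < e by rewrite !lt_min ltr01 e10 !divr_gt0// ltr_wpDl.
exists e => // h hb.
pose F x := weak_scalar (h i) phi x - weak_scalar (g i) phi x.
have F0 x : ~ K x -> F x = 0 by move=> nKx; rewrite /F !(weak_scalar_out _ cK phi0 nKx) subrr.
have ih := weak_scalar_integrable h; have ig := weak_scalar_integrable g.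
have mF : measurable_fun setT (fun x : borel 'rV[R]_n => (F x)%:E).
  apply/measurable_EFinP; apply: measurable_funB; apply/measurable_EFinP.
    exact: measurable_int ih.
  exact: measurable_int ig.
rewrite -integralB_EFin//.
apply: le_trans (le_abse_integral _ _ mF) _ => //.
have -> : (\int[lam]_(x in setT) `|(F x)%:E| = \int[lam]_(x in K) `|(F x)%:E|)%E.
  rewrite [RHS]integral_mkcond; apply: eq_integral => x _; rewrite patchE.
  case: ifPn => // /negP nKx; rewrite F0 ?abse0//; apply: contra_not nKx.
  by rewrite inE.
pose N2 p := nabla_diff_norm g h p ^+ 2.
have mN : measurable_fun (K : set (borel 'rV[R]_n)) (fun x : borel 'rV[R]_n => (N2 (cinv (charts i) x))%:E).
  apply/measurable_EFinP; apply: (@measurable_funS _ _ _ _ (cimg (charts i) : set (borel 'rV[R]_n))) => //.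
  apply: (@measurableT_comp _ _ _ _ _ _ (N2 : borel M -> measurableTypeR R) _ _ _ (@measurable_cinv _ _ _ (charts i))).
  by apply: continuous_borel_measurable_real; exact: nabla_diff_norm_sqr_continuous.
apply: (@le_trans _ _ (\int[lam]_(x in K)
    ((d1 + C * e ^+ 2)%:E + C%:E * (N2 (cinv (charts i) x))%:E))%E).
  apply: ge0_le_integral => //.
  - by apply: measurable_funTS; exact: measurableT_comp mF.
  - by apply: emeasurable_funD; [exact: measurable_cst|exact: measurable_funeM].
  - move=> x Kx; rewrite /= -EFinM -EFinD lee_fin; apply: CP => //.
    by rewrite /e !ge_min lexx !orbT.
rewrite ge0_integralD//; first last.
- exact: measurable_funeM.
- by move=> x _; rewrite -EFinM lee_fin mulr_ge0// sqr_ge0.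
- by move=> x _; rewrite lee_fin addr_ge0// ?(ltW d10)// mulr_ge0// sqr_ge0.
rewrite integral_cst// ge0_integralZl//; last first.
  by move=> x _; rewrite lee_fin sqr_ge0.
apply: le_trans (leeD (lexx _) (lee_wpmul2l _ (mP h e e0 hb))) _; first by rewrite lee_fin.
suff : ((d1 + C * e ^+ 2)%:E * lam K + C%:E * (m * e ^+ 2)%:E <= delta%:E)%E by [].
rewrite -(fineK lamKf) -/L -!EFinM -EFinD lee_fin.
have ee : e ^+ 2 <= e by rewrite expr2 ler_piMl ?(ltW e0)// /e ge_min lexx.
have h1 : d1 * L <= delta / 2.
  by rewrite /d1 mulrAC ler_pdivrMr// ler_wpM2l ?lerDl// divr_ge0// ltW.
have h2 : Q * e <= delta / 2.
  apply: (@le_trans _ _ (Q * (delta / 2 / (Q + 1)))).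
    by rewrite ler_wpM2l// /e !ge_min lexx !orbT.
  rewrite mulrA ler_pdivrMr ?ltr_wpDl// mulrC ler_wpM2l ?lerDl//.
  by rewrite divr_ge0// ltW.
rewrite [leRHS]splitr.
rewrite [leLHS](_ : _ = d1 * L + Q * e ^+ 2); last by rewrite /Q; ring.
by apply: lerD => //; apply: le_trans h2; rewrite ler_wpM2l.
Qed.

End patch.

(** * Continuity of the total scalar curvature *)

Lemma lee_sum_near (R : realType) (I T : Type) (F : T -> I -> \bar R) (B : R -> set T) (x : T) :
  (forall e e', e <= e' -> B e `<=` B e') ->
  (forall i d, 0 < d -> exists2 e : R, 0 < e & forall y, B e y -> (F y i <= F x i + d%:E)%E) ->
  forall (r : seq I) (d : R), 0 < d -> exists2 e : R, 0 < e &
    forall y, B e y -> (\sum_(i <- r) F y i <= \sum_(i <- r) F x i + d%:E)%E.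
Proof.
move=> BS FB; elim=> [|i r IH] d d0.
  by exists 1 => // y _; rewrite !big_nil add0e lee_fin ltW.
have d20 : 0 < d / 2 by rewrite divr_gt0.
have [e1 e10 P1] := IH _ d20; have [e2 e20 P2] := FB i _ d20.
exists (Num.min e1 e2) => [|y yB]; first by rewrite lt_min e10.
rewrite !big_cons [d in leRHS]splitr EFinD addeACA.
apply: leeD; [apply: P2|apply: P1]; by apply: BS yB; rewrite ge_min lexx ?orbT.
Qed.

Section total.
Context {R : realType} {n : nat} {M : closed_manifold R n}.
Context (s : seq M) (psi : M -> M -> R) (K : M -> set 'rV[R]_n).
Local Notation c_ p := (charts (chart_at (p : M))).
Local Notation lam := (@lebesgue_rV R n).
Hypotheses (cK : forall p, compact (K p)) (KU : forall p, K p `<=` cimg (c_ p))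
  (Cpsi : forall p i, Ck 1 (cimg (charts i)) (psi p \o cinv (charts i)))
  (suppK : forall p q, psi p q != 0 -> cdom (c_ p) q /\ K p (cmap (c_ p) q))
  (sum1 : forall q, \sum_(p <- s) psi p q = 1).

Definition local_weight p : 'rV[R]_n -> R := (psi p \o cinv (c_ p)) \_ (cimg (c_ p)).

Lemma local_weight_out p x : ~ K p x -> local_weight p x = 0.
Proof.
move=> nKx; rewrite /local_weight patchE; case: ifPn => // /[!inE] px /=.
by apply/eqP; apply: contrapT => /negP /suppK[_]; rewrite cinvK.
Qed.

Lemma local_weight_C1 p : Ck 1 setT (local_weight p).
Proof.
have op := @cimg_openT _ _ _ (c_ p).
apply: (Ck_extend0 op (@cK p) (@KU p)); last exact: local_weight_out.
by apply: (Ck_ext op) (Cpsi p (chart_at p)) => x px; rewrite /local_weight patchE mem_set.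
Qed.

(** Provides a set of finite volume off which [psi p] vanishes, which makes the weighted curvature
    integrable. *)
Lemma compact_image_volume (g : riem_metric M) p :
  let S : set (borel M) := cinv (c_ p) @` K p in
  measurable S /\ (volume g S < +oo)%E.
Proof.
move=> S; have cS : compact (cinv (c_ p) @` K p).
  apply: continuous_compact (@cK p); apply: continuous_subspaceW (@KU p) _.
  exact: cinv_continuous.
have mS : measurable S.
  rewrite -[S]setCK; apply: measurableC; apply: open_borel_measurable.
  by apply: closed_openC; apply: compact_closed => //; exact: mf_hausdorff.
have SD : S `<=` cdom (c_ p) by move=> _ [x /KU px <-]; exact: cinv_dom.
split=> //; rewrite (volume_chart g mS SD).
have SE : S = cdom (c_ p) `&` cmap (c_ p) @^-1` K p.
  apply/seteqP; split=> [_ [x Kx <-]|q [pq Kq]].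
    by have px := KU Kx; split; [exact: cinv_dom|rewrite /= cinvK].
  by exists (cmap (c_ p) q) => //; rewrite cmapK.
rewrite SE chart_volume_preimage; last exact: KU.
have [C C0 CP] : exists2 C : R, 0 <= C & forall x, K p x -> `|sqdet g (chart_at p) x| <= C.
  apply: (compact_bound (@cK p)); apply: continuous_subspaceW (@KU p) _.
  rewrite continuous_open_subspace; last exact: cimg_openT.
  by move=> x /[!inE]; exact: sqdet_continuous.
have mK := measurable_compact_rV (@cK p).
apply: (@le_lt_trans _ _ (C%:E * lam (K p))%E).
  rewrite -integral_cst//; apply: ge0_le_integral => //.
  - by move=> x /KU px; rewrite lee_fin ltW// sqdet_gt0.
  - exact: measurable_sqdetS.
  - by move=> x Kx; rewrite lee_fin; apply: le_trans (ler_norm _) (CP x Kx).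
by apply: lte_mul_pinfty; rewrite ?lee_fin//; exact: lebesgue_rV_compact_lty.
Qed.

Lemma psi_continuous p : continuous (psi p).
Proof. by apply: chartwise_continuous => i; exact: Ck_pred (Cpsi p i). Qed.

Lemma weighted_curvature_continuous (g : riem_metric M) p :
  continuous (fun q : M => psi p q * scalar_curvature g q).
Proof.
move=> q; apply: continuousM; first exact: psi_continuous.
exact: scalar_curvature_continuous.
Qed.

Lemma weighted_curvature_integrable (g : riem_metric M) p :
  (volume g).-integrable setT (EFin \o (fun q => psi p q * scalar_curvature g q)).
Proof.
have [mS Soo] := compact_image_volume g p.
have wc : continuous (fun q : M => psi p q * scalar_curvature g q).
  exact: weighted_curvature_continuous.
have [C C0 CP] := compact_bound (@manifold_compact _ _ M) (continuous_subspaceT wc).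
apply: (bounded_support_integrable (M := C) mS Soo).
- exact: continuous_borel_measurable_real wc.
- by move=> q; exact: CP.
- move=> q nS; suff -> : psi p q = 0 by rewrite mul0r.
  apply/eqP; apply: contrapT => /negP /suppK[pq Kq]; apply: nS.
  by exists (cmap (c_ p) q) => //; rewrite cmapK.
Qed.

Definition weak_total (g : riem_metric M) p : \bar R :=
  (\int[lam]_(x in setT) (weak_scalar (g (chart_at p)) (local_weight p) x)%:E)%E.

(** [psi p] vanishes off the domain of the chart at [p], so the integral can be computed in this
    chart, where the volume has density [sqdet] and the weak form applies. *)
Lemma weighted_total (g : riem_metric M) p :
  (\int[volume g]_(q in setT) (psi p q * scalar_curvature g q)%:E = weak_total g p)%E.
Proof.
have op := @cimg_openT _ _ _ (c_ p).
rewrite /weak_total -(weak_form op (riem_metric_on g _) (local_weight_C1 p) (@cK p) (@KU p)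
  (@local_weight_out p)).
transitivity (\int[volume g]_(q in (cdom (c_ p) : set (borel M)))
    (psi p q * scalar_curvature g q)%:E)%E.
  rewrite [RHS]integral_mkcond; apply: eq_integral => q _; rewrite patchE.
  case: ifPn => // /negP; rewrite inE => npq; suff -> : psi p q = 0 by rewrite mul0r.
  by apply/eqP; apply: contrapT => /negP /suppK[].
rewrite integral_volume_chart; last first.
  by apply: continuous_borel_measurable_real; exact: weighted_curvature_continuous.
rewrite integral_mkcond; apply: eq_integral => x _; rewrite patchE.
rewrite /local_weight patchE; case: ifPn => [/[!inE] px|_]; last by rewrite mul0r.
by rewrite (scalar_curvature_chart g (cinv_dom px)) cinvK//= -mulrA [X in _ * X]mulrC.
Qed.

Lemma total_scalar_curvatureE (g : riem_metric M) :
  total_scalar_curvature g = (\sum_(p <- s) weak_total g p)%E.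
Proof.
rewrite -(eq_bigr _ (fun p _ => weighted_total g p)).
rewrite -(integral_sum measurableT (weighted_curvature_integrable g)).
apply: eq_integral => q _.
by rewrite sumEFin -mulr_suml sum1 mul1r.
Qed.

Lemma weak_total_fin (g : riem_metric M) p : weak_total g p \is a fin_num.
Proof.
apply: integrable_fin_num => //.
exact: weak_scalar_integrable (@cK p) (@KU p) (local_weight_C1 p) (@local_weight_out p) g.
Qed.

Lemma total_scalar_curvature_fin (g : riem_metric M) :
  total_scalar_curvature g \is a fin_num.
Proof.
rewrite total_scalar_curvatureE; elim/big_ind: _ => // [x y fx fy|p _].
  by rewrite fin_numD fx.
exact: weak_total_fin.
Qed.

(** The complement of a superlevel set is a strict sublevel set, so its openness asks for an upper
    bound of the nearby totals. *)
Lemma total_scalar_curvature_near (g : riem_metric M) (eps : R) : 0 < eps ->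
  exists2 e : R, 0 < e & forall h, C0W12_ball g e h ->
    (total_scalar_curvature h < total_scalar_curvature g + eps%:E)%E.
Proof.
move=> eps0; have e20 : 0 < eps / 2 by rewrite divr_gt0.
have ball_le e e' : e <= e' -> C0W12_ball g e `<=` C0W12_ball g e'.
  by move=> le h [h1 h2 h3]; split;
    [apply: lt_le_trans h1 _|apply: lt_le_trans h2 _|apply: lt_le_trans h3 _]; rewrite lee_fin.
have near p d : 0 < d -> exists2 e : R, 0 < e & forall h, C0W12_ball g e h ->
    (weak_total h p <= weak_total g p + d%:E)%E.
  move=> d0; have [e e0 eP] := weak_scalar_near g (@cK p) (@KU p) (@local_weight_C1 p)
    (@local_weight_out p) d0.
  exists e => // h /eP; have := weak_total_fin g p; rewrite /weak_total.
  set u := integral _ _ _; set v := integral _ _ _; move: u v => u v; clear => uf.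
  by move=> /(le_trans (lee_abs _)); rewrite leeBlDr// addeC.
have [e e0 eP] := lee_sum_near ball_le near s e20.
exists e => // h hb.
apply: (@le_lt_trans _ _ (total_scalar_curvature g + (eps / 2)%:E)%E).
  by rewrite (total_scalar_curvatureE h) (total_scalar_curvatureE g); exact: eP.
move: (total_scalar_curvature_fin g); generalize (total_scalar_curvature g) => u uf.
by rewrite lteD2lE// lte_fin ltr_pdivrMr// ltr_pMr// ltr1n.
Qed.

End total.

Theorem corollary1p1 (R : realType) (n : nat) (M : closed_manifold R n)
    (kappa : R) :
  closed [set g : metrics M | (kappa%:E <= total_scalar_curvature g)%E].
Proof.
have [s [psi [K [cKU Cpsi suppK sum1]]]] := @partition_of_unity R n M.
have cK p := (cKU p).1; have KU p := (cKU p).2.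
rewrite -openC.
suff : C0W12_open (~` [set g : metrics M | (kappa%:E <= total_scalar_curvature g)%E]) by [].
move=> g /= /negP; rewrite -ltNge => gk.
have tfin := total_scalar_curvature_fin cK KU Cpsi suppK sum1 g.
(* As the total is finite, its distance to [kappa] is a positive real, which serves as the error
   allowed for nearby metrics. *)
move: gk; rewrite -(fineK tfin) lte_fin -subr_gt0 => eps0.
have [e e0 eP] := total_scalar_curvature_near cK KU Cpsi suppK sum1 g eps0.
exists e => // h /eP; rewrite -(fineK tfin) -EFinD addrC subrK => hk.
by apply/negP; rewrite -ltNge.
Qed.
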